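(* Let $Z=(Z^1,\dots,Z^n)=X+iY$, with $X=(X^1,\dots,X^n)$, $Y=(Y^1,\dots,Y^n)$ real, be a $\mathbb{C}^n$-valued continuous conformal martingale starting at zero, on a filtered probability space satisfying the usual conditions, with the orthogonality property. Then for $p=2^k$, $k\in\mathbb{N}$, \[ \big\|\,\|Y\|_{\ell^2}\big\|_p\le\cot\Big(\frac{\pi}{2p}\Big)\big\|\,\|X\|_{\ell^2}\big\|_p . \]
   Context: A $\mathbb{C}$-valued continuous martingale $Z^k=X^k+iY^k$ is conformal if $\langle X^k\rangle_t=\langle Y^k\rangle_t$ and $\langle X^k,Y^k\rangle_t=0$ for all $t$; a $\mathbb{C}^n$-valued martingale is conformal if each coordinate is. It has the orthogonality property if $\langle Z^k,Z^j\rangle_t=0$ for all $j,k$ and $t$, where the bracket is complex bilinear: $\langle Z^k,Z^j\rangle=\langle X^k,X^j\rangle-\langle Y^k,Y^j\rangle+i(\langle X^k,Y^j\rangle+\langle Y^k,X^j\rangle)$. $\|X_t\|_{\ell^2}=(\sum_{k=1}^n|X^k_t|^2)^{1/2}$, and for a process $W$, $\|W\|_p=\sup_{t>0}\|W_t\|_{L^p(\mathbb{P})}$. *)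

(* Defs.v *)
From mathcomp Require Import all_boot all_order all_algebra.
From mathcomp Require Import all_classical all_reals all_analysis.
Set Implicit Arguments. Unset Strict Implicit. Unset Printing Implicit Defensive.
Import Order.TTheory GRing.Theory Num.Theory.
Import numFieldNormedType.Exports.
Local Open Scope classical_set_scope.
Local Open Scope ring_scope.

(** Time is [0, +oo) inside R; a process is a map  R -> T -> R
    (only times t >= 0 matter). A filtration is a map R -> set (set T). *)

Section Defs.
Context {d : measure_display} {T : measurableType d} {R : realType}.
Variable P : probability T R.

Definition usual_filtration (F : R -> set (set T)) : Prop :=
  [/\ (forall t, 0 <= t -> sigma_algebra setT (F t)),
      (forall t, 0 <= t -> F t `<=` measurable),
      (forall s t, 0 <= s -> s <= t -> F s `<=` F t),
      (forall t, 0 <= t -> F t = \bigcap_(s in [set s | t < s]) F s) &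
      (forall N, P.-negligible N -> F 0 N)].

Definition adapted (F : R -> set (set T)) (M : R -> T -> R) : Prop :=
  forall t, 0 <= t -> forall B : set R, measurable B -> F t (M t @^-1` B).

Definition cont_martingale0 (F : R -> set (set T)) (M : R -> T -> R) : Prop :=
  [/\ adapted F M,
      (forall t, 0 <= t -> P.-integrable setT (EFin \o M t)),
      (forall s t, 0 <= s -> s <= t -> forall A, F s A ->
          (\int[P]_(w in A) (M t w)%:E = \int[P]_(w in A) (M s w)%:E)%E),
      (forall w, {within [set t | 0 <= t], continuous (fun t => M t w)}) &
      (forall w, M 0 w = 0)].

Definition cvg_in_prob (S : nat -> T -> R) (L : T -> R) : Prop :=
  measurable_fun setT L /\
  forall eps : R, 0 < eps ->
    (fun m => P [set w | eps < `|S m w - L w|]) @ \oo --> 0%E.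

Definition dyadic_cov (A B : R -> T -> R) (t : R) (m : nat) (w : T) : R :=
  \sum_(k < 2 ^ m)
     (A (t * k.+1%:R / 2 ^+ m) w - A (t * k%:R / 2 ^+ m) w) *
     (B (t * k.+1%:R / 2 ^+ m) w - B (t * k%:R / 2 ^+ m) w).

Definition bracket_at (A B : R -> T -> R) (t : R) (L : T -> R) : Prop :=
  cvg_in_prob (dyadic_cov A B t) L.

End Defs.

Definition l2norm {T : Type} {R : realType} (n : nat)
  (M : 'I_n -> R -> T -> R) (t : R) (w : T) : R :=
  Num.sqrt (\sum_(k < n) (M k t w) ^+ 2).

Definition cot {R : realType} (x : R) : R := cos x / sin x.

(* Main.v *)
Require Import Defs.
From mathcomp Require Import all_boot all_order all_algebra.
From mathcomp Require Import all_classical all_reals all_analysis.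
From mathcomp Require Import measurable_realfun ring lra.

(* With [Q = sum_j (Z^j)^2 = |X|^2 - |Y|^2 + 2i X.Y], the half-angle formula
   [cot (x/2) = cot x + sqrt (1 + cot^2 x)] gives, by induction on [k], a pointwise inequality
   [|Y|^p <= cot^p (pi/2p) |X|^p + B Re (Q^(p/2))]. By orthogonality [Q^(p/2)] is a local martingale
   starting at 0, so the last term disappears in expectation.

   The martingale property is obtained without stochastic integrals, on the dyadic grids of [[0, t]].
   The discrete martingale is stopped when it or its quadratic variation becomes large, and single
   increments above 1 are dropped; by continuity of the paths this costs an asymptotically negligible
   drift. A martingale transform with small coefficients is uniformly small with high probability;
   applied to the lag of a grid behind a coarser one, this compares the bracket sums of different
   grids and shows that those of [Z^j, Z^l] vanish uniformly in time along one grid. Bounded discrete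
   processes that are asymptotically driftless and have vanishing brackets with every [Z^j] are then
   closed under sums and under multiplication by [Z^j], hence contain the powers of [Q]. *)
Set Implicit Arguments. Unset Strict Implicit. Unset Printing Implicit Defensive.
Import Order.TTheory GRing.Theory Num.Theory.
Import numFieldNormedType.Exports.
Local Open Scope classical_set_scope.
Local Open Scope ring_scope.

(** * The pointwise inequality *)

(** Integrability shapes the argument. The coordinates are only known to be integrable, and a
    bracket is only a limit in probability at one fixed time. Stopping at level [K] replaces $L^2$
    theory by the deterministic bound [K + 1] on each coordinate and on the sum of squared
    increments. The drift created by dropping a large increment is charged to $|Z^a_t| + K$ on the
    event that some increment exceeds 1, so one integrable function per coordinate dominates it on
    all grids. The stopping index depends on the path, which is why bracket sums must vanish
    uniformly in time and not just at $t$. The moment of $|Y|$ is not known to be finite beforehand: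
    its truncation at [L] is estimated, then [L] tends to infinity. The parameters are fixed in the
    order [L], [K], grid: [K] makes [L] times the probability of stopping small, and the grid makes
    the errors depending on [K] small. The moment of $|X|$ may be assumed finite; its stopped
    version is compared with the terminal one by convexity, again up to the drift. *)

Section PointwiseInequality.
Variable R : realType.
Implicit Types (z w : R * R) (x y u v : R).

Definition cmul z w : R * R :=
  (z.1 * w.1 - z.2 * w.2, z.1 * w.2 + z.2 * w.1).

Definition cpow z m : R * R := iter m (cmul z) (1, 0).

Lemma cmulA z1 z2 z3 : cmul z1 (cmul z2 z3) = cmul (cmul z1 z2) z3.
Proof. by rewrite /cmul /=; congr pair; ring. Qed.

Lemma cpow_mul2 z m : cpow z (2 * m) = cpow (cmul z z) m.
Proof.
elim: m => [|m IH] //.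
by rewrite mulnS !addSn add0n /cpow /= -/(cpow _ _) IH cmulA.
Qed.

Lemma cpowN z m :
  cpow (- z.1, - z.2) m = ((-1) ^+ m * (cpow z m).1, (-1) ^+ m * (cpow z m).2).
Proof.
elim: m => [|m IH]; first by rewrite /cpow /= expr0 mul1r mulr0.
rewrite /cpow /= -!/(cpow _ _) IH /cmul /= exprS.
by congr pair; ring.
Qed.

(** Induction on [m]: multiplying the bound for [m] by [l * a + (1 - l) * b] leaves the defect
    $l(1-l)(a-b)(a^m-b^m)$, whose last two factors have the same sign. *)
Lemma expr_convex m (l a b : R) : 0 <= l <= 1 -> 0 <= a -> 0 <= b ->
  (l * a + (1 - l) * b) ^+ m <= l * a ^+ m + (1 - l) * b ^+ m.
Proof.
move=> /andP[l0 l1] a0 b0; elim: m => [|m IH]; first by rewrite !expr0; lra.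
rewrite !exprS.
have h : (l * a + (1 - l) * b) * (l * a + (1 - l) * b) ^+ m <=
   (l * a + (1 - l) * b) * (l * a ^+ m + (1 - l) * b ^+ m).
  by apply: ler_wpM2l => //; nra.
apply: (le_trans h); rewrite -subr_ge0.
rewrite (_ : _ - _ = l * (1 - l) * ((a - b) * (a ^+ m - b ^+ m))); last ring.
apply: mulr_ge0; first nra.
case: (lerP a b) => ab; last first.
  apply: mulr_ge0; first by rewrite subr_ge0 ltW.
  by rewrite subr_ge0 lerXn2r ?nnegrE// ltW.
apply: mulr_le0; first by rewrite subr_le0.
by rewrite subr_le0 lerXn2r ?nnegrE.
Qed.

(** These are the cotangents of $\pi/4, \pi/8, \dots$, generated by the half-angle formula; the
    algebraic recursion is the form that the induction on the exponent consumes. *)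
Fixpoint bestc (k : nat) : R :=
  if k is k'.+1 then bestc k' + Num.sqrt (1 + bestc k' ^+ 2) else 1.

Lemma bestc_gt0 k : 0 < bestc k.
Proof. by elim: k => [|k IH] //=; rewrite ltr_wpDr ?sqrtr_ge0. Qed.

Lemma cot_bestc k : cot (pi / (2 * 2 ^+ k.+1)) = bestc k :> R.
Proof.
have bnd m : 0 < (pi : R) / (2 * 2 ^+ m.+1) < pi / 2.
  have p0 := pi_gt0 R.
  apply/andP; split; first by rewrite divr_gt0// mulr_gt0// exprn_gt0.
  rewrite ltr_pM2l// ltf_pV2 ?posrE ?mulr_gt0 ?exprn_gt0//.
  by rewrite ltr_pMr// exprn_egt1// ltr1n.
elim: k => [|k IH] /=.
  rewrite /cot (_ : 2 * 2 ^+ 1 = 4 :> R); last ring.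
  set x := pi / 4.
  have xx : x *+ 2 = pi / 2 by rewrite /x -mulr_natr; field.
  have s0 : 0 < sin x.
    by rewrite sin_gt0_pi//; have p0 := pi_gt0 R; rewrite /x; lra.
  have c0 : 0 < cos x.
    by apply: cos_gt0_pihalf; have p0 := pi_gt0 R; rewrite /x; lra.
  have := cos_mulr2n x; rewrite xx cos_pihalf => h.
  have h2 := cos2Dsin2 x.
  have : (cos x - sin x) * (cos x + sin x) = 0 by lra.
  move/eqP; rewrite mulf_eq0 => /orP[|] /eqP h3; last lra.
  by rewrite (_ : cos x = sin x) ?divff//; lra.
set x := pi / (2 * 2 ^+ k.+2).
have xx : x *+ 2 = pi / (2 * 2 ^+ k.+1).
  by rewrite /x -mulr_natr [in LHS]exprS; field; rewrite expf_neq0.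
rewrite -IH /cot -xx sin_mulr2n cos_mulr2n.
have /andP[x0 x1] := bnd k.+1; rewrite -/x in x0 x1.
have p0 := pi_gt0 R.
have s0 : 0 < sin x by rewrite sin_gt0_pi//; lra.
have c0 : 0 < cos x by apply: cos_gt0_pihalf; lra.
have h2 := cos2Dsin2 x.
set c := cos x in c0 h2 *; set s := sin x in s0 h2 *.
(* With [c] and [s] the cosine and sine of [x], this is $\sqrt{1+\cot^2 2x} = 1/\sin 2x$; the sign
   is right because [x] lies in $(0,\pi/2)$. *)
have -> : Num.sqrt (1 + ((c ^+ 2 *+ 2 - 1) / (c * s *+ 2)) ^+ 2) = 1 / (c * s *+ 2).
  rewrite (_ : 1 + _ = (1 / (c * s *+ 2)) ^+ 2).
    by rewrite sqrtr_sqr ger0_norm// divr_ge0// mulrn_wge0// mulr_ge0 ?ltW.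
  have e : (c ^+ 2 *+ 2 - 1) ^+ 2 = 1 - 4 * c ^+ 2 * s ^+ 2.
    by rewrite (_ : s ^+ 2 = 1 - c ^+ 2); [ring|lra].
  rewrite !expr_div_n e; field.
  by rewrite !gt_eqF.
rewrite -mulrDl subrK; field.
by rewrite !gt_eqF.
Qed.

(** The relation $C - 1/C = 2c$ makes $x^2+|u|$, a bound for $y^2$, the average of $C^2x^2$ and
    $\frac{C}{2c}|u|$ with weights [l] and [1 - l]. Then come convexity, the hypothesis on [u ^+ p],
    and $C^p x^p y^p \le (C^{2p}x^{2p}+y^{2p})/2$, whose [y] term is absorbed on the left. The
    convexity and mean inequalities are equalities at $y = Cx$, so the constant is not degraded. *)
Lemma bestc_step (c C l : R) (p : nat) (B : R) (x y u v w : R) :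
  0 < c -> C = c + Num.sqrt (1 + c ^+ 2) -> ~~ odd p ->
  0 <= x -> 0 <= y -> u = x ^+ 2 - y ^+ 2 -> `|v| <= 2 * (x * y) ->
  u ^+ p <= c ^+ p * v ^+ p + B * w ->
  l = (C ^+ 2)^-1 ->
  y ^+ (2 * p) <= C ^+ (2 * p) * x ^+ (2 * p)
    + (2 / (1 + l) * ((1 - l) * (C / (2 * c)) ^+ p * B)) * w.
Proof.
move=> c0 CE ep x0 y0 uE hv hu lE.
have q0 : 0 <= 1 + c ^+ 2 by rewrite addr_ge0 ?sqr_ge0.
have sq := sqr_sqrtr q0; have s0 := sqrtr_ge0 (1 + c ^+ 2).
have C2 : C ^+ 2 = 1 + 2 * c * C by rewrite CE; ring: sq.
have C0 : 0 < C by rewrite CE ltr_wpDr.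
have C21 : 1 < C ^+ 2 by rewrite C2 ltrDl !mulr_gt0.
have l0 : 0 < l by rewrite lE invr_gt0; lra.
have l1 : l < 1 by rewrite lE invf_lt1//; lra.
have lC : l * C ^+ 2 = 1 by rewrite lE mulVf// gt_eqF//; lra.
have up : u ^+ p = `|u| ^+ p by rewrite -normrX ger0_norm// exprn_even_ge0.
have vp : v ^+ p <= 2 ^+ p * (x ^+ p * y ^+ p).
  rewrite -!exprMn.
  by rewrite -[leLHS]ger0_norm ?exprn_even_ge0// normrX lerXn2r ?nnegrE ?mulr_ge0.
have h1 : y ^+ (2 * p) <= (x ^+ 2 + `|u|) ^+ p.
  rewrite exprM lerXn2r ?nnegrE ?addr_ge0 ?sqr_ge0//.
  by have := ler_norm (- u); rewrite normrN uE; lra.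
have d0 : 0 < C / (2 * c) by rewrite divr_gt0// mulr_gt0.
have h2 : (x ^+ 2 + `|u|) ^+ p <= l * (C ^+ 2 * x ^+ 2) ^+ p
   + (1 - l) * (C / (2 * c) * `|u|) ^+ p.
  have e1 : (1 - l) * (C / (2 * c)) = 1.
    have e' : (1 - l) * C = 2 * c.
      apply: (mulIf (lt0r_neq0 C0)).
      by rewrite -mulrA -expr2 mulrBl lC mul1r C2; ring.
    by rewrite mulrA e' divff// gt_eqF// mulr_gt0.
  rewrite [X in X ^+ p <= _](_ : _ = l * (C ^+ 2 * x ^+ 2) + (1 - l) * (C / (2 * c) * `|u|)).
    apply: expr_convex; first by rewrite !ltW.
      by rewrite mulr_ge0 ?sqr_ge0.
    by rewrite mulr_ge0 ?(ltW d0).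
  by rewrite mulrA lC mul1r mulrA e1 mul1r.
have cp : 0 <= c ^+ p by rewrite exprn_ge0// ltW.
have h3 : `|u| ^+ p <= (2 * c) ^+ p * (x ^+ p * y ^+ p) + B * w.
  rewrite -up (le_trans hu)// lerD2r.
  have -> : (2 * c) ^+ p = c ^+ p * 2 ^+ p by rewrite exprMn mulrC.
  by rewrite -mulrA ler_wpM2l.
have h4 : C ^+ p * (x ^+ p * y ^+ p) <= 2^-1 * (C ^+ (2 * p) * x ^+ (2 * p) + y ^+ (2 * p)).
  rewrite ![(2 * p)%N]mulnC !exprM.
  by have := sqr_ge0 (C ^+ p * x ^+ p - y ^+ p); nra.
have h5 : (C / (2 * c) * `|u|) ^+ p <= C ^+ p * (x ^+ p * y ^+ p) + (C / (2 * c)) ^+ p * (B * w).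
  have := ler_wpM2l (exprn_ge0 p (ltW d0)) h3.
  by rewrite mulrDr [_ * (_ * (_ * _))]mulrA -!exprMn divfK// gt_eqF// mulr_gt0.
have h6 : y ^+ (2 * p) <= l * (C ^+ (2 * p) * x ^+ (2 * p)) + (1 - l) *
   (2^-1 * (C ^+ (2 * p) * x ^+ (2 * p) + y ^+ (2 * p)) + (C / (2 * c)) ^+ p * (B * w)).
  apply: (le_trans h1); apply: (le_trans h2).
  rewrite exprMn -!exprM.
  rewrite lerD2l ler_wpM2l//; first by rewrite subr_ge0 ltW.
  by apply: (le_trans h5); rewrite lerD2r.
(* After half of [(1 - l) * y ^+ (2 * p)] is absorbed, both main terms carry the factor $1 - (1-l)/2
   = l + (1-l)/2 = (1+l)/2$. *)
rewrite -(@ler_pM2l _ ((1 + l) / 2)); last by rewrite divr_gt0// addr_gt0.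
have -> : (1 + l) / 2 * (C ^+ (2 * p) * x ^+ (2 * p) +
  2 / (1 + l) * ((1 - l) * (C / (2 * c)) ^+ p * B) * w) =
  (1 + l) / 2 * (C ^+ (2 * p) * x ^+ (2 * p)) + (1 - l) * ((C / (2 * c)) ^+ p * (B * w)).
  by field; rewrite gt_eqF// addr_gt0.
move: h6; set Y := y ^+ _; set X := C ^+ _ * _; set W := _ ^+ p * _.
lra.
Qed.

(* The scalar inequality at level [k], applied to [-i Q], gives the vector one at level [k.+1]. *)
Lemma even_power_inequality k : exists B : R, forall x y u v,
  0 <= x -> 0 <= y -> u = x ^+ 2 - y ^+ 2 -> `|v| <= 2 * (x * y) ->
  y ^+ (2 ^ k.+1) <= bestc k ^+ (2 ^ k.+1) * x ^+ (2 ^ k.+1)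
    + B * (cpow (u, v) (2 ^ k)).1.
Proof.
elim: k => [|k [B IH]].
  (* The base case is the identity $y^2 = x^2 - \mathrm{Re}\,Q$. *)
  exists (-1) => x y u v x0 y0 -> hv.
  by rewrite expr1n /cpow /cmul /=; lra.
set c := bestc k; set C := bestc k.+1; set l := (C ^+ 2)^-1.
exists (2 / (1 + l) * ((1 - l) * (C / (2 * c)) ^+ (2 ^ k.+1) * (B * (-1) ^+ (2 ^ k)))).
move=> x y u v x0 y0 uE hv.
rewrite [in X in X <= _]expnS [in X in _ <= X * _ + _]expnS [X in _ <= _ * x ^+ X + _]expnS.
apply: (@bestc_step c C l (2 ^ k.+1) _ x y u v) => //.
- exact: bestc_gt0.
- by rewrite expnS oddM.
have ev s : s ^+ (2 ^ k.+1) = `|s| ^+ (2 ^ k.+1) :> R.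
  by rewrite -normrX ger0_norm// exprn_even_ge0// expnS oddM.
rewrite (ev u) (ev v).
(* Since $-iQ = v - iu$, the moduli of [v] and [u] take the places of [x] and [y], and the pair
   supplied is $(-iQ)^2 = -Q^2$. *)
have h := IH `|v| `|u| (v ^+ 2 - u ^+ 2) (- (2 * (u * v))).
apply: le_trans (h _ _ _ _) _ => //; first by rewrite !real_normK ?num_real.
  by rewrite normrN !normrM (@ger0_norm _ 2)// [`|u| * _]mulrC.
rewrite lerD2l [in leRHS]expnS cpow_mul2.
have -> : (v ^+ 2 - u ^+ 2, - (2 * (u * v))) =
  (- (cmul (u, v) (u, v)).1, - (cmul (u, v) (u, v)).2).
  by rewrite /cmul /=; congr pair; ring.
by rewrite cpowN /= mulrA.
Qed.

End PointwiseInequality.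

(** * Probabilistic preliminaries *)

Section AdaptedFunctions.
Context {d : measure_display} {T : measurableType d} {R : realType}.
Implicit Types (G H : set (set T)).

Definition measurable_wrt {d'} {U : measurableType d'} G (h : T -> U) : Prop :=
  forall B, measurable B -> G (h @^-1` B).

(** A filtration is a bare family of sets. Passing to the type that carries the sigma-algebra
    generated by [G], which is [G] itself, makes measurability with respect to [G] ordinary
    measurability. *)
Lemma measurable_wrtP {d'} {U : measurableType d'} G (h : T -> U) :
  sigma_algebra setT G ->
  measurable_wrt G h <-> measurable_fun (setT : set (g_sigma_algebraType G)) h.
Proof.
move=> sG; split=> [hh _ B mB|hh B mB].
  by rewrite setTI; apply: sub_sigma_algebra; exact: hh.
have := hh measurableT B mB; rewrite setTI /measurable /=.
by rewrite sigma_algebra_id.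
Qed.

Lemma measurable_wrt_sub {d'} {U : measurableType d'} G H (h : T -> U) :
  G `<=` H -> measurable_wrt G h -> measurable_wrt H h.
Proof. by move=> GH hG B mB; apply/GH/hG. Qed.

Lemma measurable_wrt_measurable {d'} {U : measurableType d'} G (h : T -> U) :
  G `<=` measurable -> measurable_wrt G h -> measurable_fun setT h.
Proof. by move=> GH hG _ B mB; rewrite setTI; exact/GH/hG. Qed.

Variable G : set (set T).
Hypothesis sG : sigma_algebra setT G.

Lemma measurable_wrt_cst {d'} {U : measurableType d'} (c : U) : measurable_wrt G (fun _ => c).
Proof. by apply/measurable_wrtP. Qed.

Lemma measurable_wrtD (f g : T -> R) :
  measurable_wrt G f -> measurable_wrt G g -> measurable_wrt G (fun w => f w + g w).
Proof.
move=> /(measurable_wrtP _ sG) mf /(measurable_wrtP _ sG) mg; apply/measurable_wrtP => //.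
exact: measurable_funD.
Qed.

Lemma measurable_wrtB (f g : T -> R) :
  measurable_wrt G f -> measurable_wrt G g -> measurable_wrt G (fun w => f w - g w).
Proof.
move=> /(measurable_wrtP _ sG) mf /(measurable_wrtP _ sG) mg; apply/measurable_wrtP => //.
exact: measurable_funB.
Qed.

Lemma measurable_wrtM (f g : T -> R) :
  measurable_wrt G f -> measurable_wrt G g -> measurable_wrt G (fun w => f w * g w).
Proof.
move=> /(measurable_wrtP _ sG) mf /(measurable_wrtP _ sG) mg; apply/measurable_wrtP => //.
exact: measurable_funM.
Qed.

Lemma measurable_wrtX (f : T -> R) m :
  measurable_wrt G f -> measurable_wrt G (fun w => f w ^+ m).
Proof.
move=> /(measurable_wrtP _ sG) mf; apply/measurable_wrtP => //.
exact: measurable_funX.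
Qed.

Lemma measurable_wrt_norm (f : T -> R) :
  measurable_wrt G f -> measurable_wrt G (fun w => `|f w|).
Proof.
move=> /(measurable_wrtP _ sG) mf; apply/measurable_wrtP => //.
exact: measurableT_comp.
Qed.

Lemma measurable_wrt_sum (I : Type) (s : seq I) (f : I -> T -> R) :
  (forall i, measurable_wrt G (f i)) ->
  measurable_wrt G (fun w => \sum_(i <- s) f i w).
Proof.
move=> mf; apply/measurable_wrtP => //.
apply: measurable_sum => i; exact/measurable_wrtP.
Qed.

Lemma measurable_wrt_le (f g : T -> R) :
  measurable_wrt G f -> measurable_wrt G g -> measurable_wrt G (fun w => f w <= g w).
Proof.
move=> /(measurable_wrtP _ sG) mf /(measurable_wrtP _ sG) mg; apply/measurable_wrtP => //.
exact: measurable_fun_ler.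
Qed.

Lemma measurable_wrt_and (f g : T -> bool) :
  measurable_wrt G f -> measurable_wrt G g -> measurable_wrt G (fun w => f w && g w).
Proof.
move=> /(measurable_wrtP _ sG) mf /(measurable_wrtP _ sG) mg; apply/measurable_wrtP => //.
exact: measurable_and.
Qed.

Lemma measurable_wrt_neg (f : T -> bool) :
  measurable_wrt G f -> measurable_wrt G (fun w => ~~ f w).
Proof.
move=> /(measurable_wrtP _ sG) mf; apply/measurable_wrtP => //.
exact: measurable_neg.
Qed.

Lemma measurable_wrt_forall (I : finType) (f : I -> T -> bool) :
  (forall i, measurable_wrt G (f i)) -> measurable_wrt G (fun w => [forall i, f i w]).
Proof.
move=> mf; rewrite (_ : (fun w => _) = (fun w => all (f^~ w) (enum I))); last first.
  apply/funext => w; apply/forallP/allP => h i //.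
  by apply: h; rewrite mem_enum.
elim: (enum I) => [|i s IH] /=; first exact: measurable_wrt_cst.
exact: measurable_wrt_and.
Qed.

Lemma measurable_wrt_indicator (b : T -> bool) :
  measurable_wrt G b -> measurable_wrt G (fun w => (b w)%:R : R).
Proof.
move=> mb; rewrite (_ : (fun w => _) = (fun w => if b w then 1 else 0 : R)); last first.
  by apply/funext => w; case: (b w).
move/(measurable_wrtP _ sG): mb => mb; apply/measurable_wrtP => //.
by apply: measurable_fun_ifT.
Qed.

Lemma measurable_wrt_pred (b : T -> bool) : measurable_wrt G b -> G [set w | b w].
Proof.
move=> mb; rewrite (_ : [set w | b w] = b @^-1` [set true]); first exact: mb.
by apply/seteqP; split => w /=; case: (b w).
Qed.


End AdaptedFunctions.

Section Expectation.
Context {d : measure_display} {T : measurableType d} {R : realType}.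
Variable P : probability T R.
Implicit Types (f g h : T -> R).

Definition intble f := P.-integrable setT (EFin \o f).
Definition Ex f : R := \int[P]_w f w.

Lemma bounded_near h (D : set T) (C : R) : (forall w, `|h w| <= C) -> [bounded h x | x in D].
Proof.
move=> hC; exists C; split; first exact: num_real.
by move=> M CM w _; apply: le_trans (hC w) (ltW CM).
Qed.

Lemma intble_bounded h (C : R) : measurable_fun setT h -> (forall w, `|h w| <= C) -> intble h.
Proof.
move=> mh hC; apply: measurable_bounded_integrable => //.
  by rewrite (le_lt_trans (probability_le1 P measurableT)) ?ltry.
exact: bounded_near hC.
Qed.

Lemma intbleM h f (C : R) : measurable_fun setT h -> (forall w, `|h w| <= C) -> intble f ->
  intble (fun w => h w * f w).
Proof.
move=> mh hC fi.
have := integrableMr measurableT mh (bounded_near setT hC) fi.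
by apply: eq_integrable => // w _ /=; rewrite EFinM.
Qed.

Lemma intble_measurable f : intble f -> measurable_fun setT f.
Proof. by move=> fi; apply/measurable_EFinP; exact: measurable_int fi. Qed.

Lemma intble_cst c : intble (fun _ => c).
Proof. by apply: (@intble_bounded _ `|c|). Qed.

Lemma intbleD f g : intble f -> intble g -> intble (fun w => f w + g w).
Proof.
move=> fi gi; have := integrableD measurableT fi gi.
by apply: eq_integrable => // w _ /=; rewrite EFinD.
Qed.

Lemma intbleB f g : intble f -> intble g -> intble (fun w => f w - g w).
Proof.
move=> fi gi; have := integrableB measurableT fi gi.
by apply: eq_integrable => // w _ /=; rewrite EFinB.
Qed.

Lemma intbleZ c f : intble f -> intble (fun w => c * f w).
Proof. by move=> fi; apply: (@intbleM _ _ `|c|). Qed.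

Lemma intble_norm f : intble f -> intble (fun w => `|f w|).
Proof.
move=> fi; have := integrable_abse fi.
by apply: eq_integrable => // w _ /=; rewrite abse_EFin.
Qed.

Lemma intble_sum (I : Type) (s : seq I) (f : I -> T -> R) :
  (forall i, intble (f i)) -> intble (fun w => \sum_(i <- s) f i w).
Proof.
move=> fi; elim: s => [|i s IH].
  have := intble_cst 0; apply: eq_integrable => // w _ /=.
  by rewrite big_nil.
have := intbleD (fi i) IH; apply: eq_integrable => // w _ /=.
by rewrite big_cons.
Qed.

Lemma ExD f g : intble f -> intble g -> Ex (fun w => f w + g w) = Ex f + Ex g.
Proof. by move=> fi gi; apply: RintegralD. Qed.

Lemma ExB f g : intble f -> intble g -> Ex (fun w => f w - g w) = Ex f - Ex g.
Proof. by move=> fi gi; apply: RintegralB. Qed.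

Lemma ExZ c f : intble f -> Ex (fun w => c * f w) = c * Ex f.
Proof. by move=> fi; apply: RintegralZl. Qed.

Lemma Ex_cst c : Ex (fun _ => c) = c.
Proof.
rewrite /Ex Rintegral_cst// -[RHS]mulr1; congr (_ * _).
by rewrite -[RHS]/(fine 1%E); congr fine; exact: probability_setT.
Qed.

Lemma Ex_sum (I : Type) (s : seq I) (f : I -> T -> R) : (forall i, intble (f i)) ->
  Ex (fun w => \sum_(i <- s) f i w) = \sum_(i <- s) Ex (f i).
Proof.
move=> fi; elim: s => [|i s IH].
  rewrite big_nil -[RHS](Ex_cst 0); congr Ex.
  by apply/funext => w; rewrite big_nil.
rewrite big_cons -IH -ExD//; last exact: intble_sum.
by congr Ex; apply/funext => w; rewrite big_cons.
Qed.

Lemma le_Ex f g : intble f -> intble g -> (forall w, f w <= g w) -> Ex f <= Ex g.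
Proof. by move=> fi gi fg; apply: le_Rintegral. Qed.

Lemma Ex_ge0 f : (forall w, 0 <= f w) -> 0 <= Ex f.
Proof. by move=> f0; apply: Rintegral_ge0. Qed.

Lemma le_norm_Ex f : intble f -> `|Ex f| <= Ex (fun w => `|f w|).
Proof. by move=> fi; apply: le_normr_Rintegral. Qed.

Lemma Ex_indicator (A : set T) : measurable A -> Ex (\1_A : T -> R) = fine (P A).
Proof. by move=> mA; rewrite /Ex /Rintegral integral_indic// setIT. Qed.

Lemma intble_indicator (A : set T) : measurable A -> intble (\1_A : T -> R).
Proof.
move=> mA; apply: (@intble_bounded _ 1); first exact: measurable_indic.
by move=> w; rewrite indicE; case: (_ \in _); rewrite ?normr1 ?normr0.
Qed.

Lemma dominated_Ex0 (f : nat -> T -> R) g (N : set T) :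
  (forall n, measurable_fun setT (f n)) -> intble g ->
  (forall n w, `|f n w| <= g w) -> P.-negligible N ->
  (forall w, ~ N w -> (fun n => f n w) @ \oo --> (0 : R)) ->
  (fun n => Ex (f n)) @ \oo --> (0 : R).
Proof.
move=> mf gi fg Nn f0.
have aeN : \forall x \ae P, ~ N x.
  by apply: negligibleS Nn => w /= /contrapT.
have [_ _] : [/\ P.-integrable setT (EFin \o cst 0 : T -> \bar R),
    (fun n => \int[P]_x (`|(f n x)%:E - 0%:E|))%E @ \oo --> 0%E &
    (fun n => \int[P]_x (f n x)%:E)%E @ \oo --> (\int[P]_x (0 : R)%:E)%E].
  apply: (@dominated_convergence _ T R P setT measurableT
    (fun n x => (f n x)%:E) (fun=> 0%:E) (EFin \o g)) => //.
  - by move=> n; apply/measurable_EFinP.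
  - apply: filterS aeN => w Nw _.
    by apply: cvg_EFin; [exact: nearW|exact: f0].
  - by apply: aeW => w n _; rewrite /= lee_fin.
rewrite integral0 => /fine_cvg.
by [].
Qed.

Lemma Ex_mulP (A : set T) f : measurable A -> intble f ->
  Ex (fun w => \1_A w * f w) = \int[P]_(w in A) f w.
Proof.
move=> mA fi; rewrite Rintegral_mkcond; congr Ex; apply/funext => w.
by rewrite patchE indicE; case: (w \in A); rewrite ?mul1r ?mul0r.
Qed.

End Expectation.

Lemma pow2_gt (R : realType) (x : R) : exists m, x < 2 ^+ m.
Proof.
exists (Num.truncn x).+1; apply: lt_le_trans (truncnS_gt _) _.
by rewrite -natrX ler_nat ltnW// ltn_expl.
Qed.

Section Multiplier.
Context {d : measure_display} {T : measurableType d} {R : realType}.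
Variable P : probability T R.

(** The pull-out property of conditional expectation, stated without conditional expectations.
    Repeated halving of the bound on [h] gives $|E(hD)| \le C\,2^{-m} E|D|$ for every [m]. *)
Lemma Ex_orthogonal (G : set (set T)) (D h : T -> R) (C : R) :
  sigma_algebra setT G -> G `<=` measurable -> intble P D ->
  (forall A, G A -> Ex P (fun w => \1_A w * D w) = 0) ->
  measurable_wrt G h -> (forall w, `|h w| <= C) ->
  Ex P (fun w => h w * D w) = 0.
Proof.
move=> sG GM Di D0 mh hC.
(* Nonnegativity of [C] needs a point of [T], which exists because the total mass is one. *)
have C0 : 0 <= C.
  by have [w|e] := pselect (exists w : T, True); [case: w => w _; exact: le_trans (hC w)|
    exfalso; have := probability_setT P; rewrite (_ : [set: T] = set0) ?measure0;
     [move=> /eqP; rewrite eqe eq_sym oner_eq0|apply/seteqP; split => // w _; apply: e; exists w]].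
(* Splitting off [C/2] times the sign of [h] halves the bound on [h] and does not change the expectation. *)
have step m : forall (h : T -> R) (C : R), measurable_wrt G h -> 0 <= C -> (forall w, `|h w| <= C) ->
   `|Ex P (fun w => h w * D w)| <= C / 2 ^+ m * Ex P (fun w => `|D w|).
  elim: m => [|m IH] {mh hC C0}h {}C mh C0 hC.
    have mh' := measurable_wrt_measurable GM mh.
    rewrite expr0 divr1 -ExZ; last exact: intble_norm.
    apply: le_trans (le_norm_Ex (intbleM mh' hC Di)) _.
    apply: le_Ex.
    - exact/intble_norm/(intbleM mh' hC).
    - exact/intbleZ/intble_norm.
    - by move=> w; rewrite normrM ler_wpM2r.
  pose A := [set w | 0 <= h w].
  have GA : G A by apply: (measurable_wrt_pred (b := fun w => 0 <= h w));
    apply: measurable_wrt_le => //; exact: measurable_wrt_cst.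
  pose s w : R := C * (\1_A w - 2^-1).
  have ms : measurable_wrt G s.
    apply: measurable_wrtM => //; first exact: measurable_wrt_cst.
    apply: measurable_wrtB => //; last exact: measurable_wrt_cst.
    rewrite (_ : \1_A = fun w => (0 <= h w)%R%:R).
      apply: measurable_wrt_indicator => //; apply: measurable_wrt_le => //; exact: measurable_wrt_cst.
    by apply/funext => w; rewrite indicE; congr (_ %:R); congr nat_of_bool; apply/idP/idP; rewrite inE.
  have hs w : `|h w - s w| <= C / 2.
    rewrite /s indicE; move: (hC w); rewrite !ler_norml => /andP[h1 h2].
    by case: (boolP (w \in A)); [rewrite inE|rewrite notin_setE] => /=; rewrite /A /=;
     [|move/negP; rewrite -ltNge] => h3; apply/andP; split; lra.
  have D2 : Ex P (fun w => 2^-1 * D w) = 0.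
    rewrite ExZ// (_ : Ex P D = 0) ?mulr0// -[RHS](D0 setT); last first.
      by rewrite -[setT]setD0; case: sG => G0 GC _; apply: GC.
    by congr Ex; apply/funext => w; rewrite indicT mul1r.
  have es : Ex P (fun w => s w * D w) = 0.
    rewrite (_ : (fun w => _) = fun w => C * (\1_A w * D w - 2^-1 * D w)); last first.
      by apply/funext => w; rewrite /s; ring.
    have AD : intble P (fun w => \1_A w * D w).
      apply: (@intbleM _ _ _ P _ _ 1) => //; first exact/measurable_indic/GM.
      by move=> w; rewrite indicE; case: (_ \in _); rewrite ?normr1 ?normr0.
    by rewrite ExZ ?ExB ?D0 ?D2 ?subrr ?mulr0//; [exact: intbleZ|apply: intbleB => //; exact: intbleZ].
  have msD : measurable_wrt G (fun w => h w - s w) by exact: measurable_wrtB.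
  have msb w : `|s w| <= C + C / 2.
    by rewrite (_ : s w = h w - (h w - s w)) ?(le_trans (ler_normB _ _)) ?lerD//; ring.
  rewrite (_ : Ex P _ = Ex P (fun w => (h w - s w) * D w)).
    apply: le_trans (IH _ _ msD _ hs) _; first by rewrite divr_ge0.
    by rewrite exprS invfM mulrA lexx.
  rewrite -[RHS]addr0 -es -ExD.
  - by congr Ex; apply/funext => w; ring.
  - exact: (intbleM (measurable_wrt_measurable GM msD) hs).
  - exact: (intbleM (measurable_wrt_measurable GM ms) msb).
apply/eqP; rewrite -normr_le0; apply/ler_addgt0Pr => e e0; rewrite add0r.
set B := C * Ex P (fun w => `|D w|).
have B0 : 0 <= B by rewrite mulr_ge0// Ex_ge0.
have [m /ltW Bm] := pow2_gt (B / e).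
apply: le_trans (step m h C mh C0 hC) _.
by rewrite mulrAC -/B ler_pdivrMr ?exprn_gt0// mulrC -ler_pdivrMr.
Qed.

Lemma Ex_multiplier (G : set (set T)) (f g h : T -> R) (C : R) :
  sigma_algebra setT G -> G `<=` measurable -> intble P f -> intble P g ->
  (forall A, G A -> (\int[P]_(w in A) (f w)%:E = \int[P]_(w in A) (g w)%:E)%E) ->
  measurable_wrt G h -> (forall w, `|h w| <= C) ->
  Ex P (fun w => h w * (f w - g w)) = 0.
Proof.
move=> sG GM fi gi fg mh hC.
apply: (Ex_orthogonal sG GM (intbleB fi gi) _ mh hC) => A GA.
have mA := GM _ GA.
have iA k : intble P k -> intble P (fun w => \1_A w * k w).
  move=> ki; apply: (@intbleM _ _ _ P _ _ 1) => //.
  by move=> w; rewrite indicE; case: (_ \in _); rewrite ?normr1 ?normr0.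
under eq_fun do rewrite mulrBr.
by rewrite ExB ?Ex_mulP//; [rewrite /Rintegral fg// subrr|exact: iA..].
Qed.

End Multiplier.

Section SmallSets.
Context {d : measure_display} {T : measurableType d} {R : realType}.
Variable P : probability T R.

(* An outer-measure bound, so that the sets of bad paths need not be shown measurable. *)
Definition Psmall (eta : R) (A : set T) : Prop :=
  exists E, [/\ measurable E, A `<=` E & (P E <= eta%:E)%E].

Lemma Psmall_sub eta A B : A `<=` B -> Psmall eta B -> Psmall eta A.
Proof. by move=> AB [E [mE BE PE]]; exists E; split => //; exact: subset_trans BE. Qed.

Lemma Psmall_le eta eta' A : eta <= eta' -> Psmall eta A -> Psmall eta' A.
Proof. by move=> h [E [mE BE PE]]; exists E; split => //; apply: le_trans PE _; rewrite lee_fin. Qed.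

Lemma PsmallU eta eta' A B : Psmall eta A -> Psmall eta' B -> Psmall (eta + eta') (A `|` B).
Proof.
move=> [E [mE AE PE]] [E' [mE' BE' PE']]; exists (E `|` E'); split.
- exact: measurableU.
- exact: setUSS.
- by apply: (le_trans (measureU2 _ mE mE')); rewrite EFinD leeD.
Qed.

Lemma Psmall_bigU (I : Type) (s : seq I) eta (A : I -> set T) :
  (forall i, Psmall eta (A i)) ->
  Psmall (eta *+ size s) (\big[setU/set0]_(i <- s) A i).
Proof.
move=> h; elim: s => [|i s IH].
  by rewrite big_nil; exists set0; split => //; rewrite measure0 mulr0n.
by rewrite big_cons /= mulrS; apply: PsmallU.
Qed.

Lemma Psmall_exists (J : finType) (A : J -> nat -> set T) :
  (forall j (eta : R), 0 < eta -> exists N0, forall N, (N0 <= N)%N -> Psmall eta (A j N)) ->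
  forall eta : R, 0 < eta -> exists N0, forall N, (N0 <= N)%N ->
    Psmall eta [set w | exists j, A j N w].
Proof.
(* The summand 1 keeps the denominator positive when [J] is empty. *)
move=> h eta eta0; have c0 : 0 < #|J|%:R + 1 :> R by rewrite ltr_wpDl.
have e0 : 0 < eta / (#|J|%:R + 1) by rewrite divr_gt0.
have [f hf] := choice (fun j => h j _ e0).
exists (\max_j f j)%N => N NN.
apply: (@Psmall_le ((eta / (#|J|%:R + 1)) *+ size (enum J))).
  rewrite -cardE -mulr_natr -mulrA ler_piMr ?ltW//.
  by rewrite mulrC ltr_pdivrMr// mul1r ltrDl.
apply: Psmall_sub (Psmall_bigU (enum J) (A := A^~ N) _); last first.
  by move=> j; apply: hf; apply: leq_trans NN; exact: leq_bigmax.
by move=> w [j Aj]; rewrite -bigcup_seq; exists j => //=; rewrite mem_enum.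
Qed.

Lemma Psmall_Ex eta A : Psmall eta A ->
  exists2 E, measurable E & A `<=` E /\ Ex P (\1_E : T -> R) <= eta.
Proof.
move=> [E [mE AE PE]]; exists E => //; split => //.
rewrite Ex_indicator// -lee_fin fineK//.
by rewrite fin_num_measure.
Qed.

Lemma Psmall_measurable eta (A : set T) : measurable A -> Ex P (\1_A : T -> R) <= eta -> Psmall eta A.
Proof.
move=> mA; rewrite Ex_indicator// => h; exists A; split => //.
by rewrite -[P A]fineK ?lee_fin// fin_num_measure.
Qed.

Lemma Psmall_markov eta (f : T -> R) (l : R) : intble P f -> (forall w, 0 <= f w) -> 0 < l ->
  Ex P f <= l * eta -> Psmall eta [set w | l < f w].
Proof.
move=> fi f0 l0 h.
have mA : measurable [set w | l < f w].
  rewrite -[X in measurable X]setTI.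
  by apply: measurable_fun_ltr => //; exact: intble_measurable fi.
apply: Psmall_measurable => //; rewrite -(ler_pM2l l0).
apply: le_trans h; rewrite -ExZ; last exact: intble_indicator.
apply: le_Ex => //; first exact/intbleZ/intble_indicator.
move=> w; rewrite indicE; case: (boolP (w \in _)); last by rewrite mulr0.
by rewrite inE /= mulr1 => /ltW.
Qed.

(** The indicators tend to zero on every path and are dominated by 1. This turns continuity or
    boundedness with constants depending on the path into bounds outside one set of small
    probability. *)
Lemma Psmall_eventually (A : nat -> set T) eta : (forall n, measurable (A n)) ->
  (forall w, exists M, forall n, (M <= n)%N -> ~ A n w) -> 0 < eta ->
  exists M, forall n, (M <= n)%N -> Psmall eta (A n).
Proof.
move=> mA Aw eta0.
have : (fun n => Ex P (\1_(A n) : T -> R)) @ \oo --> (0 : R).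
  apply: (@dominated_Ex0 _ _ _ P _ (fun=> 1) set0) => //.
  - exact: intble_cst.
  - by move=> n w; rewrite indicE; case: (_ \in _); rewrite ?normr1 ?normr0.
  - by exists set0; split => //; rewrite measure0.
  - move=> w _; have [M hM] := Aw w.
    apply: (@cvg_near_cst).
    exists M => // n /= Mn; rewrite indicE memNset//; exact: hM.
move=> /cvgr0Pnorm_lt /(_ _ eta0) [M _ hM]; exists M => n Mn.
apply: Psmall_measurable => //; apply: le_trans (ltW (hM n Mn)).
exact: ler_norm.
Qed.

Lemma measurable_exists (I : countType) (b : I -> set T) :
  (forall i, measurable (b i)) -> measurable [set w | exists i, b i w].
Proof.
move=> mb; rewrite (_ : [set w | _] = \bigcup_(k in setT)
   (if unpickle k is Some i then b i else set0)).
  by apply: bigcup_measurable => k _; case: (unpickle k).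
apply/seteqP; split => w /=.
  by move=> [i bi]; exists (pickle i) => //; rewrite pickleK.
by move=> [k _]; case: (unpickle k) => // i bi; exists i.
Qed.

Lemma measurable_andp (Q : Prop) (b : set T) :
  measurable b -> measurable [set w | Q /\ b w].
Proof.
move=> mb; have [q|q] := pselect Q.
  by rewrite (_ : [set w | _] = b)//; apply/seteqP; split => w /=; [case|].
by rewrite (_ : [set w | _] = set0)//; apply/seteqP; split => w /=; [case|].
Qed.

End SmallSets.

Section Paths.
Variable R : realType.

(** Heine-Cantor: compactness of [[0, t]], in its near-covering form, merges the local moduli into
    one. *)
Lemma path_uniformly_continuous (f : R -> R) (t e : R) :
  {within [set s | 0 <= s], continuous f} -> 0 < e ->
  exists2 dl, 0 < dl & forall u v, 0 <= u <= t -> 0 <= v <= t -> `|u - v| < dl ->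
    `|f u - f v| <= e.
Proof.
move=> cf e0.
have /compact_near_coveringP/near_covering_withinP : compact `[0, t] := @segment_compact _ _ _.
move=> /(_ _ ((0 : R)^'+) (fun dl u => forall v, 0 <= v <= t -> `|u - v| < dl -> `|f u - f v| <= e)).
move/subspace_continuousP: cf => cf.
case.
  move=> x; rewrite /= in_itv /= => /andP[x0 xt].
  have := cf x x0; rewrite /from_subspace /=.
  move=> /cvgrPdist_lt /(_ _ (divr_gt0 e0 (ltr0n _ 2))).
  rewrite near_withinE => /nbhs_ballP[r /= r0 hr].
  near=> u dl; rewrite /= in_itv /= => /andP[u0 ut] v /andP[v0 vt] uv.
  have hu : `|x - u| < r / 2.
    by near: u; apply: nbhsx_ballx; rewrite divr_gt0.
  have hd : dl < r / 2 by near: dl; apply: nbhs_right_lt; rewrite divr_gt0.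
  have hfu : `|f x - f u| < e / 2.
    by apply: hr => //; rewrite /ball /=; lra.
  have hfv : `|f x - f v| < e / 2.
    apply: hr => //; rewrite /ball /= (_ : x - v = (x - u) + (u - v)); last ring.
    by apply: le_lt_trans (ler_normD _ _) _; lra.
  rewrite (_ : f u - f v = (f x - f v) - (f x - f u)); last ring.
  by apply: le_trans (ler_normB _ _) _; lra.
rewrite /at_right /within /= => dl /= dl0 hd.
exists (dl / 2); first by rewrite divr_gt0.
move=> u v u0 v0 uv; apply: (hd (dl / 2) _ _ u _ v v0 uv).
- by rewrite /= sub0r normrN ger0_norm ?divr_ge0 ?ltW// ltr_pdivrMr// ltr_pMr// ltr1n.
- by rewrite divr_gt0.
- by rewrite /= in_itv.
Unshelve. all: by end_near. Qed.

Lemma path_bounded (f : R -> R) (t : R) :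
  {within [set s | 0 <= s], continuous f} ->
  exists K, forall u, 0 <= u <= t -> `|f u| <= K.
Proof.
move=> cf.
have cf' : {within `[0, t], continuous f}.
  apply: continuous_subspaceW cf => x /=; rewrite in_itv /=; by case/andP.
have /compact_bounded [K [_ hK]] := continuous_compact cf' (@segment_compact _ _ _).
exists (K + 1) => u u0; apply: (hK (K + 1)); first by rewrite ltrDl.
by exists u => //; rewrite /= in_itv.
Qed.

End Paths.

(** * Stopped discrete martingales *)

Section StoppedIncrements.
Context {d : measure_display} {T : measurableType d} {R : realType}.
Variable P : probability T R.
Variables (I : finType) (n : nat) (Z : nat -> I -> T -> R) (G : nat -> set (set T)).

Definition incr i a w : R := Z i.+1 a w - Z i a w.
Definition znorm i w : R := \sum_a `|Z i a w|.
Definition incr_norm i w : R := \sum_a `|incr i a w|.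
(** The squared $\ell^1$ norm of the whole increment is used because it dominates every product of
    increments of two coordinates. *)
Definition quad_var r w : R := \sum_(k < r) incr_norm k w ^+ 2.

Variables (K : R) (extra : nat -> T -> bool).

(** No stopping criterion has been met by index [i]. The slot [extra] takes a further adapted
    criterion: the size of a transform in the maximal inequality, nothing when it is later
    instantiated with [never]. *)
Fixpoint alive i w : bool :=
  if i is j.+1 then
    [&& alive j w, znorm i w <= K, incr_norm j w <= 1, quad_var i w <= K & extra i w]
  else extra 0 w.

(** Whether step [i] is taken depends on the increment of that very step, so the stopped process is
    not exactly a martingale; this is the source of all drift terms. *)
Definition active i w : bool := alive i w && (incr_norm i w <= 1).

(* Dropping a large last increment keeps the stopped process bounded, without overshoot. *)
Definition sincr i a w : R := (active i w)%:R * incr i a w.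
Definition sincr_norm i w : R := \sum_a `|sincr i a w|.
Definition stopped r a w : R := \sum_(k < r) sincr k a w.

Lemma alive_le i j w : (i <= j)%N -> alive j w -> alive i w.
Proof.
elim: j => [|j IH]; first by rewrite leqn0 => /eqP ->.
rewrite leq_eqVlt => /orP[/eqP -> //|]; rewrite ltnS => ij /= /and5P[aj _ _ _ _].
exact: IH.
Qed.

Lemma alive_extra i w : alive i w -> extra i w.
Proof. by case: i => [|i] //= /and5P[]. Qed.

Lemma alive_active i j w : (i < j)%N -> alive j w -> active i w.
Proof.
move=> ij /(alive_le ij) aj; rewrite /active (alive_le (leqnSn i) aj).
by move: aj => /= /and5P[].
Qed.

Lemma active_dead i j w : (i <= j)%N -> ~~ alive i w -> active j w = false.
Proof. by move=> ij; rewrite /active; case: (boolP (alive j w)) => // /(alive_le ij) ->. Qed.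

Lemma sincr_normE i w : sincr_norm i w = (active i w)%:R * incr_norm i w.
Proof.
rewrite /sincr_norm /incr_norm mulr_sumr; apply: eq_bigr => a _.
by rewrite normrM normr_nat.
Qed.

Lemma sincr_norm_ge0 i w : 0 <= sincr_norm i w.
Proof. by apply: sumr_ge0. Qed.

Lemma sincr_norm_le1 i w : sincr_norm i w <= 1.
Proof.
rewrite sincr_normE /active.
by case: (lerP (incr_norm i w) 1) => h; case: (alive i w); rewrite ?mul1r ?mul0r ?ler01.
Qed.

Lemma le_sincr_norm i a w : `|sincr i a w| <= sincr_norm i w.
Proof. by rewrite /sincr_norm (bigD1 a) //= lerDl sumr_ge0. Qed.

Lemma sincr_le1 i a w : `|sincr i a w| <= 1.
Proof. exact: le_trans (le_sincr_norm i a w) (sincr_norm_le1 i w). Qed.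

Lemma sincr_dead i j a w : (i <= j)%N -> ~~ alive i w -> sincr j a w = 0.
Proof. by move=> ij h; rewrite /sincr (active_dead ij h) mul0r. Qed.

Lemma sum_sincr_alive (c : nat -> T -> R) r a w : alive r w ->
  \sum_(k < r) c k w * sincr k a w = \sum_(k < r) c k w * incr k a w.
Proof.
move=> ar; apply: eq_bigr => k _.
by rewrite /sincr (alive_active _ ar) ?mul1r.
Qed.

Lemma sum_sincr_dead (f : nat -> T -> R) i r w : (i <= r)%N -> ~~ alive i w ->
  (forall k, active k w = false -> f k w = 0) ->
  \sum_(k < r) f k w = \sum_(k < i) f k w.
Proof.
move=> ir di f0; rewrite -(subnKC ir); elim: (r - i)%N => [|m IH]; first by rewrite addn0.
by rewrite addnS big_ord_recr /= IH f0 ?addr0// (active_dead _ di) ?leq_addr.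
Qed.

(* Only the last step before stopping can exceed the bound that is valid while alive. *)
Lemma stopped_sum_le (f : nat -> T -> R) w (A B : R) :
  (forall k, active k w = false -> f k w = 0) ->
  (forall k, f k w <= B) -> 0 <= B -> 0 <= A ->
  (forall r, alive r w -> \sum_(k < r) f k w <= A) ->
  forall r, \sum_(k < r) f k w <= A + B.
Proof.
move=> f0 fB B0 A0 h; elim=> [|r IH]; first by rewrite big_ord0 addr_ge0.
rewrite big_ord_recr /=; case: (boolP (alive r w)) => ar.
  by rewrite lerD ?h.
by rewrite f0 ?addr0// (active_dead _ ar).
Qed.

Hypothesis K0 : 0 <= K.
Hypothesis Z0 : forall a w, Z 0 a w = 0.

Lemma alive_znorm i w : alive i w -> znorm i w <= K.
Proof.
case: i => [|i] /=; last by case/and5P.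
by move=> _; rewrite /znorm big1// => a _; rewrite Z0 normr0.
Qed.

Lemma alive_quad_var i w : alive i w -> quad_var i w <= K.
Proof.
case: i => [|i] /=; last by case/and5P.
by move=> _; rewrite /quad_var big_ord0.
Qed.

Lemma alive_stopped r a w : alive r w -> stopped r a w = Z r a w.
Proof.
move=> ar; rewrite -[RHS]subr0 -[X in _ - X](Z0 a w) -(telescope_sumr (fun k => Z k a w) (leq0n r)) big_mkord.
rewrite /stopped; have := sum_sincr_alive (fun _ _ => 1) a ar.
by under eq_bigr do rewrite mul1r; under [in RHS]eq_bigr do rewrite mul1r.
Qed.

Lemma alive_Z_le i a w : alive i w -> `|Z i a w| <= K.
Proof.
move=> /alive_znorm; apply: le_trans.
by rewrite /znorm (bigD1 a) //= lerDl sumr_ge0.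
Qed.

Lemma stopped_bound r a w : `|stopped r a w| <= K + 1.
Proof.
have inact (k : nat) : active k w = false -> sincr k a w = 0.
  by rewrite /sincr => ->; rewrite mul0r.
have b1 k := sincr_le1 k a w.
rewrite ler_norml; apply/andP; split.
  rewrite lerNl /stopped -sumrN.
  apply: (@stopped_sum_le (fun k w => - sincr k a w) w K 1) => //.
  - by move=> k /inact ->; rewrite oppr0.
  - by move=> k; have := b1 k; rewrite ler_norml => /andP[]; rewrite lerNl.
  - move=> m am; rewrite sumrN -/(stopped m a w) alive_stopped//.
    by have := alive_Z_le a am; rewrite ler_norml => /andP[]; rewrite lerNl.
apply: (@stopped_sum_le (fun k w => sincr k a w) w K 1) => //.
- by move=> k; have := b1 k; rewrite ler_norml => /andP[].
- move=> m am; rewrite -/(stopped m a w) alive_stopped//.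
  by have := alive_Z_le a am; rewrite ler_norml => /andP[].
Qed.

(** The bound holds on every path, so sums of quadratic terms can later be passed to the limit under
    the expectation by domination. *)
Lemma stopped_quad_var r w : \sum_(k < r) sincr_norm k w ^+ 2 <= K + 1.
Proof.
apply: (@stopped_sum_le (fun k w => sincr_norm k w ^+ 2) w K 1) => //.
- by move=> k h; rewrite sincr_normE h mul0r expr0n.
- by move=> k; rewrite expr_le1// ?sincr_norm_le1// sincr_norm_ge0.
- move=> m am; apply: le_trans (alive_quad_var am).
  apply: ler_sum => k _; rewrite sincr_normE (alive_active _ am)// mul1r//.
Qed.

Hypothesis sG : forall i, sigma_algebra setT (G i).
Hypothesis GM : forall i, G i `<=` measurable.
Hypothesis Gmono : forall i j, (i <= j)%N -> G i `<=` G j.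
Hypothesis Zad : forall i a, measurable_wrt (G i) (Z i a).
Hypothesis extra_ad : forall i, measurable_wrt (G i) (extra i).

Lemma incr_ad i a : measurable_wrt (G i.+1) (incr i a).
Proof.
apply: measurable_wrtB; [exact: sG|exact: Zad|].
exact: measurable_wrt_sub (Gmono (leqnSn i)) (Zad i a).
Qed.

Lemma incr_norm_ad i : measurable_wrt (G i.+1) (incr_norm i).
Proof.
apply: measurable_wrt_sum => // a; apply: measurable_wrt_norm => //; exact: incr_ad.
Qed.

Lemma quad_var_ad i : measurable_wrt (G i) (quad_var i).
Proof.
apply: measurable_wrt_sum => // k; apply: measurable_wrtX => //.
exact: measurable_wrt_sub (Gmono (ltn_ord k)) (incr_norm_ad k).
Qed.

Lemma le_cst_ad i (f : T -> R) c :
  measurable_wrt (G i) f -> measurable_wrt (G i) (fun w => f w <= c).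
Proof. by move=> fi; apply: measurable_wrt_le => //; exact: measurable_wrt_cst. Qed.

Lemma alive_ad i : measurable_wrt (G i) (alive i).
Proof.
elim: i => [|i IH]; first exact: extra_ad.
apply: measurable_wrt_and => //; first exact: measurable_wrt_sub (Gmono (leqnSn i)) IH.
apply: measurable_wrt_and => //.
  apply: le_cst_ad; apply: measurable_wrt_sum => // a; exact: measurable_wrt_norm.
apply: measurable_wrt_and => //; first exact/le_cst_ad/incr_norm_ad.
apply: measurable_wrt_and => //; exact/le_cst_ad/quad_var_ad.
Qed.

Lemma alive_adS i : measurable_wrt (G i.+1) (alive i).
Proof. exact: measurable_wrt_sub (Gmono (leqnSn i)) (alive_ad i). Qed.

Lemma sincr_ad i a : measurable_wrt (G i.+1) (sincr i a).
Proof.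
apply: measurable_wrtM => //; last exact: incr_ad.
apply: measurable_wrt_indicator => //; apply: measurable_wrt_and => //; first exact: alive_adS.
exact/le_cst_ad/incr_norm_ad.
Qed.

Lemma stopped_ad r a : measurable_wrt (G r) (stopped r a).
Proof.
apply: measurable_wrt_sum => // k.
exact: measurable_wrt_sub (Gmono (ltn_ord k)) (sincr_ad k a).
Qed.

Definition overshoot i w : bool := alive i w && ~~ (incr_norm i w <= 1).

Lemma overshoot_ad i : measurable_wrt (G i.+1) (overshoot i).
Proof.
apply: measurable_wrt_and => //; first exact: alive_adS.
apply: measurable_wrt_neg => //; exact/le_cst_ad/incr_norm_ad.
Qed.

(** An overshoot kills the process, so at most one occurs. The invariant is that the number of past
    overshoots plus the indicator of [alive] is at most 1. *)
Lemma sum_overshoot r w :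
  \sum_(i < r) (overshoot i w)%:R <= ([exists i : 'I_r, 1 < incr_norm i w])%:R :> R.
Proof.
case: (boolP [exists _, _]) => [_|]; last first.
  rewrite negb_exists => /forallP h; rewrite big1// => i _.
  by rewrite /overshoot; have := h i; rewrite -leNgt => ->; rewrite andbF.
suff : \sum_(i < r) (overshoot i w)%:R + (alive r w)%:R <= 1 :> R.
  by apply: le_trans; rewrite lerDl.
elim: r => [|r IH]; first by rewrite big_ord0 add0r; case: alive.
rewrite big_ord_recr /=; apply: le_trans IH.
rewrite -addrA lerD2l /overshoot; case: (alive r w) => /=; last by rewrite addr0.
case: (lerP (incr_norm r w) 1) => /= h; first by rewrite add0r; case: (_ && _).
by rewrite andbF addr0.
Qed.

Hypothesis Zint : forall i a, intble P (Z i a).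
Hypothesis Zmart : forall i j a A, (i <= j)%N -> G i A ->
  (\int[P]_(w in A) (Z j a w)%:E = \int[P]_(w in A) (Z i a w)%:E)%E.

Lemma Ex_martingale i j a (h : T -> R) (C : R) : (i <= j)%N ->
  measurable_wrt (G i) h -> (forall w, `|h w| <= C) ->
  Ex P (fun w => h w * (Z j a w - Z i a w)) = 0.
Proof.
move=> ij mh hC; apply: (Ex_multiplier (sG i) (@GM i) (Zint j a) (Zint i a) _ mh hC) => A GA.
exact: Zmart.
Qed.

Lemma norm_bool (b : bool) : `|b%:R : R| <= 1.
Proof. by case: b; rewrite ?normr1 ?normr0. Qed.

Lemma measurable_fun_indicator i (b : T -> bool) : measurable_wrt (G i) b ->
  measurable_fun setT (fun w => (b w)%:R : R).
Proof.
by move=> mb; apply: (measurable_wrt_measurable (@GM i)); exact: measurable_wrt_indicator.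
Qed.

Definition drift_error a : R := Ex P (fun w => \sum_(i < n) (overshoot i w)%:R * `|incr i a w|).

Lemma intble_incr i a : intble P (incr i a).
Proof. exact: intbleB. Qed.

Lemma intble_overshoot i a : intble P (fun w => (overshoot i w)%:R * `|incr i a w|).
Proof.
apply: (@intbleM _ _ _ P _ _ 1); last exact/intble_norm/intble_incr.
- exact: measurable_fun_indicator (overshoot_ad i).
- by move=> w; exact: norm_bool.
Qed.

(** A stopped increment is the increment on [alive] minus the increment on [overshoot]. The event
    [alive i] is known at index [i], so the first part has mean zero against [h i]; only the second
    survives, and [drift_error] measures it. *)
Lemma drift_bound a (h : nat -> T -> R) (C : R) :
  (forall i, measurable_wrt (G i) (h i)) -> (forall i w, `|h i w| <= C) ->
  `|Ex P (fun w => \sum_(i < n) h i w * sincr i a w)| <= C * drift_error a.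
Proof.
move=> mh hC.
have C0 (w : T) : 0 <= C by exact: le_trans (hC 0%N w).
have mhM i := measurable_wrt_measurable (@GM i) (mh i).
have ma i := measurable_fun_indicator (alive_ad i).
have mo i := measurable_fun_indicator (overshoot_ad i).
have hb i (b : bool) w : `|h i w * b%:R| <= C.
  by rewrite normrM; apply: (le_trans (ler_piMr (normr_ge0 _) (norm_bool b))); exact: hC.
have i1 i : intble P (fun w => (h i w * (alive i w)%:R) * incr i a w).
  by apply: (@intbleM _ _ _ P _ _ C) => //; [exact: measurable_funM|exact: intble_incr].
have i2 i : intble P (fun w => (h i w * (overshoot i w)%:R) * incr i a w).
  by apply: (@intbleM _ _ _ P _ _ C) => //; [exact: measurable_funM|exact: intble_incr].
have split_ w i : h i w * sincr i a w =
    (h i w * (alive i w)%:R) * incr i a w - (h i w * (overshoot i w)%:R) * incr i a w.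
  rewrite /sincr /active /overshoot; case: (alive i w); case: (_ <= _) => /=; ring.
rewrite (_ : (fun w => _) = fun w => \sum_(i < n)
  ((h i w * (alive i w)%:R) * incr i a w - (h i w * (overshoot i w)%:R) * incr i a w)); last first.
  by apply/funext => w; apply: eq_bigr => i _; exact: split_.
rewrite Ex_sum; last by move=> i; exact: intbleB.
under eq_bigr => i _.
  rewrite ExB// (@Ex_martingale i i.+1 a (fun w => h i w * (alive i w)%:R) C) ?leqnSn//; last first.
    by apply: measurable_wrtM => //; apply: measurable_wrt_indicator => //; exact: alive_ad.
  rewrite sub0r; over.
rewrite sumrN normrN -Ex_sum//.
apply: le_trans (le_norm_Ex (intble_sum _ (fun i : 'I_n => i2 i))) _.
rewrite /drift_error -ExZ; last by apply: intble_sum => i; exact: intble_overshoot.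
apply: le_Ex.
- by apply: intble_norm; exact: intble_sum.
- by apply: intbleZ; apply: intble_sum => i; exact: intble_overshoot.
move=> w; apply: le_trans (ler_norm_sum _ _ _) _.
rewrite mulr_sumr; apply: ler_sum => i _.
by rewrite !normrM normr_nat -mulrA ler_wpM2r// mulr_ge0.
Qed.

(** At an overshoot the previous value is at most [K] in modulus, so the increment is at most
    [|Z i.+1 a| + K]. The submartingale property moves [|Z i.+1 a|] to the terminal index, and
    [sum_overshoot] sums over [i]. Only the terminal variable remains, and it does not change when
    the grid is refined. *)
Lemma drift_error_bound a :
  drift_error a <= Ex P (fun w => ([exists i : 'I_n, 1 < incr_norm i w])%:R * (`|Z n a w| + K)).
Proof.
have mbig : measurable_wrt (G n) (fun w => [exists i : 'I_n, 1 < incr_norm i w]).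
  rewrite (_ : (fun w => _) = fun w => ~~ [forall i : 'I_n, incr_norm i w <= 1]); last first.
    apply/funext => w; rewrite negb_forall; apply: eq_existsb => i.
    by rewrite ltNge.
  apply: measurable_wrt_neg => //; apply: measurable_wrt_forall => // i; apply: le_cst_ad.
  exact: measurable_wrt_sub (Gmono (ltn_ord i)) (incr_norm_ad i).
have iZ : intble P (fun w => `|Z n a w| + K).
  by apply: intbleD; [exact: intble_norm|exact: intble_cst].
have io i : intble P (fun w => (overshoot i w)%:R * (`|Z n a w| + K)).
  apply: (@intbleM _ _ _ P _ _ 1) => //; first exact: measurable_fun_indicator (overshoot_ad i).
  by move=> w; exact: norm_bool.
apply: (@le_trans _ _ (Ex P (fun w => \sum_(i < n) (overshoot i w)%:R * (`|Z n a w| + K)))); last first.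
  apply: le_Ex.
  - exact: intble_sum.
  - apply: (@intbleM _ _ _ P _ _ 1) => //; first exact: measurable_fun_indicator mbig.
    by move=> w; exact: norm_bool.
  - move=> w; rewrite -mulr_suml ler_wpM2r ?addr_ge0//.
    exact: sum_overshoot.
rewrite /drift_error Ex_sum; last by move=> i; exact: intble_overshoot.
rewrite Ex_sum//; apply: ler_sum => i _.
(* The sign of [Z i.+1 a] makes the absolute value linear, so that the martingale property
   applies. *)
pose h w : R := (overshoot i w)%:R * Num.sg (Z i.+1 a w).
have hb w : `|h w| <= 1.
  rewrite normrM mulr_ile1 ?norm_bool//.
  by case: sgrP => _; rewrite ?normr0 ?normr1 ?normrN1.
have mh : measurable_wrt (G i.+1) h.
  apply: measurable_wrtM => //; first by apply: measurable_wrt_indicator => //; exact: overshoot_ad.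
  rewrite (_ : (fun w => _) = fun w => (0 <= Z i.+1 a w)%R%:R - (Z i.+1 a w <= 0)%R%:R); last first.
    by apply/funext => w; case: sgrP => h'; rewrite ?h' ?lexx ?(ltW h') ?(lt_geF h') ?subrr ?subr0 ?sub0r.
  apply: measurable_wrtB => //; apply: measurable_wrt_indicator => //; last exact: le_cst_ad.
  by apply: measurable_wrt_le => //; exact: measurable_wrt_cst.
have mhM := measurable_wrt_measurable (@GM i.+1) mh.
have i1 j : intble P (fun w => h w * Z j a w) by exact: (intbleM mhM hb).
have ib : intble P (fun w => (overshoot i w)%:R * K).
  apply: (@intbleM _ _ _ P _ _ 1); last exact: intble_cst.
    exact: measurable_fun_indicator (overshoot_ad i).
  by move=> w; exact: norm_bool.
apply: (@le_trans _ _ (Ex P (fun w => h w * Z i.+1 a w + (overshoot i w)%:R * K))).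
  apply: le_Ex; [exact: intble_overshoot|exact: intbleD|move=> w].
  rewrite /h -mulrA -normrEsg -mulrDr; case: (boolP (overshoot i w)) => o; last by rewrite !mul0r.
  rewrite !mul1r /incr (le_trans (ler_normB _ _))// lerD2l alive_Z_le//.
  by case/andP: o.
rewrite ExD// (_ : Ex P (fun w => h w * Z i.+1 a w) = Ex P (fun w => h w * Z n a w)); last first.
  apply/esym/eqP; rewrite -subr_eq0 -ExB//; apply/eqP.
  rewrite -[RHS](Ex_martingale a (ltn_ord i) mh hb); congr Ex.
  by apply/funext => w; rewrite mulrBr.
rewrite -ExD//; apply: le_Ex => //; first exact: intbleD.
move=> w; rewrite mulrDr lerD2r /h -mulrA ler_wpM2l//.
apply: le_trans (ler_norm _) _; rewrite normrM ler_piMl//.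
by case: sgrP => _; rewrite ?normr0 ?normr1 ?normrN1.
Qed.

End StoppedIncrements.

(** [k %/ L * L] is the start of the block containing [k]. Inside a block the summand is the
    increment of the product of the two displacements from the block start, so complete blocks
    telescope; the last term is the incomplete block. *)
Lemma block_product_sum (R : comPzRingType) (x y : nat -> R) (L r : nat) : (0 < L)%N ->
  \sum_(k < r) ((x k - x (k %/ L * L)%N) * (y k.+1 - y k)
              + (y k - y (k %/ L * L)%N) * (x k.+1 - x k)
              + (x k.+1 - x k) * (y k.+1 - y k))
  = \sum_(q < r %/ L) (x (q.+1 * L)%N - x (q * L)%N) * (y (q.+1 * L)%N - y (q * L)%N)
    + (x r - x (r %/ L * L)%N) * (y r - y (r %/ L * L)%N).
Proof.
move=> L0; elim: r => [|r IH].
  by rewrite big_ord0 div0n big_ord0 mul0n !subrr mul0r addr0.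
rewrite big_ord_recr /= IH divnS//.
case: (boolP (L %| r.+1)%N) => dv /=; last by rewrite add0n; ring.
rewrite add1n big_ord_recr /=.
have <- : r.+1 = ((r %/ L).+1 * L)%N.
  by rewrite -[LHS](divnK dv) divnS// dv.
ring.
Qed.

Lemma sqr_sum_le (R : realType) (I : finType) (x : I -> R) :
  (\sum_a x a) ^+ 2 <= #|I|%:R * \sum_a x a ^+ 2.
Proof.
rewrite expr2 mulr_suml.
under eq_bigr do rewrite mulr_sumr.
apply: (@le_trans _ _ (\sum_i \sum_j (x i ^+ 2 + x j ^+ 2) / 2)).
  apply: ler_sum => i _; apply: ler_sum => j _.
  by have := sqr_ge0 (x i - x j); lra.
under eq_bigr do rewrite -mulr_suml big_split /= sumr_const.
rewrite -mulr_suml big_split /= sumr_const.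
rewrite sumrMnl mulr_natl; set S := _ *+ _.
lra.
Qed.

(** The interface to continuous time: samples of the same paths on all grids with [2 ^ N] steps.
    Time is normalised to length 1, so indices less than [dl * 2 ^+ N] apart are times less than
    [dl] apart, and one modulus of continuity per path serves every [N]. *)
Record dyadic_martingale {d : measure_display} {T : measurableType d} {R : realType}
    (P : probability T R) (I : finType) (Z : nat -> nat -> I -> T -> R)
    (ZT : I -> T -> R) (G : nat -> nat -> set (set T)) : Prop := DyadicMartingale {
  dm_sigma : forall N i, sigma_algebra setT (G N i);
  dm_measurable : forall N i, G N i `<=` measurable;
  dm_mono : forall N i j, (i <= j)%N -> G N i `<=` G N j;
  dm_adapted : forall N i a, measurable_wrt (G N i) (Z N i a);
  dm_intble : forall N i a, intble P (Z N i a);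
  dm_martingale : forall N i j a A, (i <= j)%N -> G N i A ->
    (\int[P]_(w in A) (Z N j a w)%:E = \int[P]_(w in A) (Z N i a w)%:E)%E;
  dm_start : forall N a w, Z N 0 a w = 0;
  dm_end : forall N a, Z N (2 ^ N)%N a = ZT a;
  dm_continuous : forall w (e : R), 0 < e -> exists2 dl : R, 0 < dl &
    forall N i j a, (i <= 2 ^ N)%N -> (j <= 2 ^ N)%N ->
    `|i%:R - j%:R : R| < dl * 2 ^+ N -> `|Z N i a w - Z N j a w| <= e;
  dm_bounded : forall w, exists K : R, forall N i a, (i <= 2 ^ N)%N -> `|Z N i a w| <= K;
  dm_quad_var : forall a (eta : R), 0 < eta -> exists (K : R) N0, forall N, (N0 <= N)%N ->
    Psmall P eta [set w | K < \sum_(k < 2 ^ N) incr (Z N) k a w ^+ 2] }.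

(** * Probability estimates uniform over the grids *)

Section MartingaleTransforms.
Context {d : measure_display} {T : measurableType d} {R : realType}.
Variable P : probability T R.
Variables (I : finType) (Z : nat -> nat -> I -> T -> R) (ZT : I -> T -> R).
Variable G : nat -> nat -> set (set T).
Hypothesis dmZ : dyadic_martingale P Z ZT G.
Let sG := dm_sigma dmZ.
Let GM := dm_measurable dmZ.
Let Gmono := dm_mono dmZ.
Let Zad := dm_adapted dmZ.
Let Zint := dm_intble dmZ.
Let Zmart := dm_martingale dmZ.
Let Z0 := dm_start dmZ.
Let ZN := dm_end dmZ.
Let Zuc := dm_continuous dmZ.
Let Zbd := dm_bounded dmZ.
Let Zqv := dm_quad_var dmZ.

Let ZM N i a : measurable_fun setT (Z N i a).
Proof. exact: measurable_wrt_measurable (GM (N:=N) (i:=i)) (Zad N i a). Qed.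

(** The moduli of continuity of the single paths are replaced by one deterministic [dl], valid on
    all grids at once. The quantified indices are countable, so the bad sets are measurable. *)
Lemma oscillation_small (e eta : R) : 0 < e -> 0 < eta -> exists2 dl : R, 0 < dl &
  Psmall P eta [set w | exists N i j a, [/\ (i <= 2 ^ N)%N, (j <= 2 ^ N)%N,
    `|i%:R - j%:R : R| < dl * 2 ^+ N & e < `|Z N i a w - Z N j a w|]].
Proof.
move=> e0 eta0.
pose A m := [set w | exists N i j a, [/\ (i <= 2 ^ N)%N, (j <= 2 ^ N)%N,
    `|i%:R - j%:R : R| < (2 ^+ m)^-1 * 2 ^+ N & e < `|Z N i a w - Z N j a w|]].
have mA m : measurable (A m).
  apply: measurable_exists => N; apply: measurable_exists => i.
  apply: measurable_exists => j; apply: measurable_exists => a.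
  rewrite [X in measurable X](_ : _ = [set w | [/\ (i <= 2 ^ N)%N, (j <= 2 ^ N)%N &
     (`|i%:R - j%:R : R| < (2 ^+ m)^-1 * 2 ^+ N)] /\ [set w | e < `|Z N i a w - Z N j a w|] w]); last first.
    by apply/seteqP; split => w /=; [case|case => -[]].
  apply: measurable_andp; rewrite -[X in measurable X]setTI.
  apply: measurable_fun_ltr => //; apply: measurableT_comp => //.
  exact: measurable_funB.
have [|M hM] := Psmall_eventually P mA _ eta0.
  move=> w; have [dl dl0 hd] := Zuc w e0.
  have [M hM] := pow2_gt dl^-1.
  exists M => m Mm [N [i [j [a [iN jN ij]]]]]; apply/negP; rewrite -leNgt; apply: hd => //.
  apply: lt_le_trans ij _; rewrite ler_wpM2r ?exprn_ge0//.
  rewrite -[leRHS]invrK lef_pV2 ?posrE ?exprn_gt0 ?invr_gt0//.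
  by apply: le_trans (ltW hM) _; rewrite ler_eXn2l// ltr1n.
exists (2 ^+ M)^-1; first by rewrite invr_gt0 exprn_gt0.
exact: hM.
Qed.

Lemma znorm_small (eta : R) : 0 < eta -> exists K : R,
  Psmall P eta [set w | exists N i, (i <= 2 ^ N)%N /\ K < znorm (Z N) i w].
Proof.
move=> eta0; pose A (m : nat) := [set w | exists N i, (i <= 2 ^ N)%N /\ m%:R < znorm (Z N) i w].
have mA m : measurable (A m).
  apply: measurable_exists => N; apply: measurable_exists => i.
  apply: measurable_andp; rewrite -[X in measurable X]setTI.
  apply: measurable_fun_ltr => //; apply: measurable_sum => a.
  exact: measurableT_comp.
have [|M hM] := Psmall_eventually P mA _ eta0.
  move=> w; have [K hK] := Zbd w.
  exists (Num.truncn (#|I|%:R * K)).+1 => m Mm [N [i [iN]]]; apply/negP; rewrite -leNgt.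
  apply: (@le_trans _ _ (#|I|%:R * K)).
    rewrite /znorm mulr_natl -sumr_const; apply: ler_sum => a _; exact: hK.
  by apply: le_trans (ltW (truncnS_gt _)) _; rewrite ler_nat.
by exists M%:R; exact: hM.
Qed.

Lemma incr_norm_eventually w (e : R) : 0 < e -> exists N0, forall N i, (N0 <= N)%N -> (i < 2 ^ N)%N ->
  incr_norm (Z N) i w <= e.
Proof.
move=> e0; have c0 : 0 < #|I|%:R + 1 :> R by rewrite ltr_wpDl.
have [dl dl0 hd] := Zuc w (divr_gt0 e0 c0).
have [M hM] := pow2_gt dl^-1.
exists M => N i MN iN.
apply: (@le_trans _ _ (#|I|%:R * (e / (#|I|%:R + 1)))).
  rewrite /incr_norm mulr_natl -sumr_const; apply: ler_sum => a _.
  apply: hd => //; first exact: ltnW.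
  rewrite -natr1 addrAC subrr add0r normr1 -ltr_pdivrMl// mulr1.
  by apply: lt_le_trans hM _; rewrite ler_eXn2l// ltr1n.
by rewrite mulrA ler_pdivrMr// [leRHS]mulrC ler_wpM2r ?ltW// ltrDl.
Qed.

Lemma measurable_incr_norm N i : measurable_fun setT (incr_norm (Z N) i).
Proof.
apply: measurable_sum => a; apply: measurableT_comp => //; exact: measurable_funB.
Qed.

Let big N := [set w | exists i : 'I_(2 ^ N), 1 < incr_norm (Z N) i w].

Lemma measurable_big N : measurable (big N).
Proof.
apply: measurable_exists => i; rewrite -[X in measurable X]setTI.
by apply: measurable_fun_ltr => //; exact: measurable_incr_norm.
Qed.

Lemma big_eventually w : exists M, forall N, (M <= N)%N -> ~ big N w.
Proof.
have [M hM] := @incr_norm_eventually w 1 ltr01.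
by exists M => N MN [i]; apply/negP; rewrite -leNgt; apply: hM.
Qed.

Lemma incr_norm_small (eta : R) : 0 < eta -> exists N0, forall N, (N0 <= N)%N -> Psmall P eta (big N).
Proof.
by move=> eta0; apply: (Psmall_eventually P _ _ eta0) => [N|w]; [exact: measurable_big|exact: big_eventually].
Qed.

Lemma quad_var_small (eta : R) : 0 < eta -> exists (K : R) N0, forall N, (N0 <= N)%N ->
  Psmall P eta [set w | K < quad_var (Z N) (2 ^ N) w].
Proof.
move=> eta0; have c0 : 0 < #|I|%:R + 1 :> R by rewrite ltr_wpDl.
have e0 : 0 < eta / (#|I|%:R + 1) by rewrite divr_gt0.
have h a : exists KN : R * nat, forall N, (KN.2 <= N)%N ->
    Psmall P (eta / (#|I|%:R + 1)) [set w | KN.1 < \sum_(k < 2 ^ N) incr (Z N) k a w ^+ 2].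
  by have [K [N0 h]] := Zqv a e0; exists (K, N0).
have [f hf] := choice h.
exists (#|I|%:R * \sum_a (f a).1), (\max_a (f a).2)%N => N NN.
apply: (@Psmall_le _ _ _ _ ((eta / (#|I|%:R + 1)) *+ size (enum I))).
  rewrite -cardE -mulr_natr -mulrA ler_piMr ?ltW//.
  by rewrite mulrC ltr_pdivrMr// mul1r ltrDl.
apply: Psmall_sub (Psmall_bigU (enum I)
  (A := fun a => [set w | (f a).1 < \sum_(k < 2 ^ N) incr (Z N) k a w ^+ 2]) _); last first.
  by move=> a; apply: hf; apply: leq_trans NN; exact: leq_bigmax.
move=> w /= hw; rewrite -bigcup_seq /=.
apply: contrapT => hn; move: hw; apply/negP; rewrite -leNgt.
apply: (@le_trans _ _ (#|I|%:R * \sum_a \sum_(k < 2 ^ N) incr (Z N) k a w ^+ 2)).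
  rewrite exchange_big /= mulr_sumr /quad_var; apply: ler_sum => k _.
  apply: le_trans (sqr_sum_le _) _; rewrite ler_wpM2l//.
  by apply: ler_sum => a _; rewrite real_normK ?num_real.
rewrite ler_wpM2l//; apply: ler_sum => a _; rewrite leNgt; apply/negP => hh.
by apply: hn; exists a => //=; rewrite mem_enum.
Qed.

(** The event on which stopping at level [K] never acts, so that [stopped] agrees with the original
    process up to the end of the grid. *)
Definition tame N (K : R) w := forall i, (i <= 2 ^ N)%N ->
  [/\ znorm (Z N) i w <= K, quad_var (Z N) i w <= K & (i < 2 ^ N)%N -> incr_norm (Z N) i w <= 1].

Lemma quad_var_le N i j w : (i <= j)%N -> quad_var (Z N) i w <= quad_var (Z N) j w.
Proof.
move=> /subnK <-; elim: (j - i)%N => [|m IH]; first by rewrite add0n.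
by apply: le_trans IH _; rewrite addSn /quad_var big_ord_recr /= lerDl sqr_ge0.
Qed.

(** The level [K] does not depend on the grid: the bound on the paths covers all grids, and the
    quadratic sums are tight uniformly in large [N]. *)
Lemma tame_small (eta : R) : 0 < eta -> exists2 K : R, 0 <= K & exists N0, forall N, (N0 <= N)%N ->
  Psmall P eta (~` [set w | tame N K w]).
Proof.
move=> eta0; have e0 : 0 < eta / 3 by rewrite divr_gt0.
have [K1 h1] := znorm_small e0.
have [N2 h2] := incr_norm_small e0.
have [K3 [N3 h3]] := quad_var_small e0.
exists (Num.max 0 (Num.max K1 K3)); first by rewrite le_max lexx.
exists (maxn N2 N3) => N; rewrite geq_max => /andP[n2 n3].
apply: (@Psmall_le _ _ _ _ (eta / 3 + eta / 3 + eta / 3)); first by lra.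
apply: Psmall_sub (PsmallU (PsmallU h1 (h2 N n2)) (h3 N n3)).
move=> w /= nt; apply: contrapT => hn; apply: nt => i iN; split.
- rewrite !le_max; apply/orP; right; apply/orP; left; rewrite leNgt; apply/negP => hh.
  by apply: hn; left; left; exists N, i.
- rewrite !le_max; apply/orP; right; apply/orP; right; rewrite leNgt; apply/negP => hh.
  by apply: hn; right; apply: lt_le_trans hh _; exact: quad_var_le.
- move=> iN'; rewrite leNgt; apply/negP => hh.
  by apply: hn; left; right; exists (Ordinal iN').
Qed.

(** By continuity each path leaves the events [big N] for good, and [|ZT a| + K] dominates. The
    threshold [N0] works for all criteria [extra] at once, as is needed when [extra] depends on the
    transform to be bounded. *)
Lemma drift_error_small (K : R) a (e : R) : 0 <= K -> 0 < e -> exists N0, forall N extra, (N0 <= N)%N ->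
  (forall i, measurable_wrt (G N i) (extra i)) ->
  drift_error P (2 ^ N) (Z N) K extra a <= e.
Proof.
move=> K0 e0.
have iZ : intble P (ZT a) by rewrite -(ZN 0); exact: Zint.
have iK : intble P (fun w => `|ZT a w| + K) by apply: intbleD; [exact: intble_norm|exact: intble_cst].
have : (fun N => Ex P (fun w => \1_(big N) w * (`|ZT a w| + K))) @ \oo --> (0 : R).
  apply: (@dominated_Ex0 _ _ _ P _ (fun w => `|ZT a w| + K) set0) => //.
  - move=> N; apply: measurable_funM; first exact/measurable_indic/measurable_big.
    exact: intble_measurable iK.
  - move=> N w; rewrite normrM (@ger0_norm _ (_ + _)) ?addr_ge0// ler_piMl ?addr_ge0//.
    by rewrite indicE; case: (_ \in _); rewrite ?normr1 ?normr0.
  - by exists set0; split => //; rewrite measure0.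
  - move=> w _; have [M hM] := big_eventually w.
    apply: cvg_near_cst; exists M => // N /= MN.
    by rewrite indicE memNset ?mul0r//; exact: hM.
move=> /cvgr0Pnorm_lt /(_ _ e0) [M _ hM]; exists M => N extra MN mex.
apply: le_trans (le_trans (ler_norm _) (ltW (hM N MN))).
have := @drift_error_bound _ _ _ P I (2 ^ N) (Z N) (G N) K extra K0 (Z0 N)
  (sG N) (@GM N) (@Gmono N) (Zad N) mex (Zint N) (@Zmart N) a.
move=> h; apply: le_trans h _; rewrite ZN le_eqVlt; apply/orP; left; apply/eqP; congr Ex.
apply/funext => w; congr (_ * _); rewrite indicE; congr (_ %:R); congr nat_of_bool.
by apply/existsP/idP => [[i hi]|]; [rewrite inE; exists i|rewrite inE => -[i hi]; exists i].
Qed.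

(** A weak-type maximal inequality without second moments of [Z]: stop also when the transform
    exceeds [lam], bound the second moment of the stopped transform by a multiple of [eps], apply
    Markov. The choice of [eps] depends neither on the grid nor on the coefficients. *)
Lemma martingale_transform_small (lam eta : R) : 0 < lam -> 0 < eta -> exists2 eps : R, 0 < eps &
  exists N0, forall N a (c : nat -> T -> R), (N0 <= N)%N ->
  (forall i, measurable_wrt (G N i) (c i)) -> (forall i w, `|c i w| <= eps) ->
  Psmall P eta [set w | exists r, (r <= 2 ^ N)%N /\ lam < `|\sum_(k < r) c k w * incr (Z N) k a w|].
Proof.
move=> lam0 eta0.
have [K K0 [N1 hK]] := tame_small (divr_gt0 eta0 (ltr0n _ 2)).
(* For [eps <= 1], [eps * B] bounds the sum of the drift part [2 * (lam + eps) * eps] and the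
   quadratic part [eps ^+ 2 * (K + 1)] of the second moment. *)
pose B := 2 * (lam + 1) + (K + 1).
have B0 : 0 < B by rewrite /B; lra.
pose eps := Num.min 1 (lam ^+ 2 * (eta / 2) / B).
have eps0 : 0 < eps by rewrite lt_min ltr01 !(divr_gt0, mulr_gt0, exprn_gt0).
have eps1 : eps <= 1 by rewrite ge_min lexx.
have epsB : eps * B <= lam ^+ 2 * (eta / 2) by rewrite -ler_pdivlMr// ge_min lexx orbT.
have h2 a : exists N0, forall N extra, (N0 <= N)%N ->
    (forall i, measurable_wrt (G N i) (extra i)) -> drift_error P (2 ^ N) (Z N) K extra a <= 1.
  exact: drift_error_small.
have [f hf] := choice h2.
exists eps => //; exists (maxn N1 (\max_a f a)) => N a c; rewrite geq_max => /andP[n1 n2] mc hc.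
pose S r w := \sum_(k < r) c k w * incr (Z N) k a w.
have mS r : measurable_wrt (G N r) (S r).
  apply: measurable_wrt_sum => // k; apply: measurable_wrtM => //.
    exact: measurable_wrt_sub (Gmono (ltnW (ltn_ord k))) (mc k).
  exact: measurable_wrt_sub (Gmono (ltn_ord k)) (incr_ad (sG N) (@Gmono N) (Zad N) k a).
pose extra i w := `|S i w| <= lam.
have mex i : measurable_wrt (G N i) (extra i).
  by apply: le_cst_ad => //; apply: measurable_wrt_norm.
have drf : drift_error P (2 ^ N) (Z N) K extra a <= 1.
  by apply: hf => //; apply: leq_trans n2; exact: leq_bigmax.
pose al := alive (Z N) K extra.
pose dl i w := sincr (Z N) K extra i a w.
pose U r w := \sum_(k < r) c k w * dl k w.
have Ub r w : `|U r w| <= lam + eps.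
  have cd k : `|c k w * dl k w| <= eps.
    by rewrite normrM -[leRHS]mulr1 ler_pM// sincr_le1.
  elim: r => [|r IH]; first by rewrite /U big_ord0 normr0; lra.
  rewrite /U big_ord_recr /= -/(U r w); case: (boolP (al r w)) => ar.
    apply: le_trans (ler_normD _ _) _; rewrite lerD//.
    rewrite /U /dl (@sum_sincr_alive _ _ _ _ (Z N) K extra c) //.
    exact: alive_extra ar.
  by rewrite /dl (sincr_dead _ (leqnn r) ar) mulr0 addr0.
have mU r : measurable_wrt (G N r) (U r).
  apply: measurable_wrt_sum => // k; apply: measurable_wrtM => //.
    exact: measurable_wrt_sub (Gmono (ltnW (ltn_ord k))) (mc k).
  exact: measurable_wrt_sub (Gmono (ltn_ord k)) (sincr_ad K (sG N) (@Gmono N) (Zad N) mex k a).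
(* Discrete product rule: the cross terms form a transform of the stopped increments, with mean
   controlled by the drift; the squares are bounded on every path. *)
have U2 r w : U r w ^+ 2 = \sum_(k < r) (2 * U k w * c k w) * dl k w
    + \sum_(k < r) c k w ^+ 2 * dl k w ^+ 2.
  elim: r => [|r IH]; first by rewrite /U !big_ord0 expr0n addr0.
  rewrite /U big_ord_recr /= -/(U r w) !big_ord_recr /= sqrrD IH -/(U r w); ring.
have mUM := measurable_wrt_measurable (@GM N (2 ^ N)) (mU (2 ^ N)%N).
have iU : intble P (fun w => U (2 ^ N)%N w ^+ 2).
  apply: (@intble_bounded _ _ _ P _ ((lam + eps) ^+ 2)); first exact: measurable_funX.
  by move=> w; rewrite normrX lerXn2r ?nnegrE ?Ub//; lra.
have mdl k : measurable_fun setT (dl k).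
  exact: measurable_wrt_measurable (@GM N k.+1) (sincr_ad K (sG N) (@Gmono N) (Zad N) mex k a).
have mcM k := measurable_wrt_measurable (@GM N k) (mc k).
have bnd2 w : \sum_(k < 2 ^ N) c k w ^+ 2 * dl k w ^+ 2 <= eps ^+ 2 * (K + 1).
  apply: (@le_trans _ _ (\sum_(k < 2 ^ N) eps ^+ 2 * sincr_norm (Z N) K extra k w ^+ 2)).
    apply: ler_sum => k _; rewrite ler_pM ?sqr_ge0//.
      by rewrite -[c k w ^+ 2]real_normK ?num_real// lerXn2r ?nnegrE ?(ltW eps0).
    by rewrite -[dl k w ^+ 2]real_normK ?num_real// lerXn2r ?nnegrE ?sincr_norm_ge0 ?le_sincr_norm.
  by rewrite -mulr_sumr ler_wpM2l ?sqr_ge0// stopped_quad_var.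
have i2 : intble P (fun w => \sum_(k < 2 ^ N) c k w ^+ 2 * dl k w ^+ 2).
  apply: (@intble_bounded _ _ _ P _ (eps ^+ 2 * (K + 1))).
    by apply: measurable_sum => k; apply: measurable_funM; exact: measurable_funX.
  by move=> w; rewrite ger0_norm// sumr_ge0// => k _; rewrite mulr_ge0 ?sqr_ge0.
have hb i w : `|2 * U i w * c i w| <= 2 * (lam + eps) * eps.
  by rewrite !normrM (@ger0_norm _ 2)// ler_pM ?mulr_ge0// ler_wpM2l.
have mh i : measurable_wrt (G N i) (fun w => 2 * U i w * c i w).
  by do 2 apply: measurable_wrtM => //; exact: measurable_wrt_cst.
have i1 : intble P (fun w => \sum_(k < 2 ^ N) (2 * U k w * c k w) * dl k w).
  have := intbleB iU i2; apply: eq_integrable => // w _ /=.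
  by rewrite U2 addrK.
have EU : Ex P (fun w => U (2 ^ N)%N w ^+ 2) <= lam ^+ 2 * (eta / 2).
  rewrite (_ : (fun w => _) = fun w => \sum_(k < 2 ^ N) (2 * U k w * c k w) * dl k w
    + \sum_(k < 2 ^ N) c k w ^+ 2 * dl k w ^+ 2); last by apply/funext => w; rewrite U2.
  rewrite ExD//.
  have d1 : Ex P (fun w => \sum_(k < 2 ^ N) (2 * U k w * c k w) * dl k w) <= 2 * (lam + eps) * eps.
    apply: le_trans (ler_norm _) _.
    have := @drift_bound _ _ _ P I (2 ^ N) (Z N) (G N) K extra
      (sG N) (@GM N) (@Gmono N) (Zad N) mex (Zint N) (@Zmart N) a _ _ mh hb.
    move=> h; apply: le_trans h _; rewrite -[leRHS]mulr1 ler_wpM2l//.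
    by rewrite !mulr_ge0//; lra.
  have d2 : Ex P (fun w => \sum_(k < 2 ^ N) c k w ^+ 2 * dl k w ^+ 2) <= eps ^+ 2 * (K + 1).
    rewrite -[leRHS](Ex_cst P); apply: le_Ex => //; exact: intble_cst.
  apply: le_trans (lerD d1 d2) _; apply: le_trans epsB.
  rewrite /B -subr_ge0 [leRHS](_ : _ = eps * (1 - eps) * (K + 3)); last ring.
  by rewrite !mulr_ge0 ?subr_ge0 ?addr_ge0 ?(ltW eps0).
apply: (@Psmall_le _ _ _ _ (eta / 2 + eta / 2)); first by lra.
have l20 : 0 < lam ^+ 2 by rewrite exprn_gt0.
apply: Psmall_sub (PsmallU (hK N n1) (Psmall_markov iU (fun w => sqr_ge0 _) l20 EU)).
move=> w /= [r [rN hr]].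
have [tw|] := pselect (tame N K w); last by left.
right.
have ex : exists r, (r <= 2 ^ N)%N && (lam < `|S r w|) by exists r; rewrite rN.
(* At the first passage [m] above [lam] the criterion [extra] fails. On a tame path all earlier
   steps were taken, so the stopped transform is frozen at [S m], whose modulus exceeds [lam]. *)
case: (ex_minnP ex) => m /andP[mN hm] mmin.
have allt i : (i < m)%N -> al i w.
  elim: i => [|i IH] im; rewrite /al /=.
    by rewrite /extra /S big_ord0 normr0 ltW.
  have iN := leq_trans (ltnW im) mN.
  have [h1 h1' _] := tw i.+1 iN.
  have [_ _ h3] := tw i (ltnW iN).
  rewrite h1 h1' h3//= [X in X && _](IH (ltnW im)) /= /extra leNgt; apply/negP => hh.
  by have := mmin i.+1; rewrite hh iN => /(_ isT); rewrite leqNgt im.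
have dead : ~~ al m w.
  by apply/negP => /alive_extra; rewrite /extra leNgt hm.
have USm : U m w = S m w.
  apply: eq_bigr => k _; rewrite /dl /sincr /active [X in X && _](allt k (ltn_ord k)) /=.
  have [_ _ h3] := tw k (ltnW (leq_trans (ltn_ord k) mN)).
  by rewrite h3 ?mul1r// (leq_trans (ltn_ord k) mN).
have -> : U (2 ^ N)%N w = S m w.
  rewrite -USm; apply: (@sum_sincr_dead _ _ _ _ (Z N) K extra (fun k w => c k w * dl k w)) => //.
  by move=> k h; rewrite /dl /sincr h mul0r mulr0.
by rewrite -[ltRHS]real_normK ?num_real// ltrXn2r ?nnegrE ?(ltW lam0).
Qed.

(** Truncating the coefficients at [eps] preserves adaptedness and changes the sums only on the
    exceptional set, of probability at most [theta]. *)
Lemma martingale_transform_small_whp (lam eta : R) : 0 < lam -> 0 < eta -> exists2 eps : R, 0 < eps &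
  exists N0, forall N a (c : nat -> T -> R) (theta : R), (N0 <= N)%N ->
  (forall i, measurable_wrt (G N i) (c i)) ->
  Psmall P theta [set w | exists i, (i < 2 ^ N)%N /\ eps < `|c i w|] ->
  Psmall P (eta + theta)
    [set w | exists r, (r <= 2 ^ N)%N /\ lam < `|\sum_(k < r) c k w * incr (Z N) k a w|].
Proof.
move=> lam0 eta0; have [eps eps0 [N0 h]] := martingale_transform_small lam0 eta0.
exists eps => //; exists N0 => N a c theta NN mc hc.
pose c' i w := (`|c i w| <= eps)%R%:R * c i w.
have mc' i : measurable_wrt (G N i) (c' i).
  apply: measurable_wrtM => //; apply: measurable_wrt_indicator => //; apply: le_cst_ad => //.
  exact: measurable_wrt_norm.
have hc' i w : `|c' i w| <= eps.
  by rewrite /c'; case: (lerP `|c i w| eps) => h'; rewrite ?mul1r// mul0r normr0 ltW.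
apply: Psmall_sub (PsmallU (h N a c' NN mc' hc') hc) => w /= [r [rN hr]].
have [[i ci]|nc] := pselect (exists i, (i < 2 ^ N)%N /\ eps < `|c i w|); first by right; exists i.
left; exists r; split => //; rewrite (_ : \sum_(k < r) _ = \sum_(k < r) c k w * incr (Z N) k a w)//.
apply: eq_bigr => k _; rewrite /c' (_ : `|c k w| <= eps) ?mul1r// leNgt; apply/negP => hh.
by apply: nc; exists k; split => //; exact: leq_trans (ltn_ord k) rN.
Qed.

End MartingaleTransforms.

(** * Brackets along dyadic grids *)

Section Bracket.
Context {d : measure_display} {T : measurableType d} {R : realType}.
Variable P : probability T R.
Variables (I : finType) (Z : nat -> nat -> I -> T -> R) (ZT : I -> T -> R).
Variable G : nat -> nat -> set (set T).
Hypothesis dmZ : dyadic_martingale P Z ZT G.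

Definition cov N a b r w : R := \sum_(k < r) incr (Z N) k a w * incr (Z N) k b w.

Definition coarse_cov N L a b m w : R :=
  \sum_(q < m) (Z N (q.+1 * L) a w - Z N (q * L) a w) * (Z N (q.+1 * L) b w - Z N (q * L) b w).

(** A discrete stochastic integral of the lag behind the coarse grid; short blocks make its
    coefficients small. *)
Definition lag_sum N L a b r w : R :=
  \sum_(k < r) (Z N k a w - Z N (k %/ L * L) a w) * incr (Z N) k b w.

Lemma cov_coarse N L a b r w : (0 < L)%N ->
  cov N a b r w = coarse_cov N L a b (r %/ L) w
   + (Z N r a w - Z N (r %/ L * L) a w) * (Z N r b w - Z N (r %/ L * L) b w)
   - lag_sum N L a b r w - lag_sum N L b a r w.
Proof.
move=> L0; have := block_product_sum (fun k => Z N k a w) (fun k => Z N k b w) r L0.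
rewrite !big_split /= -/(cov N a b r w) -/(lag_sum N L a b r w) -/(lag_sum N L b a r w).
by rewrite -/(coarse_cov N L a b (r %/ L) w) => <-; ring.
Qed.

Lemma lag_sum_small (lam eta : R) : 0 < lam -> 0 < eta -> exists2 dl : R, 0 < dl &
  exists N0, forall N L a b, (N0 <= N)%N -> (0 < L)%N -> L%:R <= dl * 2 ^+ N ->
  Psmall P eta [set w | exists r, (r <= 2 ^ N)%N /\ lam < `|lag_sum N L a b r w|].
Proof.
move=> lam0 eta0; have e0 : 0 < eta / 2 by rewrite divr_gt0.
have [eps eps0 [N0 hT]] := martingale_transform_small_whp dmZ lam0 e0.
have [dl dl0 osc] := oscillation_small dmZ eps0 e0.
exists dl => //; exists N0 => N L a b NN L0 hL.
apply: (@Psmall_le _ _ _ _ (eta / 2 + eta / 2)); first by lra.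
apply: (hT N b (fun k w => Z N k a w - Z N (k %/ L * L) a w)) => //.
  move=> k; apply: measurable_wrtB; first exact: (dm_sigma dmZ).
    exact: (dm_adapted dmZ).
  exact: measurable_wrt_sub (dm_mono dmZ (leq_trunc_div k L)) (dm_adapted dmZ _ _ _).
apply: Psmall_sub osc => w [k [kN hk]]; exists N, k, (k %/ L * L)%N, a; split => //.
- exact: ltnW.
- exact: leq_trans (leq_trunc_div k L) (ltnW kN).
- rewrite {1}(divn_eq k L) natrD addrAC subrr add0r ger0_norm//.
  by apply: lt_le_trans hL; rewrite ltr_nat ltn_mod.
Qed.

(** With blocks of length [l] on the grid [M + m], the coarse sum over [2 ^ m] blocks belongs to the
    level [m] dyadic partition of $[0, l/2^M]$ in normalised time. These are the sums whose limit in
    probability is the bracket at that time. *)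
Lemma cov_coarse_small (lam eta : R) M l a b : 0 < lam -> 0 < eta -> (0 < l)%N -> (l <= 2 ^ M)%N ->
  exists m0, forall m, (m0 <= m)%N ->
  Psmall P eta [set w | lam < `|cov (M + m) a b (l * 2 ^ m) w - coarse_cov (M + m) l a b (2 ^ m) w|].
Proof.
move=> lam0 eta0 l0 lM.
have l2 : 0 < lam / 2 by rewrite divr_gt0.
have e0 : 0 < eta / 2 by rewrite divr_gt0.
have [dl dl0 [N0 h]] := lag_sum_small l2 e0.
have [m1 hm1] := pow2_gt dl^-1.
exists (maxn N0 m1) => m; rewrite geq_max => /andP[m0 mm1].
have NN : (N0 <= M + m)%N by rewrite (leq_trans m0)// leq_addl.
have hl : l%:R <= dl * 2 ^+ (M + m).
  rewrite exprD mulrCA; apply: (@le_trans _ _ (2 ^+ M * 1)).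
    by rewrite mulr1 -natrX ler_nat.
  rewrite ler_wpM2l ?exprn_ge0// -ler_pdivrMl// mulr1.
  by apply: le_trans (ltW hm1) _; rewrite ler_eXn2l// ltr1n.
apply: (@Psmall_le _ _ _ _ (eta / 2 + eta / 2)); first by lra.
apply: Psmall_sub (PsmallU (h _ l a b NN l0 hl) (h _ l b a NN l0 hl)) => w /=.
(* The final index is a multiple of [l], so there is no incomplete block. *)
rewrite (cov_coarse _ a b (l * 2 ^ m) w l0) mulKn// [X in Z _ X a w - _](mulnC l) !subrr mul0r addr0.
move=> hw; apply: contrapT => hn; move: hw; apply/negP; rewrite -leNgt.
have rN : (l * 2 ^ m <= 2 ^ (M + m))%N by rewrite expnD leq_mul2r lM orbT.
have h1 : `|lag_sum (M + m) l a b (l * 2 ^ m) w| <= lam / 2.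
  by rewrite leNgt; apply/negP => hh; apply: hn; left; exists (l * 2 ^ m)%N.
have h2 : `|lag_sum (M + m) l b a (l * 2 ^ m) w| <= lam / 2.
  by rewrite leNgt; apply/negP => hh; apply: hn; right; exists (l * 2 ^ m)%N.
set c := coarse_cov _ _ _ _ _ _; set u := lag_sum _ _ _ _ _ _ in h1 *; set v := lag_sum _ _ _ _ _ _ in h2 *.
rewrite (_ : _ - c = - (u + v)); last ring.
by rewrite normrN; apply: le_trans (ler_normD _ _) _; lra.
Qed.

(** Rounding [r] down to a multiple of the block length keeps the same complete blocks, so the
    coarse sums cancel. Four lag sums and one product of two oscillations remain. *)
Lemma cov_oscillation_small (lam eta : R) a b : 0 < lam -> 0 < eta ->
  exists M0, forall M, (M0 <= M)%N -> exists N0, forall N, (N0 <= N)%N -> (M <= N)%N /\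
  Psmall P eta [set w | exists r, (r <= 2 ^ N)%N /\
    lam < `|cov N a b r w - cov N a b (r %/ 2 ^ (N - M) * 2 ^ (N - M)) w|].
Proof.
move=> lam0 eta0.
have l8 : 0 < lam / 8 by rewrite divr_gt0.
have e3 : 0 < eta / 3 by rewrite divr_gt0.
have [dl dl0 [N0 h]] := lag_sum_small l8 e3.
pose e := Num.min 1 (lam / 4).
have e0 : 0 < e by rewrite lt_min ltr01 divr_gt0.
have e1 : e <= 1 by rewrite ge_min lexx.
have el : e <= lam / 4 by rewrite ge_min lexx orbT.
have [dl' dl'0 osc] := oscillation_small dmZ e0 e3.
have [M1 hM1] := pow2_gt dl^-1; have [M2 hM2] := pow2_gt dl'^-1.
exists (maxn M1 M2) => M; rewrite geq_max => /andP[MM1 MM2].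
have hM (x : R) : 0 < x -> (x^-1 < 2 ^+ M1 \/ x^-1 < 2 ^+ M2) ->
    forall N, (M <= N)%N -> (2 ^ (N - M))%:R < x * 2 ^+ N.
  move=> x0 hx N MN; rewrite natrX -ltr_pdivrMl// -[X in _ < 2 ^+ X](subnK MN) exprD mulrC.
  rewrite ltr_pM2l ?exprn_gt0//; case: hx => hx; apply: lt_le_trans hx _; by rewrite ler_eXn2l ?ltr1n.
exists (maxn N0 M) => N; rewrite geq_max => /andP[NN MN]; split => //.
set L := (2 ^ (N - M))%N.
have L0 : (0 < L)%N by rewrite expn_gt0.
have hL := hM dl dl0 (or_introl hM1) N MN.
have hL' := hM dl' dl'0 (or_intror hM2) N MN.
apply: (@Psmall_le _ _ _ _ (eta / 3 + eta / 3 + eta / 3)); first by lra.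
apply: Psmall_sub (PsmallU (PsmallU (h N L a b NN L0 (ltW hL)) (h N L b a NN L0 (ltW hL))) osc) => w /=.
move=> [r [rN hw]]; apply: contrapT => hn; move: hw; apply/negP; rewrite -leNgt.
pose r' := (r %/ L * L)%N.
have r'r : (r' <= r)%N by exact: leq_trunc_div.
have r'N := leq_trans r'r rN.
rewrite !(cov_coarse _ _ _ _ _ L0) -/r' mulnK// -/r' !subrr mul0r addr0.
have hJ c c' k : (k <= 2 ^ N)%N -> (c, c') = (a, b) \/ (c, c') = (b, a) -> `|lag_sum N L c c' k w| <= lam / 8.
  move=> kN hc; rewrite leNgt; apply/negP => hh; apply: hn; left.
  by case: hc hh => -[-> ->] hh; [left|right]; exists k.
have hZ c : `|Z N r c w - Z N r' c w| <= e.
  rewrite leNgt; apply/negP => hh; apply: hn; right; exists N, r, r', c; split => //.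
  rewrite {1}(divn_eq r L) natrD addrAC subrr add0r ger0_norm//.
  by apply: lt_trans hL'; rewrite ltr_nat ltn_mod.
have := hJ a b r rN (or_introl erefl); have := hJ a b r' r'N (or_introl erefl).
have := hJ b a r rN (or_intror erefl); have := hJ b a r' r'N (or_intror erefl).
set c := coarse_cov _ _ _ _ _ _.
have hp : `|(Z N r a w - Z N r' a w) * (Z N r b w - Z N r' b w)| <= lam / 4.
  rewrite normrM; apply: (@le_trans _ _ (e * e)); first by rewrite ler_pM.
  by apply: le_trans el; rewrite ler_piMr// ltW.
move: hp; set pp := (_ - _) * _.
rewrite !ler_norml => /andP[? ?] /andP[? ?] /andP[? ?] /andP[? ?] /andP[? ?].
by apply/andP; split; lra.
Qed.

(** The hypothesis gives smallness at each fixed dyadic time. For a fixed [M],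
    [cov_oscillation_small] reduces every index to one of finitely many such times, which yields
    uniformity in [r]. *)
Lemma bracket_uniformly_small a b a' b' (s : R) : `|s| <= 1 ->
  (forall M l (lam eta : R), (l <= 2 ^ M)%N -> 0 < lam -> 0 < eta -> exists m0, forall m, (m0 <= m)%N ->
    Psmall P eta [set w | lam <
      `|coarse_cov (M + m) l a b (2 ^ m) w + s * coarse_cov (M + m) l a' b' (2 ^ m) w|]) ->
  forall lam eta : R, 0 < lam -> 0 < eta -> exists N0, forall N, (N0 <= N)%N ->
    Psmall P eta [set w | exists r, (r <= 2 ^ N)%N /\ lam < `|cov N a b r w + s * cov N a' b' r w|].
Proof.
move=> s1 H lam eta lam0 eta0.
have sle (x : R) : `|s * x| <= `|x| by rewrite normrM ler_piMl.
have l4 : 0 < lam / 4 by rewrite divr_gt0.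
have l6 : 0 < lam / 6 by rewrite divr_gt0.
have e3 : 0 < eta / 3 by rewrite divr_gt0.
have [M1 h1] := cov_oscillation_small a b l4 e3.
have [M2 h2] := cov_oscillation_small a' b' l4 e3.
pose M := maxn M1 M2.
have [N1 {}h1] := h1 M (leq_maxl _ _).
have [N2 {}h2] := h2 M (leq_maxr _ _).
pose B N r w := cov N a b r w + s * cov N a' b' r w.
pose n := (2 ^ M).+1.
have hl (l : 'I_n) (e : R) : 0 < e -> exists m0, forall m, (m0 <= m)%N ->
    Psmall P e [set w | lam / 2 < `|B (M + m)%N (l * 2 ^ m)%N w|].
  move=> e0; have en3 : 0 < e / 3 by rewrite divr_gt0.
  have lM : (l <= 2 ^ M)%N by rewrite -ltnS.
  (* A block length must be positive, so time 0 is treated apart; the sums are empty there. *)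
  case: (posnP l) => [->|l0].
    exists 0%N => m _; exists set0; split => //; last by rewrite measure0 lee_fin ltW.
    by move=> w /=; rewrite /B /cov mul0n !big_ord0 mulr0 addr0 normr0; lra.
  have [m1 k1] := cov_coarse_small a b l6 en3 l0 lM.
  have [m2 k2] := cov_coarse_small a' b' l6 en3 l0 lM.
  have [m3 k3] := H M l _ _ lM l6 en3.
  exists (maxn m1 (maxn m2 m3)) => m; rewrite !geq_max => /and3P[mm1 mm2 mm3].
  apply: (@Psmall_le _ _ _ _ (e / 3 + e / 3 + e / 3)); first by lra.
  apply: Psmall_sub (PsmallU (PsmallU (k1 m mm1) (k2 m mm2)) (k3 m mm3)) => w /= hw.
  apply: contrapT => hn; move: hw; apply/negP; rewrite -leNgt /B.
  set u := cov _ _ _ _ _; set v := cov _ _ _ _ _.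
  have k1' : `|u - coarse_cov (M + m) l a b (2 ^ m) w| <= lam / 6.
    by rewrite leNgt; apply/negP => hh; apply: hn; left; left.
  have k2' : `|v - coarse_cov (M + m) l a' b' (2 ^ m) w| <= lam / 6.
    by rewrite leNgt; apply/negP => hh; apply: hn; left; right.
  have k3' : `|coarse_cov (M + m) l a b (2 ^ m) w + s * coarse_cov (M + m) l a' b' (2 ^ m) w| <= lam / 6.
    by rewrite leNgt; apply/negP => hh; apply: hn; right.
  move: k1' k2' k3'; set x := coarse_cov _ _ _ _ _ _; set y := coarse_cov _ _ _ _ _ _.
  move=> k1' k2' k3'.
  have k2'' := le_trans (sle (v - y)) k2'.
  rewrite (_ : u + s * v = (u - x) + s * (v - y) + (x + s * y)); last ring.
  apply: le_trans (ler_normD _ _) _; apply: le_trans (lerD (ler_normD _ _) (lexx _)) _.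
  by lra.
have [m0 hm] := Psmall_exists hl e3.
exists (maxn (maxn N1 N2) (M + m0)) => N; rewrite !geq_max => /andP[/andP[NN1 NN2] NM].
have MN : (M <= N)%N by apply: leq_trans NM; exact: leq_addr.
have [_ g1] := h1 N NN1; have [_ g2] := h2 N NN2.
have m0N : (m0 <= N - M)%N by rewrite leq_subRL.
have := hm _ m0N; rewrite subnKC// => g3.
apply: (@Psmall_le _ _ _ _ (eta / 3 + eta / 3 + eta / 3)); first by lra.
apply: Psmall_sub (PsmallU (PsmallU g1 g2) g3) => w /= [r [rN hr]].
apply: contrapT => hn; move: hr; apply/negP; rewrite -leNgt.
set L := (2 ^ (N - M))%N in hn.
have k1 : `|cov N a b r w - cov N a b (r %/ L * L) w| <= lam / 4.
  by rewrite leNgt; apply/negP => hh; apply: hn; left; left; exists r.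
have k2 : `|cov N a' b' r w - cov N a' b' (r %/ L * L) w| <= lam / 4.
  by rewrite leNgt; apply/negP => hh; apply: hn; left; right; exists r.
have lr : (r %/ L < n)%N.
  by rewrite ltnS -(@mulnK (2 ^ M) L) ?expn_gt0// leq_div2r// /L -expnD subnKC.
have k3 : `|B N (r %/ L * L)%N w| <= lam / 2.
  rewrite leNgt; apply/negP => hh; apply: hn; right.
  by exists (Ordinal lr).
move: k1 k2 k3; rewrite /B; set x := cov N a b _ _; set y := cov N a b _ _.
set x' := cov N a' b' _ _; set y' := cov N a' b' _ _ => k1 k2 k3.
have k2' := le_trans (sle (x' - y')) k2.
rewrite (_ : x + s * x' = (x - y) + s * (x' - y') + (y + s * y')); last ring.
apply: le_trans (ler_normD _ _) _; apply: le_trans (lerD (ler_normD _ _) (lexx _)) _.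
by lra.
Qed.

End Bracket.

Section Subsequence.
Context {d : measure_display} {T : measurableType d} {R : realType}.
Variable P : probability T R.

(** Borel-Cantelli: at stage [k] a grid is chosen whose bad set has probability at most [2 ^- k.+1],
    a summable bound. *)
Lemma Psmall_subsequence (A : nat -> nat -> set T) :
  (forall k (eta : R), 0 < eta -> exists N0, forall N, (N0 <= N)%N -> Psmall P eta (A k N)) ->
  exists phi : nat -> nat, (forall k, (k <= phi k)%N) /\
  exists2 N, P.-negligible N & forall w, ~ N w -> exists k0, forall k, (k0 <= k)%N -> ~ A k (phi k) w.
Proof.
move=> hA.
have h k : exists NE : nat * set T, [/\ (k <= NE.1)%N, measurable NE.2, A k NE.1 `<=` NE.2
    & (P NE.2 <= (2 ^- k.+1)%:E)%E].
  have e0 : 0 < 2 ^- k.+1 :> R by rewrite invr_gt0 exprn_gt0.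
  have [N0 hN] := hA k _ e0; have [E [mE AE PE]] := hN (maxn N0 k) (leq_maxl _ _).
  by exists (maxn N0 k, E); split => //=; exact: leq_maxr.
have [F hF] := choice h.
exists (fun k => (F k).1); split; first by move=> k; have [] := hF k.
pose E k := (F k).2.
have mE k : measurable (E k) by have [] := hF k.
have PE : P (lim_sup_set E) = 0%E.
  apply: lim_sup_set_cvg0 => //.
  have := @cvg_geometric_eseries_half R 1 0; rewrite expr0 divr1 => /cvg_lim hl.
  apply: (@le_lt_trans _ _ (\sum_(0 <= k <oo) ((1 : R) / (2 ^ (k + 1))%:R)%:E)%E); last first.
    by rewrite hl// ltry.
  apply: lee_nneseries => // k _; have [_ _ _] := hF k.
  by rewrite div1r addn1 natrX.
exists (lim_sup_set E); first by exists (lim_sup_set E); split => //;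
  apply: bigcap_measurable => // k _; exact: bigcup_measurable.
move=> w hw; have [k0 hk] : exists k0, ~ (\bigcup_(j >= k0) E j) w.
  by apply: contrapT => hn; apply: hw => k _; apply: contrapT => hk; apply: hn; exists k.
exists k0 => k kk Ak; apply: hk; exists k => //.
by have [_ _ AE _] := hF k; exact: AE.
Qed.

End Subsequence.

Section SlowlyVarying.
Variable R : realType.

Lemma block_sum (f B : nat -> R) (L r : nat) : (0 < L)%N ->
  \sum_(k < r) f (k %/ L * L)%N * (B k.+1 - B k)
  = \sum_(q < r %/ L) f (q * L)%N * (B (q.+1 * L)%N - B (q * L)%N)
    + f (r %/ L * L)%N * (B r - B (r %/ L * L)%N).
Proof.
move=> L0; elim: r => [|r IH].
  by rewrite big_ord0 div0n big_ord0 !subrr mulr0 addr0.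
rewrite big_ord_recr /= IH divnS//.
case: (boolP (L %| r.+1)%N) => dv /=; last by rewrite add0n; ring.
rewrite add1n big_ord_recr /=.
have <- : r.+1 = ((r %/ L).+1 * L)%N.
  by rewrite -[LHS](divnK dv) divnS// dv.
ring.
Qed.

(* Summation by parts over coarse blocks: only the modulus of continuity of [f] enters, not its variation. *)
Lemma slow_sum_cvg0 (phi : nat -> nat) (f b : nat -> nat -> R) (C V : R) :
  (forall k, (k <= phi k)%N) ->
  (forall k i, `|f k i| <= C) ->
  (forall e : R, 0 < e -> exists2 dl : R, 0 < dl & exists k0, forall k i j, (k0 <= k)%N ->
    (i <= 2 ^ phi k)%N -> (j <= 2 ^ phi k)%N -> `|i%:R - j%:R : R| < dl * 2 ^+ phi k ->
    `|f k i - f k j| <= e) ->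
  (forall k r, \sum_(i < r) `|b k i| <= V) ->
  (forall e : R, 0 < e -> exists k0, forall k r, (k0 <= k)%N -> (r <= 2 ^ phi k)%N ->
    `|\sum_(i < r) b k i| <= e) ->
  forall e : R, 0 < e -> exists k0, forall k r, (k0 <= k)%N -> (r <= 2 ^ phi k)%N ->
    `|\sum_(i < r) f k i * b k i| <= e.
Proof.
move=> phik fC fm bV b0 e e0.
have C0 : 0 <= C by exact: le_trans (fC 0%N 0%N).
have V0 : 0 <= V by have := bV 0%N 0%N; rewrite big_ord0.
have e1 : 0 < e / 2 / (V + 1) by rewrite !divr_gt0// ltr_wpDl.
have [dl dl0 [k1 h1]] := fm _ e1.
have [M hM] := pow2_gt dl^-1.
(* [2 ^+ M] bounds the number of complete blocks and the inner 1 counts the incomplete one; each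
   contributes at most [C * 2] times the bound on the partial sums of [b]. The outer 1 keeps [D]
   positive. *)
pose D := (2 ^+ M + 1) * (C * 2) + 1.
have D0 : 0 < D by rewrite /D ltr_wpDl// !mulr_ge0// addr_ge0// exprn_ge0.
have e2 : 0 < e / 2 / D by rewrite !divr_gt0.
have [k2 h2] := b0 _ e2.
exists (maxn (maxn k1 k2) M) => k r; rewrite !geq_max => /andP[/andP[kk1 kk2] kM] rN.
have MN : (M <= phi k)%N by exact: leq_trans kM (phik k).
pose L := (2 ^ (phi k - M))%N.
have L0 : (0 < L)%N by rewrite expn_gt0.
pose B r := \sum_(i < r) b k i.
have Bb m : (m <= 2 ^ phi k)%N -> `|B m| <= e / 2 / D by exact: h2.
have -> : \sum_(i < r) f k i * b k i = \sum_(i < r) (f k i - f k (i %/ L * L)%N) * b k i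
    + \sum_(i < r) f k (i %/ L * L)%N * (B i.+1 - B i).
  rewrite -big_split /=; apply: eq_bigr => i _.
  by rewrite /B big_ord_recr /=; ring.
rewrite block_sum//.
have s1 : `|\sum_(i < r) (f k i - f k (i %/ L * L)%N) * b k i| <= e / 2.
  apply: le_trans (ler_norm_sum _ _ _) _.
  apply: (@le_trans _ _ (\sum_(i < r) e / 2 / (V + 1) * `|b k i|)).
    apply: ler_sum => i _; rewrite normrM ler_wpM2r//.
    have iN : (i <= 2 ^ phi k)%N by apply: leq_trans rN; exact: ltnW.
    apply: h1 => //; first exact: leq_trans (leq_trunc_div i L) iN.
    rewrite {1}(divn_eq i L) natrD addrAC subrr add0r ger0_norm//.
    apply: (@lt_trans _ _ L%:R); first by rewrite ltr_nat ltn_mod.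
    rewrite /L natrX -ltr_pdivrMl// -[X in _ < 2 ^+ X](subnK MN) exprD mulrC.
    by rewrite ltr_pM2l ?exprn_gt0.
  rewrite -mulr_sumr; apply: (@le_trans _ _ (e / 2 / (V + 1) * V)).
    by rewrite ler_wpM2l// ltW.
  rewrite mulrAC ler_pdivrMr ?ltr_wpDl// ler_wpM2l//; [by rewrite divr_ge0 ?ltW|by rewrite lerDl].
have Bd m m' : (m <= 2 ^ phi k)%N -> (m' <= 2 ^ phi k)%N -> `|B m - B m'| <= 2 * (e / 2 / D).
  move=> hm hm'; apply: le_trans (ler_normB _ _) _.
  by have := Bb m hm; have := Bb m' hm'; set z := e / 2 / D; lra.
have fB i m m' : (m <= 2 ^ phi k)%N -> (m' <= 2 ^ phi k)%N ->
    `|f k i * (B m - B m')| <= C * (2 * (e / 2 / D)).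
  by move=> hm hm'; rewrite normrM ler_pM// Bd.
have rL : (r %/ L <= 2 ^ M)%N.
  by rewrite -(@mulnK (2 ^ M) L)// leq_div2r// /L -expnD subnKC.
have qL q : (q <= r %/ L)%N -> (q * L <= 2 ^ phi k)%N.
  move=> hq; apply: leq_trans rN; apply: leq_trans (leq_trunc_div r L).
  by rewrite leq_mul2r hq orbT.
have s2 : `|\sum_(q < r %/ L) f k (q * L)%N * (B (q.+1 * L)%N - B (q * L)%N)| <=
    2 ^+ M * (C * (2 * (e / 2 / D))).
  apply: le_trans (ler_norm_sum _ _ _) _.
  apply: (@le_trans _ _ (\sum_(q < r %/ L) C * (2 * (e / 2 / D)))).
    by apply: ler_sum => q _; apply: fB; apply: qL => //; exact: ltnW.
  rewrite sumr_const card_ord -[leLHS]mulr_natl ler_wpM2r//.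
    by rewrite mulr_ge0// mulr_ge0// ltW.
  by rewrite -natrX ler_nat.
have s3 : `|f k (r %/ L * L)%N * (B r - B (r %/ L * L)%N)| <= C * (2 * (e / 2 / D)).
  by apply: fB => //; exact: qL.
have s4 : (2 ^+ M + 1) * (C * (2 * (e / 2 / D))) <= e / 2.
  rewrite (_ : _ * _ = (2 ^+ M + 1) * (C * 2) * (e / 2) / D); last by field; rewrite gt_eqF.
  rewrite ler_pdivrMr// mulrC ler_wpM2l ?divr_ge0 ?(ltW e0)// /D lerDl//.
apply: le_trans (ler_normD _ _) _; apply: le_trans (lerD s1 (ler_normD _ _)) _.
apply: le_trans (lerD (lexx _) (lerD s2 s3)) _.
move: s4; set z := C * _; lra.
Qed.

End SlowlyVarying.

(** * Polynomials of a conformal martingale *)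

Section ConformalCalculus.
Context {d : measure_display} {T : measurableType d} {R : realType}.
Variable P : probability T R.
Variables (n : nat) (Z : nat -> nat -> 'I_n + 'I_n -> T -> R) (ZT : 'I_n + 'I_n -> T -> R).
Variable G : nat -> nat -> set (set T).
Hypothesis dmZ : dyadic_martingale P Z ZT G.
Variables (phi : nat -> nat) (Nul : set T) (K : R).
Hypothesis phi_ge : forall k, (k <= phi k)%N.
Hypothesis Nul_null : P.-negligible Nul.
Hypothesis K0 : 0 <= K.

Definition never : nat -> T -> bool := fun _ _ => true.
Let W a k r w := stopped (Z (phi k)) K never r a w.
Let sn k i w := sincr_norm (Z (phi k)) K never i w.

Definition delta (a : nat -> nat -> T -> R) k i w := a k i.+1 w - a k i w.

(** An algebra of bounded adapted processes that vary no faster than the stopped martingale: it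
    contains the polynomials in that martingale, and [slow_sum_cvg0] applies to it. The modulus
    along a path is required only from some [k0] on, since on coarse grids a large increment may
    have been dropped. *)
Definition slow (a : nat -> nat -> T -> R) : Prop :=
  [/\ (forall k r, measurable_wrt (G (phi k) r) (a k r)),
      (exists C, forall k r w, `|a k r w| <= C),
      (exists C, forall k i w, `|delta a k i w| <= C * sn k i w) &
      forall w (e : R), 0 < e -> exists2 dl : R, 0 < dl & exists k0, forall k i j, (k0 <= k)%N ->
        (i <= 2 ^ phi k)%N -> (j <= 2 ^ phi k)%N -> `|i%:R - j%:R : R| < dl * 2 ^+ phi k ->
        `|a k i w - a k j w| <= e].

Definition unif0 (b : nat -> nat -> T -> R) : Prop :=
  forall w, ~ Nul w -> forall e : R, 0 < e -> exists k0, forall k r, (k0 <= k)%N -> (r <= 2 ^ phi k)%N ->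
    `|\sum_(i < r) b k i w| <= e.

Definition quad_bounded (b : nat -> nat -> T -> R) : Prop :=
  exists C, forall k i w, `|b k i w| <= C * sn k i w ^+ 2.

Definition Esum (h a : nat -> nat -> T -> R) k : R :=
  Ex P (fun w => \sum_(i < 2 ^ phi k) h k i w * delta a k i w).

(** An asymptotic martingale property. Testing against all slow [h], not only constants, makes it
    stable under products: one factor moves into the test process. *)
Definition driftless (a : nat -> nat -> T -> R) : Prop :=
  forall h, slow h -> Esum h a @ \oo --> (0 : R).

Let sn0 k i w : 0 <= sn k i w. Proof. exact: sincr_norm_ge0. Qed.

Let sn_sum k r w : \sum_(i < r) sn k i w ^+ 2 <= K + 1.
Proof. by apply: stopped_quad_var => //; exact: (dm_start dmZ). Qed.

Let never_ad k i : measurable_wrt (G (phi k) i) (never i).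
Proof. by apply: measurable_wrt_cst; exact: (dm_sigma dmZ). Qed.

Lemma pos_bound (S : Type) (f g : S -> R) (C : R) : (forall s, 0 <= g s) ->
  (forall s, `|f s| <= C * g s) -> exists2 C', 0 <= C' & forall s, `|f s| <= C' * g s.
Proof.
move=> g0 h; exists `|C| => // s; apply: le_trans (h s) _.
by rewrite ler_wpM2r// ler_norm.
Qed.

Lemma slow_delta a : slow a -> exists2 C, 0 <= C & forall k i w, `|delta a k i w| <= C * sn k i w.
Proof.
case=> _ _ [C hC] _.
have [C' C'0 h] := @pos_bound (nat * nat * T) (fun s => delta a s.1.1 s.1.2 s.2)
  (fun s => sn s.1.1 s.1.2 s.2) C (fun s => sn0 _ _ _) (fun s => hC _ _ _).
by exists C' => // k i w; exact: (h (k, i, w)).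
Qed.

Lemma slow_bound a : slow a -> exists2 C, 0 <= C & forall k i w, `|a k i w| <= C.
Proof.
case=> _ [C hC] _ _; exists `|C| => // k i w.
exact: le_trans (hC k i w) (ler_norm _).
Qed.

Lemma slow_measurable a k r : slow a -> measurable_fun setT (a k r).
Proof. by case=> ma _ _ _; apply: measurable_wrt_measurable (ma k r); exact: (dm_measurable dmZ). Qed.

Lemma slow_cst c : slow (fun _ _ _ => c).
Proof.
split.
- by move=> k r; apply: measurable_wrt_cst; exact: (dm_sigma dmZ).
- by exists `|c|.
- by exists 0 => k i w; rewrite /delta subrr normr0 mul0r.
- by move=> w e e0; exists 1 => //; exists 0%N => *; rewrite subrr normr0 ltW.
Qed.

Lemma slowD a b : slow a -> slow b -> slow (fun k r w => a k r w + b k r w).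
Proof.
move=> sa sb; split.
- move=> k r; apply: measurable_wrtD; [exact: (dm_sigma dmZ)|by case: sa|by case: sb].
- have [C _ hC] := slow_bound sa; have [C' _ hC'] := slow_bound sb.
  by exists (C + C') => k r w; apply: le_trans (ler_normD _ _) _; exact: lerD.
- have [C _ hC] := slow_delta sa; have [C' _ hC'] := slow_delta sb.
  exists (C + C') => k r w; rewrite mulrDl; apply: le_trans (lerD (hC k r w) (hC' k r w)).
  by rewrite /delta opprD addrACA ler_normD.
- move=> w e e0; have e2 : 0 < e / 2 by rewrite divr_gt0.
  have [_ _ _ /(_ w _ e2) [dl dl0 [k0 h]]] := sa; have [_ _ _ /(_ w _ e2) [dl' dl'0 [k0' h']]] := sb.
  exists (Num.min dl dl'); first by rewrite lt_min dl0.
  exists (maxn k0 k0') => k i j; rewrite geq_max => /andP[kk kk'] iN jN ij.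
  rewrite opprD addrACA; apply: le_trans (ler_normD _ _) _.
  rewrite [leRHS]splitr lerD ?h ?h'//; apply: lt_le_trans ij _.
    by rewrite ler_wpM2r ?exprn_ge0// ge_min lexx.
  by rewrite ler_wpM2r ?exprn_ge0// ge_min lexx orbT.
Qed.

Lemma slowM a b : slow a -> slow b -> slow (fun k r w => a k r w * b k r w).
Proof.
move=> sa sb; have [C C0 hC] := slow_bound sa; have [C' C'0 hC'] := slow_bound sb.
have split_ (x y x' y' : R) : x' * y' - x * y = (x' - x) * y' + x * (y' - y) by ring.
split.
- move=> k r; apply: measurable_wrtM; [exact: (dm_sigma dmZ)|by case: sa|by case: sb].
- by exists (C * C') => k r w; rewrite normrM ler_pM.
- have [D _ hD] := slow_delta sa; have [D' _ hD'] := slow_delta sb.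
  exists (D * C' + C * D') => k r w; rewrite /delta split_ [leRHS]mulrDl.
  apply: le_trans (ler_normD _ _) _; rewrite !normrM; apply: lerD.
    by rewrite mulrAC ler_pM// hD.
  by rewrite -mulrA ler_pM// hD'.
- move=> w e e0; have e2 : 0 < e / 2 / (C + C' + 1) by rewrite !divr_gt0// ltr_wpDl// addr_ge0.
  have [_ _ _ /(_ w _ e2) [dl dl0 [k0 h]]] := sa; have [_ _ _ /(_ w _ e2) [dl' dl'0 [k0' h']]] := sb.
  exists (Num.min dl dl'); first by rewrite lt_min dl0.
  exists (maxn k0 k0') => k i j; rewrite geq_max => /andP[kk kk'] iN jN ij.
  rewrite split_; apply: le_trans (ler_normD _ _) _; rewrite !normrM.
  set z := e / 2 / _ in e2 h h'.
  have ze : z * (C + C' + 1) = e / 2 by rewrite divfK// gt_eqF// ltr_wpDl// addr_ge0.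
  have h1 : `|a k i w - a k j w| * `|b k i w| <= z * C'.
    rewrite ler_pM ?h//; apply: lt_le_trans ij _.
    by rewrite ler_wpM2r ?exprn_ge0// ge_min lexx.
  have h2 : `|a k j w| * `|b k i w - b k j w| <= C * z.
    rewrite ler_pM ?h'//; apply: lt_le_trans ij _.
    by rewrite ler_wpM2r ?exprn_ge0// ge_min lexx orbT.
  apply: le_trans (lerD h1 h2) _; nra.
Qed.

Lemma slowZ c a : slow a -> slow (fun k r w => c * a k r w).
Proof. by move=> sa; apply: slowM => //; exact: slow_cst. Qed.

Lemma slowB a b : slow a -> slow b -> slow (fun k r w => a k r w - b k r w).
Proof.
move=> sa sb; rewrite (_ : (fun _ => _) = fun k r w => a k r w + (-1) * b k r w); first exact/slowD/slowZ.
by apply/funext => k; apply/funext => r; apply/funext => w; rewrite mulN1r.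
Qed.

Lemma delta_W a k i w : delta (W a) k i w = sincr (Z (phi k)) K never i a w.
Proof. by rewrite /delta /W /stopped big_ord_recr /= addrAC subrr add0r. Qed.

(** From some grid on, no increment of the given path exceeds 1, so none is dropped: the stopped
    path follows the original one up to the first dead index and is constant afterwards. *)
Lemma slow_W a : slow (W a).
Proof.
split.
- move=> k r; apply: stopped_ad => //; [exact: (dm_sigma dmZ)|exact: (dm_mono dmZ)|exact: (dm_adapted dmZ)].
- exists (K + 1) => k r w; apply: stopped_bound => //; exact: (dm_start dmZ).
- by exists 1 => k i w; rewrite delta_W mul1r; exact: le_sincr_norm.
move=> w e e0; have [dl dl0 h] := dm_continuous dmZ w e0.
have [N0 hN0] := incr_norm_eventually dmZ w ltr01.
exists dl => //; exists N0 => k.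
pose al := alive (Z (phi k)) K never.
have WZ i : (i <= 2 ^ phi k)%N -> al i w -> W a k i w = Z (phi k) i a w.
  move=> iN ai; apply: alive_stopped => //; exact: (dm_start dmZ).
suff main i j : (N0 <= k)%N -> (i <= j)%N -> (j <= 2 ^ phi k)%N ->
    `|i%:R - j%:R : R| < dl * 2 ^+ phi k -> `|W a k i w - W a k j w| <= e.
  move=> i j Nk iN jN ij; case: (leqP i j) => hij; first exact: main.
  by rewrite distrC; apply: main => //; [exact: ltnW|rewrite distrC].
move=> Nk ij jN hij; have iN := leq_trans ij jN.
case: (boolP (al j w)) => aj.
  by rewrite !WZ ?h// /al (alive_le ij).
case: (ex_minnP (ex_intro (fun m => ~~ al m w) j aj)) => m am mmin.
have mj : (m <= j)%N by exact: mmin.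
have mN := leq_trans mj jN.
have dead r : (m <= r)%N -> W a k r w = W a k m w.
  move=> mr; apply: (@sum_sincr_dead _ _ _ _ (Z (phi k)) K never
    (fun i w => sincr (Z (phi k)) K never i a w)) => //.
  by move=> i0 hi; rewrite /sincr hi mul0r.
(* All steps before the first dead index [m] were taken, including the last one, because increments
   are at most 1 here. *)
have WZm : W a k m w = Z (phi k) m a w.
  rewrite /W /stopped -[RHS]subr0 -[X in _ - X](dm_start dmZ (phi k) a w).
  rewrite -(telescope_sumr (fun i => Z (phi k) i a w) (leq0n m)) big_mkord.
  apply: eq_bigr => q _.
  have aq : al q w by apply: contraT => hq; have := mmin q hq; rewrite leqNgt ltn_ord.
  rewrite /sincr /active [X in X && _]aq hN0 ?mul1r//.
    exact: leq_trans Nk (phi_ge k).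
  exact: leq_trans (ltn_ord q) mN.
rewrite (dead j mj); case: (leqP m i) => mi; first by rewrite (dead i mi) subrr normr0 ltW.
have ai : al i w by apply: contraT => hi; have := mmin i hi; rewrite leqNgt mi.
rewrite WZm WZ// h//; apply: le_lt_trans hij.
rewrite !(distrC i%:R) !ger0_norm ?subr_ge0 ?ler_nat ?(ltnW mi)//.
by rewrite lerD2r ler_nat.
Qed.

Lemma quad_bounded_deltaM a b : slow a -> slow b ->
  quad_bounded (fun k i w => delta a k i w * delta b k i w).
Proof.
move=> /slow_delta [C C0 hC] /slow_delta [C' C'0 hC'].
exists (C * C') => k i w; rewrite normrM expr2 mulrACA ler_pM//.
Qed.

Lemma quad_boundedD a b : quad_bounded a -> quad_bounded b ->
  quad_bounded (fun k i w => a k i w + b k i w).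
Proof.
move=> [C hC] [C' hC']; exists (C + C') => k i w; rewrite mulrDl.
by apply: le_trans (ler_normD _ _) _; exact: lerD.
Qed.

Lemma quad_boundedB a b : quad_bounded a -> quad_bounded b ->
  quad_bounded (fun k i w => a k i w - b k i w).
Proof.
move=> [C hC] [C' hC']; exists (C + C') => k i w; rewrite mulrDl.
by apply: le_trans (ler_normB _ _) _; exact: lerD.
Qed.

Lemma quad_boundedM f b : slow f -> quad_bounded b -> quad_bounded (fun k i w => f k i w * b k i w).
Proof.
move=> /slow_bound [C C0 hC] [C' hC']; exists (C * C') => k i w.
by rewrite normrM -mulrA ler_pM.
Qed.

Lemma quad_bounded_sum b : quad_bounded b -> exists2 V, 0 <= V & forall k r w, \sum_(i < r) `|b k i w| <= V.
Proof.
move=> [C hC]; exists (`|C| * (K + 1)); first by rewrite mulr_ge0 ?addr_ge0.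
move=> k r w; apply: (@le_trans _ _ (\sum_(i < r) `|C| * sn k i w ^+ 2)).
  apply: ler_sum => i _; apply: le_trans (hC k i w) _.
  by rewrite ler_wpM2r ?sqr_ge0// ler_norm.
by rewrite -mulr_sumr ler_wpM2l.
Qed.

Lemma eq_unif0 a b : (forall k i w, a k i w = b k i w) -> unif0 a -> unif0 b.
Proof.
move=> ab ha w hw e e0; have [k0 h] := ha w hw e e0; exists k0 => k r kk rN.
by rewrite (eq_bigr (fun i : 'I_r => a k i w)) ?h// => i _; rewrite ab.
Qed.

Lemma unif0D a b : unif0 a -> unif0 b -> unif0 (fun k i w => a k i w + b k i w).
Proof.
move=> ha hb w hw e e0; have e2 : 0 < e / 2 by rewrite divr_gt0.
have [k0 h] := ha w hw _ e2; have [k1 h'] := hb w hw _ e2.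
exists (maxn k0 k1) => k r; rewrite geq_max => /andP[kk kk'] rN.
rewrite big_split /= [leRHS]splitr; apply: le_trans (ler_normD _ _) _.
by rewrite lerD ?h ?h'.
Qed.

Lemma unif0N a : unif0 a -> unif0 (fun k i w => - a k i w).
Proof.
move=> ha w hw e e0; have [k0 h] := ha w hw _ e0; exists k0 => k r kk rN.
by rewrite sumrN normrN h.
Qed.

Lemma unif0B a b : unif0 a -> unif0 b -> unif0 (fun k i w => a k i w - b k i w).
Proof. by move=> ha hb; apply: unif0D => //; exact: unif0N. Qed.

(** A quadratically bounded [b] has total variation below a constant, so [slow_sum_cvg0] applies
    along each path. *)
Lemma unif0M f b : slow f -> unif0 b -> quad_bounded b -> unif0 (fun k i w => f k i w * b k i w).
Proof.
move=> sf hb qb w hw.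
have [C C0 hC] := slow_bound sf; have [V V0 hV] := quad_bounded_sum qb.
apply: (@slow_sum_cvg0 R phi (fun k i => f k i w) (fun k i => b k i w) C V) => //.
- by case: sf => _ _ _ /(_ w).
- exact: hb.
Qed.

(** One factor is controlled by the largest increment, which tends to zero along the path, the other
    two by the bounded quadratic sum. *)
Lemma unif0_cubic a b c : slow a -> slow b -> slow c ->
  unif0 (fun k i w => delta a k i w * delta b k i w * delta c k i w).
Proof.
move=> /slow_delta [C1 C10 h1] /slow_delta [C2 C20 h2] /slow_delta [C3 C30 h3] w _ e e0.
have c0 : 0 < C1 * C2 * C3 * (K + 1) + 1 by rewrite ltr_wpDl// !mulr_ge0 ?addr_ge0.
have [N0 hN0] := incr_norm_eventually dmZ w (divr_gt0 e0 c0).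
exists N0 => k r Nk rN; apply: le_trans (ler_norm_sum _ _ _) _.
set z := e / _ in hN0.
have z0 : 0 < z by rewrite divr_gt0.
apply: (@le_trans _ _ (\sum_(i < r) C1 * C2 * C3 * z * sn k i w ^+ 2)).
  apply: ler_sum => i _; rewrite !normrM.
  apply: (@le_trans _ _ (C1 * sn k i w * (C2 * sn k i w) * (C3 * sn k i w))).
    by rewrite !ler_pM ?mulr_ge0.
  rewrite (_ : _ * _ = C1 * C2 * C3 * sn k i w ^+ 2 * sn k i w); last ring.
  rewrite [leRHS]mulrAC ler_wpM2l ?mulr_ge0 ?sqr_ge0//.
  rewrite /sn sincr_normE; case: (active _ _ _ _ _); last by rewrite mul0r ltW.
  rewrite mul1r hN0//; first exact: leq_trans Nk (phi_ge k).
  exact: leq_trans (ltn_ord i) rN.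
rewrite -mulr_sumr; apply: (@le_trans _ _ (C1 * C2 * C3 * z * (K + 1))).
  by rewrite ler_wpM2l// (mulr_ge0 _ (ltW z0))// !mulr_ge0.
rewrite mulrAC [leRHS](_ : e = (C1 * C2 * C3 * (K + 1) + 1) * z); last by rewrite mulrC divfK// gt_eqF.
by rewrite ler_wpM2r ?(ltW z0)// lerDl.
Qed.

Lemma unif0_Ex b : unif0 b -> quad_bounded b -> (forall k i, measurable_fun setT (b k i)) ->
  (fun k => Ex P (fun w => \sum_(i < 2 ^ phi k) b k i w)) @ \oo --> (0 : R).
Proof.
move=> hb qb mb; have [V V0 hV] := quad_bounded_sum qb.
apply: (@dominated_Ex0 _ _ _ P _ (fun=> V) Nul) => //.
- by move=> k; exact: measurable_sum.
- exact: intble_cst.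
- by move=> k w; apply: le_trans (ler_norm_sum _ _ _) _.
move=> w hw; apply/cvgr0Pnorm_le => e e0.
have [k0 h] := hb w hw e e0.
by exists k0 => // k kk; apply: h.
Qed.

Lemma measurable_delta a k i : slow a -> measurable_fun setT (delta a k i).
Proof. by move=> sa; apply: measurable_funB; exact: slow_measurable. Qed.

Lemma intble_Esum h a k m : slow h -> slow a ->
  intble P (fun w => \sum_(i < m) h k i w * delta a k i w).
Proof.
move=> sh sa; have [C C0 hC] := slow_bound sh; have [C' C'0 hC'] := slow_bound sa.
apply: intble_sum => i; apply: (@intble_bounded _ _ _ P _ (C * (C' + C'))).
  by apply: measurable_funM; [exact: slow_measurable|exact: measurable_delta].
move=> w; rewrite normrM ler_pM//; apply: le_trans (ler_normB _ _) _; exact: lerD.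
Qed.

Lemma driftless_W a : driftless (W a).
Proof.
move=> h sh; have [C C0 hC] := slow_bound sh.
apply/cvgr0Pnorm_le => e e0.
have [N0 hN0] := drift_error_small dmZ a K0 (divr_gt0 e0 (ltr_wpDl C0 ltr01)).
exists N0 => // k /= Nk.
have := @drift_bound _ _ _ P _ (2 ^ phi k) (Z (phi k)) (G (phi k)) K never
  (dm_sigma dmZ _) (dm_measurable dmZ (N:=_)) (dm_mono dmZ (N:=_)) (dm_adapted dmZ _)
  (never_ad k) (dm_intble dmZ _)
  (dm_martingale dmZ (N:=_)) a (h k) C _ (hC k).
rewrite /Esum; under [X in Ex P X]eq_fun do under eq_bigr do rewrite -delta_W.
case: sh => mh _ _ _ /(_ (mh k)) hh; apply: le_trans hh _.
have := hN0 (phi k) never (leq_trans Nk (phi_ge k)) (never_ad k).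
set z := drift_error _ _ _ _ _ _; move=> hz.
apply: le_trans (ler_wpM2l C0 hz) _.
by rewrite mulrA ler_pdivrMr ?ltr_wpDl// [leRHS]mulrC ler_wpM2r ?(ltW e0)// lerDl.
Qed.

Lemma driftlessD a b : slow a -> slow b -> driftless a -> driftless b ->
  driftless (fun k r w => a k r w + b k r w).
Proof.
move=> sa sb ha hb h sh.
rewrite (_ : Esum _ _ = fun k => Esum h a k + Esum h b k).
  by rewrite -[X in _ --> X]addr0; apply: cvgD; [exact: ha|exact: hb].
apply/funext => k; rewrite /Esum -ExD; [|exact: intble_Esum..].
congr Ex; apply/funext => w; rewrite -big_split; apply: eq_bigr => i _ /=.
by rewrite /delta; ring.
Qed.

(** Discrete product rule: the increment of $ax$ is $a\,\delta x + x\,\delta a + \delta a\,\delta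
    x$. In the first two terms a factor joins the test process. The quadratic terms need to vanish
    only in the combination with [s], the real or imaginary part of a complex bracket. *)
Lemma driftlessM (s : R) a b x y : slow a -> slow b -> slow x -> slow y ->
  driftless a -> driftless b -> driftless x -> driftless y ->
  unif0 (fun k i w => delta a k i w * delta x k i w + s * (delta b k i w * delta y k i w)) ->
  driftless (fun k r w => a k r w * x k r w + s * (b k r w * y k r w)).
Proof.
move=> sa sb sx sy ha hb hx hy u0 h sh.
pose be k i w := delta a k i w * delta x k i w + s * (delta b k i w * delta y k i w).
have qbe : quad_bounded be.
  apply: quad_boundedD; first exact: quad_bounded_deltaM.
  exact: (quad_boundedM (slow_cst s) (quad_bounded_deltaM sb sy)).
pose hs k r w := s * h k r w.
have shs : slow hs by exact: slowZ.
pose F k := Esum (fun k r w => h k r w * a k r w) x k + Esum (fun k r w => hs k r w * b k r w) y k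
  + Esum (fun k r w => h k r w * x k r w) a k + Esum (fun k r w => hs k r w * y k r w) b k
  + Ex P (fun w => \sum_(i < 2 ^ phi k) h k i w * be k i w).
have mbe k i : measurable_fun setT (fun w => h k i w * be k i w).
  apply: measurable_funM; first exact: slow_measurable.
  apply: measurable_funD; first by apply: measurable_funM; exact: measurable_delta.
  by apply: measurable_funM => //; apply: measurable_funM; exact: measurable_delta.
have qhb : quad_bounded (fun k i w => h k i w * be k i w) by exact: quad_boundedM.
rewrite (_ : Esum _ _ = F).
  rewrite /F -[X in _ --> X]addr0; apply: cvgD; last first.
    by apply: (unif0_Ex (b := fun k i w => h k i w * be k i w)) => //; exact: unif0M.
  rewrite -[X in _ --> X]addr0; apply: cvgD; last by apply: hb; exact: slowM.
  rewrite -[X in _ --> X]addr0; apply: cvgD; last by apply: ha; exact: slowM.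
  rewrite -[X in _ --> X]addr0; apply: cvgD; last by apply: hy; exact: slowM.
  by apply: hx; exact: slowM.
apply/funext => k; rewrite /F /Esum.
have [V V0 hV] := quad_bounded_sum qhb.
have ibe : intble P (fun w => \sum_(i < 2 ^ phi k) h k i w * be k i w).
  apply: (@intble_bounded _ _ _ P _ V); first exact: measurable_sum.
  by move=> w; apply: le_trans (ler_norm_sum _ _ _) _.
have i1 := intble_Esum k (2 ^ phi k) (slowM sh sa) sx.
have i2 := intble_Esum k (2 ^ phi k) (slowM shs sb) sy.
have i3 := intble_Esum k (2 ^ phi k) (slowM sh sx) sa.
have i4 := intble_Esum k (2 ^ phi k) (slowM shs sy) sb.
have i12 := intbleD i1 i2; have i123 := intbleD i12 i3; have i1234 := intbleD i123 i4.
rewrite -(ExD i1 i2) -(ExD i12 i3) -(ExD i123 i4) -(ExD i1234 ibe).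
congr Ex; apply/funext => w; rewrite -!big_split; apply: eq_bigr => i _ /=.
by rewrite /be /hs /delta; ring.
Qed.

(* The properties of the real and imaginary parts of [f(Z)], [f] holomorphic, that survive products. *)
Definition conformal (a b : nat -> nat -> T -> R) : Prop :=
  [/\ slow a /\ slow b, driftless a, driftless b &
   forall j, unif0 (fun k i w => delta a k i w * delta (W (inl j)) k i w
                               - delta b k i w * delta (W (inr j)) k i w) /\
             unif0 (fun k i w => delta a k i w * delta (W (inr j)) k i w
                               + delta b k i w * delta (W (inl j)) k i w)].

Lemma conformal_cst c c' : conformal (fun _ _ _ => c) (fun _ _ _ => c').
Proof.
have dr c0 : driftless (fun _ _ _ => c0).
  move=> h _; rewrite (_ : Esum _ _ = cst 0); first exact: cvg_cst.
  apply/funext => k; rewrite /Esum -[RHS](Ex_cst P); congr Ex; apply/funext => w.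
  by rewrite big1// => i _; rewrite /delta subrr mulr0.
split; [by split; exact: slow_cst|exact: dr|exact: dr|].
move=> j; split => w _ e e0; exists 0%N => k r _ _; rewrite big1 ?normr0 ?ltW// => i _;
  by rewrite /delta !subrr !mul0r ?subrr ?addr0.
Qed.

Lemma conformalD a b a' b' : conformal a b -> conformal a' b' ->
  conformal (fun k r w => a k r w + a' k r w) (fun k r w => b k r w + b' k r w).
Proof.
move=> [[sa sb] da db h] [[sa' sb'] da' db' h']; split.
- by split; exact: slowD.
- exact: driftlessD.
- exact: driftlessD.
move=> j; have [h1 h2] := h j; have [h1' h2'] := h' j; split.
  by apply: eq_unif0 (unif0D h1 h1') => k i w; rewrite /delta; ring.
by apply: eq_unif0 (unif0D h2 h2') => k i w; rewrite /delta; ring.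
Qed.

Lemma conformal_sum (J : Type) (s : seq J) (a b : J -> nat -> nat -> T -> R) :
  (forall j, conformal (a j) (b j)) ->
  conformal (fun k r w => \sum_(j <- s) a j k r w) (fun k r w => \sum_(j <- s) b j k r w).
Proof.
move=> h; elim: s => [|j s IH].
  have := conformal_cst 0 0; congr conformal;
    by apply/funext => k; apply/funext => r; apply/funext => w; rewrite big_nil.
have := conformalD (h j) IH; congr conformal;
  by apply/funext => k; apply/funext => r; apply/funext => w; rewrite big_cons.
Qed.

Hypothesis bracket_re : forall j l,
  unif0 (fun k i w => delta (W (inl j)) k i w * delta (W (inl l)) k i w
                    - delta (W (inr j)) k i w * delta (W (inr l)) k i w).
Hypothesis bracket_im : forall j l,
  unif0 (fun k i w => delta (W (inl j)) k i w * delta (W (inr l)) k i w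
                    + delta (W (inr j)) k i w * delta (W (inl l)) k i w).

(** With $f = a + ib$, the bracket of $fZ^j$ with $Z^l$ has three parts: $f$ times that of $Z^j,
    Z^l$, which vanishes by [bracket_re] and [bracket_im]; $Z^j$ times that of $f, Z^l$, which
    vanishes as $f$ is conformal; and a cubic remainder. *)
Lemma conformalM a b j : conformal a b ->
  conformal (fun k r w => a k r w * W (inl j) k r w - b k r w * W (inr j) k r w)
            (fun k r w => a k r w * W (inr j) k r w + b k r w * W (inl j) k r w).
Proof.
move=> [[sa sb] da db h].
have sW c := slow_W c; have dW c := @driftless_W c.
have [h1 h2] := h j.
split.
- by split; [apply: slowB|apply: slowD]; exact: slowM.
- have h1' : unif0 (fun k i w => delta a k i w * delta (W (inl j)) k i w
      + -1 * (delta b k i w * delta (W (inr j)) k i w)).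
    by apply: eq_unif0 h1 => k i w; ring.
  have := driftlessM sa sb (sW _) (sW _) da db (dW _) (dW _) h1'.
  by congr driftless; apply/funext => k; apply/funext => r; apply/funext => w; ring.
- have h2' : unif0 (fun k i w => delta a k i w * delta (W (inr j)) k i w
      + 1 * (delta b k i w * delta (W (inl j)) k i w)).
    by apply: eq_unif0 h2 => k i w; ring.
  have := driftlessM sa sb (sW _) (sW _) da db (dW _) (dW _) h2'.
  by congr driftless; apply/funext => k; apply/funext => r; apply/funext => w; ring.
move=> l; have [g1 g2] := h l.
have qd c c' := quad_bounded_deltaM (sW c) (sW c').
have qa c := quad_bounded_deltaM sa (sW c).
have qb c := quad_bounded_deltaM sb (sW c).
have cub c c' : unif0 (fun k i w => delta a k i w * delta (W c) k i w * delta (W c') k i w).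
  exact: unif0_cubic.
have cub' c c' : unif0 (fun k i w => delta b k i w * delta (W c) k i w * delta (W c') k i w).
  exact: unif0_cubic.
have a1 := unif0M sa (bracket_re j l) (quad_boundedB (qd _ _) (qd _ _)).
have a2 := unif0M sa (bracket_im j l) (quad_boundedD (qd _ _) (qd _ _)).
have b1 := unif0M sb (bracket_re j l) (quad_boundedB (qd _ _) (qd _ _)).
have b2 := unif0M sb (bracket_im j l) (quad_boundedD (qd _ _) (qd _ _)).
have x1 := unif0M (sW (inl j)) g1 (quad_boundedB (qa _) (qb _)).
have x2 := unif0M (sW (inl j)) g2 (quad_boundedD (qa _) (qb _)).
have y1 := unif0M (sW (inr j)) g1 (quad_boundedB (qa _) (qb _)).
have y2 := unif0M (sW (inr j)) g2 (quad_boundedD (qa _) (qb _)).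
split.
  have c1 := unif0B (unif0B (cub (inl j) (inl l)) (cub' (inr j) (inl l)))
                    (unif0D (cub (inr j) (inr l)) (cub' (inl j) (inr l))).
  apply: eq_unif0 (unif0D (unif0B (unif0D (unif0B a1 b2) x1) y2) c1) => k i w.
  by rewrite /delta; ring.
have c2 := unif0D (unif0B (cub (inl j) (inr l)) (cub' (inr j) (inr l)))
                  (unif0D (cub (inr j) (inl l)) (cub' (inl j) (inl l))).
apply: eq_unif0 (unif0D (unif0D (unif0D (unif0D a2 b1) x2) y1) c2) => k i w.
by rewrite /delta; ring.
Qed.

Definition Qre k r w : R := \sum_j (W (inl j) k r w ^+ 2 - W (inr j) k r w ^+ 2).
Definition Qim k r w : R := \sum_j (2 * (W (inl j) k r w * W (inr j) k r w)).

(** $Q^{m+1} = \sum_j Z^j (Z^j Q^m)$, so multiplication by single coordinates and sums suffice. *)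
Lemma conformal_cpow m : conformal (fun k r w => (cpow (Qre k r w, Qim k r w) m).1)
                                   (fun k r w => (cpow (Qre k r w, Qim k r w) m).2).
Proof.
elim: m => [|m IH]; first exact: conformal_cst.
have := conformal_sum (enum 'I_n) (fun j => conformalM j (conformalM j IH)).
congr conformal; apply/funext => k; apply/funext => r; apply/funext => w.
  rewrite big_enum /= -/(cpow _ _) /Qre /Qim !mulr_suml -sumrB.
  by apply: eq_bigr => j _; ring.
rewrite big_enum /= -/(cpow _ _) /Qre /Qim !mulr_suml -big_split.
by apply: eq_bigr => j _ /=; ring.
Qed.

(** Testing against the constant 1 telescopes the sum; [Q] starts at zero, hence so does each
    positive power. *)
Lemma Ex_cpow_cvg0 m : (0 < m)%N ->
  (fun k => Ex P (fun w => (cpow (Qre k (2 ^ phi k)%N w, Qim k (2 ^ phi k)%N w) m).1)) @ \oo --> (0 : R).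
Proof.
case: m => // m _.
have [_ /(_ _ (slow_cst 1)) h _ _] := conformal_cpow m.+1.
move: h; apply: cvg_trans; apply: near_eq_cvg; apply: nearW => k; rewrite /Esum; congr Ex.
apply/funext => w; under eq_bigr do rewrite mul1r.
rewrite -(big_mkord xpredT (fun i => delta _ k i w)) telescope_sumr//.
suff -> : (cpow (Qre k 0 w, Qim k 0 w) m.+1).1 = 0 by rewrite subr0.
rewrite /Qre /Qim !big1 ?/W; first by rewrite /cpow /cmul /= !mul0r subrr.
  by move=> j _; rewrite /W /stopped !big_ord0 ?expr0n ?mulr0 ?subrr.
by move=> j _; rewrite /W /stopped !big_ord0 ?expr0n ?mulr0 ?subrr.
Qed.

End ConformalCalculus.

(** * The moment inequality *)

(** The tangent line of a convex power, which stands in for Jensen's inequality in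
    [stopped_moment]. *)
Lemma expr_tangent (R : realType) q (s r : R) : 0 <= s -> 0 <= r ->
  r ^+ q.+1 + q.+1%:R * r ^+ q * (s - r) <= s ^+ q.+1.
Proof.
move=> s0 r0; elim: q => [|q IH]; first by rewrite !expr1 expr0; lra.
rewrite [leRHS]exprS; apply: le_trans (ler_wpM2l s0 IH).
rewrite -subr_ge0 (_ : _ - _ = q.+1%:R * r ^+ q * (s - r) ^+ 2).
  by rewrite mulr_ge0 ?sqr_ge0// mulr_ge0 ?exprn_ge0.
by rewrite !exprS -!natr1; ring.
Qed.

(** Lagrange's identity. The factor 2 matches the bound $|\mathrm{Im}\,Q| \le 2|X||Y|$ required by
    [even_power_inequality]. *)
Lemma cauchy_schwarz_sum (R : realType) (I : finType) (x y : I -> R) :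
  `|\sum_i 2 * (x i * y i)| <=
  2 * (Num.sqrt (\sum_i x i ^+ 2) * Num.sqrt (\sum_i y i ^+ 2)).
Proof.
rewrite -mulr_sumr normrM (@ger0_norm _ 2)// ler_wpM2l//.
have x0 : 0 <= \sum_i x i ^+ 2 by apply: sumr_ge0 => i _; exact: sqr_ge0.
have y0 : 0 <= \sum_i y i ^+ 2 by apply: sumr_ge0 => i _; exact: sqr_ge0.
rewrite -sqrtrM// -sqrtr_sqr ler_sqrt ?mulr_ge0//.
rewrite -subr_ge0; have : 0 <= \sum_i \sum_j (x i * y j - x j * y i) ^+ 2.
  by apply: sumr_ge0 => i _; apply: sumr_ge0 => j _; exact: sqr_ge0.
suff -> : \sum_i \sum_j (x i * y j - x j * y i) ^+ 2 =
   2 * ((\sum_i x i ^+ 2) * (\sum_i y i ^+ 2) - (\sum_i x i * y i) ^+ 2) by lra.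
have e1 : (\sum_i x i ^+ 2) * (\sum_i y i ^+ 2) = \sum_i \sum_j x i ^+ 2 * y j ^+ 2.
  by rewrite mulr_suml; apply: eq_bigr => i _; rewrite mulr_sumr.
have e2 : (\sum_i x i ^+ 2) * (\sum_i y i ^+ 2) = \sum_i \sum_j x j ^+ 2 * y i ^+ 2.
  by rewrite e1 exchange_big.
have e3 : (\sum_i x i * y i) ^+ 2 = \sum_i \sum_j x i * y i * (x j * y j).
  by rewrite expr2 mulr_suml; apply: eq_bigr => i _; rewrite mulr_sumr.
rewrite mulrBr mulr2n mulrDl mul1r {1}e1 e2 e3 mulr_sumr -big_split -sumrB /=.
apply: eq_bigr => i _; rewrite mulr_sumr -big_split -sumrB /=.
by apply: eq_bigr => j _; ring.
Qed.

Section Moments.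
Context {d : measure_display} {T : measurableType d} {R : realType}.
Variable P : probability T R.
Variables (I : finType) (Z : nat -> nat -> I -> T -> R) (ZT : I -> T -> R).
Variable G : nat -> nat -> set (set T).
Hypothesis dmZ : dyadic_martingale P Z ZT G.
Variables (N : nat) (K : R).
Hypothesis K0 : 0 <= K.

Let m := (2 ^ N)%N.
Let al := alive (Z N) K never.
Let W r a w := stopped (Z N) K never r a w.

Let never_ad i : measurable_wrt (G N i) (never i : T -> bool).
Proof. by apply: measurable_wrt_cst; exact: (dm_sigma dmZ). Qed.

Let W_dead i a w : (i <= m)%N -> ~~ al i w -> W m a w = W i a w.
Proof.
move=> im di; apply: (@sum_sincr_dead _ _ _ _ (Z N) K never (fun i w => sincr (Z N) K never i a w)) => //.
by move=> k hk; rewrite /sincr hk mul0r.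
Qed.

Let W_ad r a : measurable_wrt (G N r) (W r a).
Proof.
apply: stopped_ad => //; [exact: (dm_sigma dmZ)|exact: (dm_mono dmZ)|exact: (dm_adapted dmZ)].
Qed.

Let W_bound r a w : `|W r a w| <= K + 1.
Proof. by apply: stopped_bound => //; exact: (dm_start dmZ). Qed.

Lemma tame_stopped a w : tame Z N K w -> W m a w = ZT a w.
Proof.
move=> tw; rewrite -(dm_end dmZ N a); apply: alive_stopped => //; first exact: (dm_start dmZ).
suff h i : (i <= m)%N -> alive (Z N) K never i w by exact: h.
elim: i => [|i IH] im //=.
have [h1 h2 _] := tw i.+1 im; have [_ _ h3] := tw i (ltnW im).
by rewrite h1 h2 h3// IH// ltnW.
Qed.

(** The terminal and stopped values differ by the increments after death and the overshoots. After
    death [g] is frozen at a value already known, so those increments have mean zero against it; the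
    overshoots cost [drift_error]. *)
Lemma stopped_gradient a (g : nat -> T -> R) (D : R) : 
  (forall i, measurable_wrt (G N i) (g i)) -> (forall i w, `|g i w| <= D) ->
  (forall i w, (i <= m)%N -> ~~ al i w -> g m w = g i w) ->
  `|Ex P (fun w => g m w * (ZT a w - W m a w))| <= D * drift_error P m (Z N) K never a.
Proof.
move=> mg hg dg.
have sG := dm_sigma dmZ N; have GM := dm_measurable dmZ (N := N).
have ma i : measurable_wrt (G N i) (al i).
  by apply: alive_ad => //; [exact: (dm_mono dmZ)|exact: (dm_adapted dmZ)].
have mo i : measurable_wrt (G N i.+1) (overshoot (Z N) K never i).
  by apply: overshoot_ad => //; [exact: (dm_mono dmZ)|exact: (dm_adapted dmZ)].
have Zi := dm_intble dmZ N.
have nb (b : bool) : `|b%:R : R| <= 1 by case: b; rewrite ?normr1 ?normr0.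
pose u i w := (~~ al i w)%:R * g i w.
pose v i w := (overshoot (Z N) K never i w)%:R * g m w.
have mu i : measurable_wrt (G N i) (u i).
  by apply: measurable_wrtM => //; apply: measurable_wrt_indicator => //; exact: measurable_wrt_neg.
have mv i : measurable_fun setT (v i).
  apply: measurable_funM; last exact: measurable_wrt_measurable (GM m) (mg m).
  by apply: (measurable_wrt_measurable (GM i.+1)); exact: measurable_wrt_indicator.
have ub i w : `|u i w| <= D by rewrite normrM (le_trans _ (hg i w))// ler_piMl.
have vb i w : `|v i w| <= D by rewrite normrM (le_trans _ (hg m w))// ler_piMl.
have iu i : intble P (fun w => u i w * incr (Z N) i a w).
  exact: (intbleM (measurable_wrt_measurable (GM i) (mu i)) (ub i) (intble_incr Zi _ _)).
have iv i : intble P (fun w => v i w * incr (Z N) i a w).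
  exact: (intbleM (mv i) (vb i) (intble_incr Zi _ _)).
have -> : (fun w => g m w * (ZT a w - W m a w)) =
   fun w => \sum_(i < m) (u i w * incr (Z N) i a w + v i w * incr (Z N) i a w).
  apply/funext => w.
  have -> : ZT a w = \sum_(i < m) incr (Z N) i a w.
    rewrite -(dm_end dmZ N a) -[LHS]subr0 -[X in _ - X](dm_start dmZ N a w).
    by rewrite -(telescope_sumr (fun i => Z N i a w) (leq0n m)) big_mkord.
  rewrite /W /stopped -sumrB mulr_sumr; apply: eq_bigr => i _.
  rewrite /u /v /sincr /active /overshoot /al; case: (boolP (alive _ _ _ _ _)) => /= ai.
    by case: (_ <= _) => /=; ring.
  by rewrite (dg i w (ltnW (ltn_ord i)) ai); ring.
rewrite Ex_sum; last by move=> i; exact: intbleD.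
under eq_bigr => i _.
  rewrite ExD// [X in X + _](@Ex_martingale _ _ _ P _ (Z N) (G N) sG (@GM) Zi
    (dm_martingale dmZ (N := N)) i i.+1 a (u i) D) ?leqnSn//.
  rewrite add0r; over.
rewrite -Ex_sum//.
apply: le_trans (le_norm_Ex (intble_sum _ (fun i : 'I_m => iv i))) _.
have io i : intble P (fun w => (overshoot (Z N) K never i w)%:R * `|incr (Z N) i a w|).
  apply: (@intbleM _ _ _ P _ _ 1) => //; last exact/intble_norm/intble_incr.
  by apply: (measurable_wrt_measurable (GM i.+1)); exact: measurable_wrt_indicator.
rewrite /drift_error -ExZ; last exact: intble_sum.
apply: le_Ex.
- by apply: intble_norm; exact: intble_sum.
- by apply: intbleZ; exact: intble_sum.
move=> w; apply: le_trans (ler_norm_sum _ _ _) _; rewrite mulr_sumr; apply: ler_sum => i _.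
by rewrite /v !normrM normr_nat [leRHS]mulrCA -mulrA ler_wpM2l// ler_wpM2r.
Qed.

(** An approximate optional stopping inequality for a convex function. Tangent inequalities for the
    power and for the squares leave a linear term with gradient [g j], whose mean [stopped_gradient]
    bounds. *)
Lemma stopped_moment (J : finType) (f : J -> I) q :
  intble P (fun w => (\sum_j ZT (f j) w ^+ 2) ^+ q.+1) ->
  Ex P (fun w => (\sum_j W m (f j) w ^+ 2) ^+ q.+1) <=
  Ex P (fun w => (\sum_j ZT (f j) w ^+ 2) ^+ q.+1) +
  2 * q.+1%:R * (#|J|%:R * (K + 1) ^+ 2) ^+ q * (K + 1) * \sum_j drift_error P m (Z N) K never (f j).
Proof.
move=> iS.
have sG := dm_sigma dmZ N; have GM := dm_measurable dmZ (N := N).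
pose s r w := \sum_j W r (f j) w ^+ 2.
have s0 r w : 0 <= s r w by apply: sumr_ge0 => j _; exact: sqr_ge0.
have sb r w : s r w <= #|J|%:R * (K + 1) ^+ 2.
  rewrite mulr_natl -sumr_const; apply: ler_sum => j _.
  by rewrite -[leLHS]real_normK ?num_real// lerXn2r ?nnegrE ?addr_ge0.
have C0 : 0 <= #|J|%:R * (K + 1) ^+ 2 :> R by rewrite mulr_ge0// sqr_ge0.
have ms r : measurable_wrt (G N r) (s r).
  by apply: measurable_wrt_sum => // j; apply: measurable_wrtX.
pose g j r w := 2 * q.+1%:R * s r w ^+ q * W r (f j) w.
set D := 2 * q.+1%:R * (#|J|%:R * (K + 1) ^+ 2) ^+ q * (K + 1).
have gb j r w : `|g j r w| <= D.
  rewrite /g /D !normrM !normr_nat normrX (ger0_norm (s0 _ _)).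
  by rewrite ler_pM ?mulr_ge0 ?exprn_ge0// ler_wpM2l ?mulr_ge0// lerXn2r ?nnegrE.
have mg j r : measurable_wrt (G N r) (g j r).
  apply: measurable_wrtM => //; apply: measurable_wrtM => //; first exact: measurable_wrt_cst.
  exact: measurable_wrtX.
have gd j i w : (i <= m)%N -> ~~ al i w -> g j m w = g j i w.
  move=> im di; rewrite /g /s (W_dead (f j) im di); congr (_ * _ ^+ _ * _).
  by apply: eq_bigr => l _; rewrite (W_dead (f l) im di).
have ig j : intble P (fun w => g j m w * (ZT (f j) w - W m (f j) w)).
  apply: (intbleM (measurable_wrt_measurable (GM m) (mg j m)) (gb j m)).
  apply: intbleB; first by rewrite -(dm_end dmZ N); exact: (dm_intble dmZ).
  apply: (@intble_bounded _ _ _ P _ (K + 1)); last exact: W_bound.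
  exact: (measurable_wrt_measurable (GM m) (W_ad m (f j))).
have isW : intble P (fun w => s m w ^+ q.+1).
  apply: (@intble_bounded _ _ _ P _ ((#|J|%:R * (K + 1) ^+ 2) ^+ q.+1)).
    by apply: (measurable_wrt_measurable (GM m)); exact: measurable_wrtX.
  by move=> w; rewrite normrX (ger0_norm (s0 _ _)) lerXn2r ?nnegrE.
have key : Ex P (fun w => s m w ^+ q.+1) + Ex P (fun w => \sum_j g j m w * (ZT (f j) w - W m (f j) w))
    <= Ex P (fun w => (\sum_j ZT (f j) w ^+ 2) ^+ q.+1).
  rewrite -ExD//; last exact: intble_sum.
  apply: le_Ex => //; first by apply: intbleD => //; exact: intble_sum.
  move=> w; set S := \sum_j ZT _ _ ^+ 2.
  have S0 : 0 <= S by apply: sumr_ge0 => j _; exact: sqr_ge0.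
  apply: le_trans (expr_tangent q S0 (s0 m w)); rewrite lerD2l.
  rewrite -sumrB mulr_sumr; apply: ler_sum => j _.
  rewrite /g (_ : 2 * _ * _ * _ * _ =
    q.+1%:R * s m w ^+ q * (2 * (W m (f j) w * (ZT (f j) w - W m (f j) w)))); last ring.
  rewrite ler_wpM2l ?mulr_ge0 ?exprn_ge0//.
  by have := sqr_ge0 (ZT (f j) w - W m (f j) w); lra.
have err : - (D * \sum_j drift_error P m (Z N) K never (f j)) <=
    Ex P (fun w => \sum_j g j m w * (ZT (f j) w - W m (f j) w)).
  rewrite Ex_sum// mulr_sumr -sumrN; apply: ler_sum => j _.
  have := @stopped_gradient (f j) (g j) D (mg j) (gb j) (gd j).
  by rewrite ler_norml => /andP[].
move: key err; set x := Ex _ _; set y := Ex _ _; lra.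
Qed.

End Moments.

Section MomentInequality.
Context {d : measure_display} {T : measurableType d} {R : realType}.
Variable P : probability T R.
Variables (n : nat) (Z : nat -> nat -> 'I_n + 'I_n -> T -> R) (ZT : 'I_n + 'I_n -> T -> R).
Variable G : nat -> nat -> set (set T).
Hypothesis dmZ : dyadic_martingale P Z ZT G.

Let re N (jl : 'I_n * 'I_n) r w :=
  cov Z N (inl jl.1) (inl jl.2) r w + -1 * cov Z N (inr jl.1) (inr jl.2) r w.
Let im N (jl : 'I_n * 'I_n) r w :=
  cov Z N (inl jl.1) (inr jl.2) r w + 1 * cov Z N (inr jl.1) (inl jl.2) r w.

Hypothesis small_re : forall jl (lam eta : R), 0 < lam -> 0 < eta -> exists N0, forall N, (N0 <= N)%N ->
    Psmall P eta [set w | exists r, (r <= 2 ^ N)%N /\ lam < `|re N jl r w|].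
Hypothesis small_im : forall jl (lam eta : R), 0 < lam -> 0 < eta -> exists N0, forall N, (N0 <= N)%N ->
    Psmall P eta [set w | exists r, (r <= 2 ^ N)%N /\ lam < `|im N jl r w|].

(** The pairs of coordinates are finitely many, so one subsequence and one null set serve them all;
    the tolerance at stage [k] is [2 ^- k]. *)
Lemma brackets_subsequence : exists phi : nat -> nat, (forall k, (k <= phi k)%N) /\
  exists2 Nul, P.-negligible Nul & forall w, ~ Nul w -> forall e : R, 0 < e ->
    exists k0, forall k jl r, (k0 <= k)%N -> (r <= 2 ^ phi k)%N ->
      `|re (phi k) jl r w| <= e /\ `|im (phi k) jl r w| <= e.
Proof.
pose A k N := [set w | exists jl, (exists r, (r <= 2 ^ N)%N /\ 2 ^- k < `|re N jl r w|) \/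
   (exists r, (r <= 2 ^ N)%N /\ 2 ^- k < `|im N jl r w|)].
have [k eta eta0|phi [phik [Nul Nul0 h]]] := @Psmall_subsequence _ _ _ P A.
  apply: (Psmall_exists (A := fun jl N => [set w | (exists r, (r <= 2 ^ N)%N /\ 2 ^- k < `|re N jl r w|) \/
   (exists r, (r <= 2 ^ N)%N /\ 2 ^- k < `|im N jl r w|)]) _ eta0) => jl e e0.
  have e2 : 0 < e / 2 by rewrite divr_gt0.
  have l0 : 0 < 2 ^- k :> R by rewrite invr_gt0 exprn_gt0.
  have [N1 h1] := small_re jl l0 e2; have [N2 h2] := small_im jl l0 e2.
  exists (maxn N1 N2) => N; rewrite geq_max => /andP[n1 n2].
  apply: (@Psmall_le _ _ _ _ (e / 2 + e / 2)); first by lra.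
  by apply: Psmall_sub (PsmallU (h1 N n1) (h2 N n2)) => w [hw|hw]; [left|right].
exists phi; split => //; exists Nul => // w /h [k0 hk] e e0.
have [k1 hk1] := pow2_gt e^-1.
exists (maxn k0 k1) => k jl r; rewrite geq_max => /andP[kk0 kk1] rN.
have he : 2 ^- k <= e.
  rewrite -[leRHS]invrK lef_pV2 ?posrE ?exprn_gt0 ?invr_gt0//.
  by apply: le_trans (ltW hk1) _; rewrite ler_eXn2l// ltr1n.
split; apply: le_trans he; rewrite leNgt; apply/negP => hh; apply: (hk k kk0); exists jl.
  by left; exists r.
by right; exists r.
Qed.

(** A step not taken is never followed by one that is taken, so a stopped sum is a full sum up to an
    index depending on the path. Bracket estimates uniform in time therefore pass to the stopped
    process. *)
Lemma active_prefix (Zn : nat -> 'I_n + 'I_n -> T -> R) (K : R) w r : exists2 r', (r' <= r)%N &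
  forall f : nat -> R, \sum_(i < r) (active Zn K never i w)%:R * f i = \sum_(i < r') f i.
Proof.
elim: r => [|r [r' r'r h]]; first by exists 0%N => // f; rewrite !big_ord0.
case: (boolP (active Zn K never r w)) => ar; last first.
  by exists r'; [exact: leqW|move=> f; rewrite big_ord_recr /= (negbTE ar) mul0r addr0].
exists r.+1 => // f; apply: eq_bigr => i _.
move: (ltn_ord i); rewrite ltnS leq_eqVlt => /orP[/eqP ->|ir]; first by rewrite ar mul1r.
by case/andP: ar => al _; rewrite (alive_active ir al) mul1r.
Qed.

(** Truncation at [L] lets the stopped paths contribute at most [L] times their probability, without
    any integrability of the power of the imaginary part. *)
Lemma moment_inequality k (L : R) : 0 <= L ->
  intble P (fun w => (\sum_j ZT (inl j) w ^+ 2) ^+ (2 ^ k)) ->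
  Ex P (fun w => Num.min ((\sum_j ZT (inr j) w ^+ 2) ^+ (2 ^ k)) L) <=
  bestc R k ^+ (2 ^ k.+1) * Ex P (fun w => (\sum_j ZT (inl j) w ^+ 2) ^+ (2 ^ k)).
Proof.
move=> L0 iX.
have [phi [phik [Nul Nul0 hNul]]] := brackets_subsequence.
have [B hB] := even_power_inequality R k.
set c := bestc R k ^+ _ in hB *.
have c0 : 0 <= c by rewrite exprn_ge0// ltW// bestc_gt0.
set SX := fun w => (\sum_j ZT (inl j) w ^+ 2) ^+ (2 ^ k).
set SY := fun w => Num.min _ L.
apply/ler_addgt0Pr => e e0.
(* The three shares of [e] pay for the stopped paths, the expectation of [H] and the drift in the
   moment of the real part. *)
have e3 : 0 < e / 3 by rewrite divr_gt0.
have eL : 0 < e / 3 / (L + 1) by rewrite divr_gt0// ltr_wpDl.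
have [K K0 [N1 hK]] := tame_small dmZ eL.
pose W a k' r w := stopped (Z (phi k')) K never r a w.
have unif (a b a' b' : 'I_n + 'I_n) (s : R) :
   (forall w, ~ Nul w -> forall e : R, 0 < e -> exists k0, forall k r, (k0 <= k)%N -> (r <= 2 ^ phi k)%N ->
     `|cov Z (phi k) a b r w + s * cov Z (phi k) a' b' r w| <= e) ->
   unif0 phi Nul (fun k i w => delta (W a) k i w * delta (W b) k i w
     + s * (delta (W a') k i w * delta (W b') k i w)).
  move=> h w hw e' e'0; have [k0 hk] := h w hw e' e'0.
  exists k0 => k' r kk rN; have [r' r'r hr] := active_prefix (Z (phi k')) K w r.
  apply: le_trans (hk k' r' kk (leq_trans r'r rN)).
  rewrite le_eqVlt; apply/orP; left; apply/eqP; congr (`| _ |).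
  rewrite /cov mulr_sumr -big_split /=.
  rewrite -(hr (fun i => incr (Z (phi k')) i a w * incr (Z (phi k')) i b w
    + s * (incr (Z (phi k')) i a' w * incr (Z (phi k')) i b' w))); apply: eq_bigr => i _.
  rewrite !delta_W /sincr; case: active; rewrite ?mul1r ?mul0r//.
  by rewrite !mulr0 addr0.
have bre j l : unif0 phi Nul (fun k i w => delta (W (inl j)) k i w * delta (W (inl l)) k i w
                    - delta (W (inr j)) k i w * delta (W (inr l)) k i w).
  apply: eq_unif0 (unif (inl j) (inl l) (inr j) (inr l) (-1) _) => [k' i w|w hw e' e'0]; first by ring.
  have [k0 hk] := hNul w hw e' e'0; exists k0 => k' r kk rN.
  by have [] := hk k' (j, l) r kk rN.
have bim j l : unif0 phi Nul (fun k i w => delta (W (inl j)) k i w * delta (W (inr l)) k i w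
                    + delta (W (inr j)) k i w * delta (W (inl l)) k i w).
  apply: eq_unif0 (unif (inl j) (inr l) (inr j) (inl l) 1 _) => [k' i w|w hw e' e'0]; first by ring.
  have [k0 hk] := hNul w hw e' e'0; exists k0 => k' r kk rN.
  by have [] := hk k' (j, l) r kk rN.
have := Ex_cpow_cvg0 dmZ phik Nul0 K0 bre bim (expn_gt0 2 k).
have B0 : 0 < e / 3 / (`|B| + 1) by rewrite divr_gt0// ltr_wpDl.
move=> /cvgr0Pnorm_lt /(_ _ B0) [k1 _ hk1].
(* [stopped_moment] takes a successor as exponent; [D] is its error constant. *)
pose q := (2 ^ k).-1; have qE : q.+1 = (2 ^ k)%N by rewrite prednK// expn_gt0.
pose D := 2 * q.+1%:R * (#|'I_n|%:R * (K + 1) ^+ 2) ^+ q * (K + 1).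
have D0 : 0 <= D by rewrite /D !mulr_ge0 ?addr_ge0// exprn_ge0// mulr_ge0// sqr_ge0.
pose den := c * D * n%:R + 1.
have den0 : 0 < den by rewrite /den ltr_wpDl// mulr_ge0// mulr_ge0.
have ed : 0 < e / 3 / den by rewrite divr_gt0.
have [f hf] := choice (fun j : 'I_n => drift_error_small dmZ (inl j) K0 ed).
pose k2 := maxn (maxn k1 N1) (\max_j f j).
pose N := phi k2.
have kN : (k2 <= N)%N by exact: phik.
have k1k2 : (k1 <= k2)%N by rewrite /k2 -maxnA leq_maxl.
have N1N : (N1 <= N)%N by apply: leq_trans kN; rewrite /k2 maxnAC leq_maxr.
have fN j : (f j <= N)%N.
  by apply: leq_trans kN; rewrite /k2; apply: leq_trans (leq_maxr _ _); exact: leq_bigmax.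
have never_ad i : measurable_wrt (G N i) (never i : T -> bool).
  by apply: measurable_wrt_cst; exact: (dm_sigma dmZ).
have drift j : drift_error P (2 ^ N) (Z N) K never (inl j) <= e / 3 / den by exact: hf.
pose V (s : 'I_n -> 'I_n + 'I_n) w := \sum_j W (s j) k2 (2 ^ N)%N w ^+ 2.
have V0 (s : 'I_n -> 'I_n + 'I_n) w : 0 <= V s w by apply: sumr_ge0 => j _; exact: sqr_ge0.
have mW a : measurable_fun setT (W a k2 (2 ^ N)%N).
  apply: (measurable_wrt_measurable (dm_measurable dmZ (N := N) (i := (2 ^ N)%N))); apply: stopped_ad => //;
   [exact: (dm_sigma dmZ)|exact: (dm_mono dmZ)|exact: (dm_adapted dmZ)].
have Wb a w : `|W a k2 (2 ^ N)%N w| <= K + 1.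
  by apply: stopped_bound => //; exact: (dm_start dmZ).
have mV s : measurable_fun setT (V s).
  by apply: measurable_sum => j; exact: measurable_funX.
have Vb s w : V s w <= #|'I_n|%:R * (K + 1) ^+ 2.
  rewrite mulr_natl -sumr_const; apply: ler_sum => j _.
  by rewrite -[leLHS]real_normK ?num_real// lerXn2r ?nnegrE ?addr_ge0.
have iV s : intble P (fun w => V s w ^+ (2 ^ k)).
  apply: (@intble_bounded _ _ _ P _ ((#|'I_n|%:R * (K + 1) ^+ 2) ^+ (2 ^ k))).
    exact: measurable_funX.
  have C0 : 0 <= #|'I_n|%:R * (K + 1) ^+ 2 by rewrite mulr_ge0// sqr_ge0.
  by move=> w; rewrite normrX (ger0_norm (V0 _ _)) lerXn2r ?nnegrE.
pose H w := (cpow (Qre Z phi K k2 (2 ^ N)%N w, Qim Z phi K k2 (2 ^ N)%N w) (2 ^ k)).1.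
have pw w : V inr w ^+ (2 ^ k) <= c * V inl w ^+ (2 ^ k) + B * H w.
  have := hB (Num.sqrt (V inl w)) (Num.sqrt (V inr w))
     (Qre Z phi K k2 (2 ^ N)%N w) (Qim Z phi K k2 (2 ^ N)%N w)
     (sqrtr_ge0 _) (sqrtr_ge0 _).
  rewrite !sqr_sqrtr// ![in X in _ -> _ -> X]expnS !(exprM _ 2) !sqr_sqrtr//; apply.
    by rewrite /Qre /V sumrB.
  exact: cauchy_schwarz_sum.
have mH : measurable_fun setT H.
  have [[sH _] _ _ _] := conformal_cpow dmZ phik Nul0 K0 bre bim (2 ^ k).
  exact: (slow_measurable dmZ k2 (2 ^ N)%N sH).
have iH : intble P H.
  have [[sH _] _ _ _] := conformal_cpow dmZ phik Nul0 K0 bre bim (2 ^ k).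
  have [C _ hC] := slow_bound sH.
  by apply: (@intble_bounded _ _ _ P H C mH) => w; exact: hC.
have EV : Ex P (fun w => V inr w ^+ (2 ^ k)) <= c * Ex P (fun w => V inl w ^+ (2 ^ k)) + B * Ex P H.
  rewrite -!ExZ// -ExD; [|exact: intbleZ..].
  by apply: le_Ex => //; apply: intbleD; exact: intbleZ.
have EX : Ex P (fun w => V inl w ^+ (2 ^ k)) <= Ex P SX + D * (n%:R * (e / 3 / den)).
  have := @stopped_moment _ _ _ P _ Z ZT G dmZ N K K0 'I_n inl q; rewrite qE => /(_ iX) h.
  apply: le_trans h _; rewrite lerD2l -qE ler_wpM2l//.
  rewrite -[X in X%:R](card_ord n) mulr_natl -sumr_const.
  by apply: ler_sum => j _; exact: drift.
have [E mE [tE PE]] := Psmall_Ex (hK N N1N).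
have ZTm a : measurable_fun setT (ZT a).
  by rewrite -(dm_end dmZ 0); apply: intble_measurable; exact: (dm_intble dmZ).
have iSY : intble P SY.
  apply: (@intble_bounded _ _ _ P _ L).
    apply: measurable_minr => //; apply: measurable_funX; apply: measurable_sum => j.
    exact: measurable_funX.
  move=> w; rewrite ger0_norm ?ge_min ?lexx ?orbT//.
  by rewrite le_min L0 exprn_ge0// sumr_ge0// => j _; exact: sqr_ge0.
(* Off [E] the path is tame and the stopped value is the terminal one; on [E] the truncated variable
   is at most [L]. *)
have ES : Ex P SY <= Ex P (fun w => V inr w ^+ (2 ^ k)) + L * (e / 3 / (L + 1)).
  apply: (@le_trans _ _ (Ex P (fun w => V inr w ^+ (2 ^ k) + L * \1_E w))).
    apply: le_Ex => //; first by apply: intbleD => //; apply: intbleZ; exact: intble_indicator.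
    move=> w; case: (boolP (w \in E)) => wE.
      rewrite indicE wE mulr1 ge_min; apply/orP; right.
      by rewrite lerDr exprn_ge0.
    rewrite indicE (negbTE wE) mulr0 addr0 ge_min; apply/orP; left.
    have tw : tame Z N K w.
      by apply: contrapT => nt; move/negP: wE; apply; rewrite inE; exact: tE.
    rewrite le_eqVlt; apply/orP; left; apply/eqP; congr (_ ^+ _); apply: eq_bigr => j _.
    by rewrite /W (tame_stopped dmZ _ tw).
  rewrite ExD//; last by apply: intbleZ; exact: intble_indicator.
  by rewrite lerD2l ExZ ?ler_wpM2l//; exact: intble_indicator.
have b1 : L * (e / 3 / (L + 1)) <= e / 3.
  by rewrite mulrA ler_pdivrMr ?ltr_wpDl// mulrC ler_wpM2l ?(ltW e3)// lerDl.
have b2 : B * Ex P H <= e / 3.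
  apply: le_trans (ler_norm _) _; rewrite normrM.
  apply: (@le_trans _ _ (`|B| * (e / 3 / (`|B| + 1)))).
    by rewrite ler_wpM2l// ltW//; exact: hk1.
  by rewrite mulrA ler_pdivrMr ?ltr_wpDl// mulrC ler_wpM2l ?(ltW e3)// lerDl.
have b3 : c * (D * (n%:R * (e / 3 / den))) <= e / 3.
  rewrite (_ : c * _ = (c * D * n%:R) * (e / 3) / den); last by rewrite !mulrA.
  by rewrite ler_pdivrMr// mulrC ler_wpM2l ?(ltW e3)// /den lerDl.
have := ler_wpM2l c0 EX; rewrite mulrDr => h.
move: ES EV h b1 b2 b3.
set x1 := Ex P SY; set x2 := Ex P (fun w => V inr w ^+ _); set x3 := Ex P (fun w => V inl w ^+ _).
set x4 := L * _; set x5 := B * _; set x6 := c * (D * _); lra.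
Qed.

End MomentInequality.

(** * Truncation and convergence in probability *)

Section Truncation.
Context {d : measure_display} {T : measurableType d} {R : realType}.
Variable P : probability T R.

Lemma integral_le_truncations (f : T -> R) (M : R) :
  measurable_fun setT f -> (forall w, 0 <= f w) ->
  (forall L, 0 <= L -> Ex P (fun w => Num.min (f w) L) <= M) ->
  (\int[P]_w (f w)%:E <= M%:E)%E.
Proof.
move=> mf f0 h.
pose g (n : nat) w := (Num.min (f w) n%:R)%:E.
have mg n : measurable_fun setT (fun w => Num.min (f w) n%:R) by exact: measurable_minr.
have g0 n w : 0 <= Num.min (f w) n%:R by rewrite le_min f0 ler0n.
have ig n : intble P (fun w => Num.min (f w) n%:R).
  apply: (@intble_bounded _ _ _ P _ n%:R) => // w.
  by rewrite ger0_norm// ge_min lexx orbT.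
have mono w : {homo g^~ w : a b / (a <= b)%N >-> (a <= b)%E}.
  move=> a b ab; rewrite /g lee_fin le_min ge_min lexx /= ge_min; apply/orP; right.
  by rewrite ler_nat.
have -> : (\int[P]_w (f w)%:E = \int[P]_w limn (g^~ w))%E.
  apply: eq_integral => w _; apply/esym/cvg_lim => //.
  apply: cvg_near_cst; exists (Num.truncn (f w)).+1 => // n /= hn.
  rewrite /g; congr EFin; apply/min_idPl.
  by apply: le_trans (ltW (truncnS_gt _)) _; rewrite ler_nat.
rewrite monotone_convergence//; last 2 first.
- by move=> n; apply/measurable_EFinP.
- by move=> n w _; rewrite lee_fin.
apply: lime_le.
  apply: ereal_nondecreasing_is_cvgn => a b ab; apply: ge0_le_integral => //.
  - by move=> w _; rewrite lee_fin.
  - exact/measurable_EFinP.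
  - exact/measurable_EFinP.
  - by move=> w _; exact: mono.
apply: nearW => n.
rewrite -[X in (X <= _)%E]fineK; last exact: integrable_fin_num (ig n).
by rewrite lee_fin; exact: h.
Qed.

Lemma cvg_in_prob_small (S : nat -> T -> R) (L : T -> R) (eps eta : R) :
  (forall m, measurable_fun setT (S m)) -> cvg_in_prob P S L -> 0 < eps -> 0 < eta ->
  exists m0, forall m, (m0 <= m)%N -> Psmall P eta [set w | eps < `|S m w - L w|].
Proof.
move=> mS [mL h] eps0 eta0; have /fine_cvg := h _ eps0.
move=> /cvgr0Pnorm_lt /(_ _ eta0) [m0 _ hm]; exists m0 => m mm.
have mA : measurable [set w | eps < `|S m w - L w|].
  rewrite -[X in measurable X]setTI; apply: measurable_fun_ltr => //.
  by apply: measurableT_comp => //; exact: measurable_funB.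
apply: Psmall_measurable => //; rewrite Ex_indicator//.
exact: le_trans (ler_norm _) (ltW (hm m mm)).
Qed.

(** The limit is a finite random variable, hence itself tight, and the sums stay within 1 of it with
    high probability. *)
Lemma cvg_in_prob_tight (S : nat -> T -> R) (L : T -> R) (eta : R) :
  (forall m, measurable_fun setT (S m)) -> cvg_in_prob P S L -> 0 < eta ->
  exists (K : R) m0, forall m, (m0 <= m)%N -> Psmall P eta [set w | K < S m w].
Proof.
move=> mS hS eta0; have e2 : 0 < eta / 2 by rewrite divr_gt0.
have [m0 h] := cvg_in_prob_small mS hS ltr01 e2.
have [mL _] := hS.
have [|||M hM] := @Psmall_eventually _ _ _ P (fun n => [set w | n%:R < L w]) (eta / 2) => //.
- by move=> n; rewrite -[X in measurable X]setTI; apply: measurable_fun_ltr.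
- move=> w; exists (Num.truncn (L w)).+1 => n hn; apply/negP; rewrite -leNgt.
  by apply: le_trans (ltW (truncnS_gt _)) _; rewrite ler_nat.
exists (M%:R + 1), m0 => m mm; apply: (@Psmall_le _ _ _ _ (eta / 2 + eta / 2)); first by lra.
apply: Psmall_sub (PsmallU (h m mm) (hM M (leqnn M))) => w /= hw.
apply: contrapT => hn; move: hw; apply/negP; rewrite -leNgt.
have h1 : `|S m w - L w| <= 1 by rewrite leNgt; apply/negP => hh; apply: hn; left.
have h2 : L w <= M%:R by rewrite leNgt; apply/negP => hh; apply: hn; right.
by move: h1; rewrite ler_norml => /andP[]; lra.
Qed.

Lemma cvg_in_prob_cancel (S S' : nat -> T -> R) (L L' : T -> R) (s lam eta : R) :
  (forall m, measurable_fun setT (S m)) -> (forall m, measurable_fun setT (S' m)) ->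
  cvg_in_prob P S L -> cvg_in_prob P S' L' -> `|s| <= 1 -> (forall w, L w + s * L' w = 0) ->
  0 < lam -> 0 < eta ->
  exists m0, forall m, (m0 <= m)%N -> Psmall P eta [set w | lam < `|S m w + s * S' m w|].
Proof.
move=> mS mS' hS hS' s1 LL lam0 eta0.
have e2 : 0 < eta / 2 by rewrite divr_gt0.
have l2 : 0 < lam / 2 by rewrite divr_gt0.
have [m1 h1] := cvg_in_prob_small mS hS l2 e2.
have [m2 h2] := cvg_in_prob_small mS' hS' l2 e2.
exists (maxn m1 m2) => m; rewrite geq_max => /andP[mm1 mm2].
apply: (@Psmall_le _ _ _ _ (eta / 2 + eta / 2)); first by lra.
apply: Psmall_sub (PsmallU (h1 m mm1) (h2 m mm2)) => w /= hw.
apply: contrapT => hn; move: hw; apply/negP; rewrite -leNgt.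
have k1 : `|S m w - L w| <= lam / 2 by rewrite leNgt; apply/negP => hh; apply: hn; left.
have k2 : `|S' m w - L' w| <= lam / 2 by rewrite leNgt; apply/negP => hh; apply: hn; right.
rewrite (_ : S m w + s * S' m w = (S m w - L w) + s * (S' m w - L' w) + (L w + s * L' w)); last ring.
rewrite LL addr0; apply: le_trans (ler_normD _ _) _; rewrite normrM.
have : `|s| * `|S' m w - L' w| <= `|S' m w - L' w| by rewrite ler_piMl.
by lra.
Qed.

End Truncation.

(** * Sampling continuous martingales on dyadic grids *)

Section Grid.
Context {d : measure_display} {T : measurableType d} {R : realType}.
Variables (P : probability T R) (F : R -> set (set T)) (I : finType) (V : I -> R -> T -> R) (t : R).
Hypothesis t0 : 0 < t.
Hypothesis usualF : usual_filtration P F.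
Hypothesis martV : forall a, cont_martingale0 P F (V a).

Definition grid (N i : nat) : R := t * i%:R / 2 ^+ N.
Definition grid_process N i a w := V a (grid N i) w.
Definition grid_filtration N i := F (grid N i).

Lemma grid_ge0 N i : 0 <= grid N i.
Proof. by rewrite divr_ge0 ?exprn_ge0// mulr_ge0// ltW. Qed.

Lemma grid_le N i j : (i <= j)%N -> grid N i <= grid N j.
Proof.
by move=> ij; rewrite ler_wpM2r ?invr_ge0 ?exprn_ge0// ler_wpM2l ?(ltW t0)// ler_nat.
Qed.

Lemma grid_end N : grid N (2 ^ N) = t.
Proof. by rewrite /grid natrX mulfK// expf_neq0. Qed.

Lemma grid_le_end N i : (i <= 2 ^ N)%N -> 0 <= grid N i <= t.
Proof. by move=> iN; rewrite grid_ge0 -[X in _ <= X](grid_end N) grid_le. Qed.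

Lemma measurable_martingale a s : 0 <= s -> measurable_fun setT (V a s).
Proof.
move=> s0; have [ad _ _ _ _] := martV a; have [_ FM _ _ _] := usualF.
by apply: (@measurable_wrt_measurable _ _ _ _ (F s)); [exact: FM|exact: ad].
Qed.

Lemma measurable_dyadic_cov a b s m : 0 <= s -> measurable_fun setT (dyadic_cov (V a) (V b) s m).
Proof.
move=> s0; have nn k : 0 <= s * k%:R / 2 ^+ m by rewrite divr_ge0 ?exprn_ge0// mulr_ge0.
apply: measurable_sum => k; apply: measurable_funM; apply: measurable_funB;
  exact: measurable_martingale.
Qed.

Hypothesis brV : forall a, exists L, bracket_at P (V a) (V a) t L.

Lemma grid_dyadic_martingale :
  dyadic_martingale P grid_process (fun a => V a t) grid_filtration.
Proof.
have [sF FM Fmono _ _] := usualF.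
split.
- by move=> N i; apply: sF; exact: grid_ge0.
- by move=> N i; apply: FM; exact: grid_ge0.
- by move=> N i j ij; apply: Fmono; [exact: grid_ge0|exact: grid_le].
- by move=> N i a B mB; have [ad _ _ _ _] := martV a; apply: ad => //; exact: grid_ge0.
- by move=> N i a; have [_ it _ _ _] := martV a; apply: it; exact: grid_ge0.
- move=> N i j a A ij FA; have [_ _ mt _ _] := martV a.
  by apply: mt => //; [exact: grid_ge0|exact: grid_le].
- by move=> N a w; have [_ _ _ _ z] := martV a; rewrite /grid_process /grid mulr0 mul0r z.
- by move=> N a; rewrite /grid_process grid_end.
- move=> w e e0.
  have h a : exists dl : R, 0 < dl /\ forall u v, 0 <= u <= t -> 0 <= v <= t -> `|u - v| < dl ->
      `|V a u w - V a v w| <= e.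
    have [_ _ _ c _] := martV a.
    by have [dl dl0 hd] := path_uniformly_continuous t (c w) e0; exists dl.
  have [f hf] := choice h.
  (* [s^-1] is at most every [f a], and the summand 1 keeps [s] positive when [I] is empty. Dividing
     by [t] passes to normalised time. *)
  pose s := \sum_a (f a)^-1 + 1.
  have s0 : 0 < s by rewrite ltr_wpDl// sumr_ge0// => a _; rewrite invr_ge0 ltW//; have [] := hf a.
  exists (s^-1 / t); first by rewrite !divr_gt0// invr_gt0.
  move=> N i j a iN jN ij; have [fa0 hfa] := hf a.
  apply: hfa; [exact: grid_le_end|exact: grid_le_end|].
  apply: (@lt_le_trans _ _ s^-1).
    rewrite /grid -mulrBl -mulrBr !normrM (ger0_norm (ltW t0)) (@ger0_norm _ (2 ^+ N)^-1)
      ?invr_ge0 ?exprn_ge0//.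
    rewrite ltr_pdivrMr ?exprn_gt0// -ltr_pdivlMl//.
    by apply: lt_le_trans ij _; rewrite le_eqVlt; apply/orP; left; apply/eqP; ring.
  rewrite -[leRHS]invrK lef_pV2 ?posrE ?invr_gt0//.
  rewrite /s (bigD1 a) //= -addrA lerDl addr_ge0// sumr_ge0// => b _.
  by rewrite invr_ge0 ltW//; have [] := hf b.
- move=> w.
  have h a : exists K : R, forall u, 0 <= u <= t -> `|V a u w| <= K.
    by have [_ _ _ c _] := martV a; exact: path_bounded.
  have [f hf] := choice h.
  exists (\sum_a `|f a|) => N i a iN.
  apply: (@le_trans _ _ `|f a|).
    by apply: le_trans (ler_norm _); apply: hf; exact: grid_le_end.
  by rewrite (bigD1 a) //= lerDl sumr_ge0.
- move=> a eta eta0; have [L hL] := brV a.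
  have [K [m0 h]] := cvg_in_prob_tight (fun m => measurable_dyadic_cov a a m (ltW t0)) hL eta0.
  exists K, m0 => m mm; apply: Psmall_sub (h m mm) => w /=.
  by rewrite /dyadic_cov; congr (_ < _); apply: eq_bigr => k _; rewrite -expr2.
Qed.

(** The points [grid (M + m) (q * l)] are the level [m] dyadic points of the interval up to
    [grid M l]. Thus brackets at different times, each defined with its own partitions, are read off
    one common fine grid. *)
Lemma coarse_dyadic_cov M l m a b w :
  coarse_cov grid_process (M + m) l a b (2 ^ m) w = dyadic_cov (V a) (V b) (grid M l) m w.
Proof.
have e q : grid (M + m) (q * l) = grid M l * q%:R / 2 ^+ m.
  by rewrite /grid natrM exprD; field; rewrite !expf_neq0.
by apply: eq_bigr => q _; rewrite /grid_process !e.
Qed.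

Lemma grid_bracket_small a b a' b' (s : R) : `|s| <= 1 ->
  (forall u, 0 <= u -> exists L, exists2 L', bracket_at P (V a) (V b) u L /\
     bracket_at P (V a') (V b') u L' & forall w, L w + s * L' w = 0) ->
  forall lam eta : R, 0 < lam -> 0 < eta -> exists N0, forall N, (N0 <= N)%N ->
    Psmall P eta [set w | exists r, (r <= 2 ^ N)%N /\
      lam < `|cov grid_process N a b r w + s * cov grid_process N a' b' r w|].
Proof.
move=> s1 h; apply: (bracket_uniformly_small grid_dyadic_martingale) => // M l lam eta lM lam0 eta0.
have [L [L' [hL hL'] LL]] := h (grid M l) (grid_ge0 M l).
have [m0 hm] := cvg_in_prob_cancel (fun m => measurable_dyadic_cov a b m (grid_ge0 M l))
  (fun m => measurable_dyadic_cov a' b' m (grid_ge0 M l)) hL hL' s1 LL lam0 eta0.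
by exists m0 => m mm; apply: Psmall_sub (hm m mm) => w /=; rewrite !coarse_dyadic_cov.
Qed.

End Grid.

(** The even exponent removes the square root and leaves a polynomial in the coordinates. *)
Lemma Lnorm_l2norm {d} {T : measurableType d} {R : realType} (P : probability T R) n
    (M : 'I_n -> R -> T -> R) (t : R) k :
  Lnorm P (2 ^+ k.+1)%:E (EFin \o l2norm M t) =
  ((\int[P]_w ((\sum_j M j t w ^+ 2) ^+ (2 ^ k))%:E) `^ (2 ^+ k.+1)^-1)%E.
Proof.
rewrite unlock; congr (_ `^ _)%E; apply: eq_integral => w _ /=.
rewrite -natrX; congr EFin; rewrite powR_mulrn// ger0_norm ?sqrtr_ge0//.
by rewrite /l2norm expnS exprM sqr_sqrtr// sumr_ge0// => j _; exact: sqr_ge0.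
Qed.

Unset Implicit Arguments.

Theorem theorem4p12 (d : measure_display) (T : measurableType d) (R : realType)
  (P : probability T R) (F : R -> set (set T)) (n : nat)
  (X Y : 'I_n -> R -> T -> R) (k : nat) :
  (0 < k)%N ->
  usual_filtration P F ->
  (forall j, cont_martingale0 P F (X j)) ->
  (forall j, cont_martingale0 P F (Y j)) ->
  (* conformal: <X^j> = <Y^j> and <X^j, Y^j> = 0 *)
  (forall j t, 0 <= t -> exists L,
      bracket_at P (X j) (X j) t L /\ bracket_at P (Y j) (Y j) t L) ->
  (forall j t, 0 <= t -> bracket_at P (X j) (Y j) t (fun _ => 0)) ->
  (* orthogonality: <Z^j, Z^l> = 0 (complex bilinear bracket) *)
  (forall j l t, 0 <= t -> exists L,
      bracket_at P (X j) (X l) t L /\ bracket_at P (Y j) (Y l) t L) ->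
  (forall j l t, 0 <= t -> exists L,
      bracket_at P (X j) (Y l) t L /\
      bracket_at P (Y j) (X l) t (fun w => - L w)) ->
  let p : R := 2 ^+ k in
  (ereal_sup [set Lnorm P p%:E (EFin \o l2norm Y t) | t in [set t : R | (0 < t)%R]]
   <= (cot (pi / (2 * p)))%:E *
      ereal_sup [set Lnorm P p%:E (EFin \o l2norm X t) | t in [set t : R | (0 < t)%R]])%E.
Proof.
case: k => // k _ usualF mX mY conf _ orth_re orth_im.
cbv zeta; rewrite cot_bestc; set p : R := 2 ^+ k.+1; set c := bestc R k.
have c0 : 0 < c by exact: bestc_gt0.
(* It suffices to compare both sides at the same [t]. *)
apply: ge_ereal_sup => _ [t /= t0 <-].
apply: (@le_trans _ _ (c%:E * Lnorm P p%:E (EFin \o l2norm X t))%E); last first.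
  by rewrite lee_wpmul2l ?lee_fin ?(ltW c0)//; apply: ereal_sup_ubound; exists t.
pose V (a : 'I_n + 'I_n) := match a with inl j => X j | inr j => Y j end.
have mV a : cont_martingale0 P F (V a) by case: a.
have bV a : exists L, bracket_at P (V a) (V a) t L.
  by case: a => j; have [L [h1 h2]] := conf j t (ltW t0); exists L.
have dmV := grid_dyadic_martingale t0 usualF mV bV.
have small_re jl := @grid_bracket_small _ _ _ P F _ V t t0 usualF mV bV
  (inl jl.1) (inl jl.2) (inr jl.1) (inr jl.2) (-1).
have small_im jl := @grid_bracket_small _ _ _ P F _ V t t0 usualF mV bV
  (inl jl.1) (inr jl.2) (inr jl.1) (inl jl.2) 1.
pose SX w := (\sum_j X j t w ^+ 2) ^+ (2 ^ k).
pose SY w := (\sum_j Y j t w ^+ 2) ^+ (2 ^ k).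
have S0 (M : 'I_n -> R -> T -> R) w : 0 <= (\sum_j M j t w ^+ 2) ^+ (2 ^ k).
  by rewrite exprn_ge0// sumr_ge0// => j _; exact: sqr_ge0.
have mS (s : 'I_n -> 'I_n + 'I_n) : measurable_fun setT (fun w => (\sum_j V (s j) t w ^+ 2) ^+ (2 ^ k)).
  apply: measurable_funX; apply: measurable_sum => j; apply: measurable_funX.
  exact: (measurable_martingale usualF mV (s j) (ltW t0)).
rewrite !Lnorm_l2norm -/SX -/SY.
have p0 : 0 < p by rewrite exprn_gt0.
have iX0 : (0 <= \int[P]_w (SX w)%:E)%E by apply: integral_ge0 => w _; rewrite lee_fin; exact: S0.
(* If the moment of [X] is infinite, so is the right-hand side, because [c] is positive. *)
case: (eqVneq (\int[P]_w (SX w)%:E)%E +oo%E) => [->|iXfin].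
  rewrite /= invr_eq0 gt_eqF// gt0_muley ?lte_fin//.
  exact: leey.
have iX : intble P SX.
  apply/integrableP; split; first by apply/measurable_EFinP; exact: (mS inl).
  under eq_integral do rewrite /= ger0_norm ?S0//.
  by rewrite ltey.
have key : (\int[P]_w (SY w)%:E <= (c ^+ (2 ^ k.+1))%:E * \int[P]_w (SX w)%:E)%E.
  have -> : (\int[P]_w (SX w)%:E = (Ex P SX)%:E)%E.
    by rewrite /Ex /Rintegral fineK//; exact: integrable_fin_num iX.
  (* Finiteness of the moment of [Y] comes out of the bound on its truncations. *)
  apply: integral_le_truncations; [exact: (mS inr)|exact: S0|move=> L L0].
  apply: (moment_inequality dmV) => //.
    move=> jl; apply: small_re; first by rewrite normrN1.
    move=> u u0; have [L0' [h1 h2]] := orth_re jl.1 jl.2 u u0.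
    by exists L0'; exists L0' => //; move=> w; rewrite mulN1r subrr.
  move=> jl; apply: small_im; first by rewrite normr1.
  move=> u u0; have [L0' [h1 h2]] := orth_im jl.1 jl.2 u u0.
  by exists L0'; exists (fun w => - L0' w) => // w; rewrite mul1r subrr.
(* With [c] written as a [p]-th root, monotonicity of that root turns [key] into the inequality of
   norms. *)
have cE : c%:E = ((c ^+ (2 ^ k.+1))%:E `^ p^-1)%E.
  by rewrite poweR_EFin -powR_mulrn ?(ltW c0)// -powRrM natrX mulfV ?gt_eqF// powRr1 ?(ltW c0).
rewrite [X in (_ <= X * _)%E]cE -poweRM ?lee_fin ?exprn_ge0 ?(ltW c0)//.
have itv (x : \bar R) : (0%R <= x)%E -> x \in `[0%R%E, +oo%E].
  by move=> x0; rewrite in_itv /= x0 leey.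
apply: gt0_ler_poweR.
- by rewrite invr_ge0 ltW.
- by apply: itv; apply: integral_ge0 => w _; rewrite lee_fin; exact: S0.
- by apply: itv; rewrite mule_ge0// lee_fin exprn_ge0// ltW.
- exact: key.
Qed.
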